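(* Let $\mathcal{V}$ and $\mathcal{W}$ be weight function systems on $\mathbb{R}^d$ satisfying $\{\mathrm{M}\}$, $\{\mathrm{Sq}\}$, and $\{\mathrm{N}\}$. Then $\mathcal{S}^{\{\mathcal{V}\}}_{\{\mathcal{W}\}}$ and its projective description $\overline{\mathcal{S}}^{\{\mathcal{V}\}}_{\{\mathcal{W}\}}$ coincide topologically (i.e. they are equal as locally convex spaces).
   Context: Let $\mathbb{R}_+=(0,\infty)$. A weight function on $\mathbb{R}^d$ is a continuous function $\mathbb{R}^d\to[1,\infty)$. A weight function system on $\mathbb{R}^d$ is a family $\mathcal{W}=\{w^\lambda:\lambda\in\mathbb{R}_+\}$ of weight functions with $w^\lambda(x)\le w^\mu(x)$ for all $x$ whenever $\mu\le\lambda$ (here $\lambda$ is an index, not a power). Conditions on $\mathcal{W}$ (all indices in $\mathbb{R}_+$): $\{\mathrm{M}\}$ $\forall\mu,\nu\,\exists\lambda\,\exists C>0\,\forall x,y:\ w^\lambda(x+y)\le Cw^\mu(x)w^\nu(y)$; $\{\mathrm{Sq}\}$ $\forall\nu\,\exists\lambda,\mu\,\exists C>0\,\forall x:\ w^\lambda(x)w^\mu(x)\le Cw^\nu(x)$; $\{\mathrm{N}\}$ $\forall\mu\,\exists\lambda:\ w^\lambda/w^\mu\in L^1(\mathbb{R}^d)$. The Fourier transform is $\widehat\varphi(\xi)=\int\varphi(t)e^{-2\pi i\xi\cdot t}\,dt$. For non-negative functions $v,w$ on $\mathbb{R}^d$, $\mathcal{S}^v_w$ is the seminormed space of all $\varphi\in\mathcal{S}'(\mathbb{R}^d)$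 such that $\varphi$ and $\widehat\varphi$ are continuous functions and $\|\varphi\|_{\mathcal{S}^v_w}=\sup_x|\varphi(x)|w(x)+\sup_\xi|\widehat\varphi(\xi)|v(\xi)<\infty$. The space $\mathcal{S}^{\{\mathcal{V}\}}_{\{\mathcal{W}\}}=\varinjlim_{\lambda\to\infty}\mathcal{S}^{v^\lambda}_{w^\lambda}$ carries the locally convex inductive limit topology. The maximal Nachbin family $\overline{V}(\mathcal{W})$ is the set of all non-negative upper semicontinuous functions $w$ on $\mathbb{R}^d$ with $\sup_{x\in\mathbb{R}^d}w(x)/w^\lambda(x)<\infty$ for all $\lambda\in\mathbb{R}_+$. The projective description $\overline{\mathcal{S}}^{\{\mathcal{V}\}}_{\{\mathcal{W}\}}$ is the space of all $\varphi\in C(\mathbb{R}^d)$ with $\varphi\in\mathcal{S}^v_w$ for all $v\in\overline{V}(\mathcal{V})$ and $w\in\overline{V}(\mathcal{W})$, with the locally convex topology generated by the seminorms $\|\cdot\|_{\mathcal{S}^v_w}$, $v\in\overline{V}(\mathcal{V})$, $w\in\overline{V}(\mathcal{W})$. *)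

(* Defs.v *)
From HB Require Import structures.
From mathcomp Require Import all_boot all_order all_algebra.
From mathcomp Require Import all_classical all_reals all_analysis.
From mathcomp Require Import complex.

Set Implicit Arguments.
Unset Strict Implicit.
Unset Printing Implicit Defensive.

Import Order.TTheory GRing.Theory Num.Theory.
Import numFieldNormedType.Exports.

Local Open Scope classical_set_scope.
Local Open Scope ring_scope.
Local Open Scope complex_scope.

Section lebesgue_measure_Rn.
Variable R : realType.

Definition tuple_of_pair n (p : n.-tuple (measurableTypeR R) * measurableTypeR R) :
  n.+1.-tuple (measurableTypeR R) := [the n.+1.-tuple _ of p.2 :: p.1].

Lemma measurable_tuple_of_pair n : measurable_fun [set: _] (@tuple_of_pair n).
Proof. exact: measurable_cons. Qed.

(* The library has the product sigma-algebra on n-tuples and binary product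
   measures, but no Lebesgue measure on R^n: it is obtained by iteration. *)
Fixpoint lebesgue_measure_tuple n :
    {measure set (n.-tuple (measurableTypeR R)) -> \bar R} :=
  match n with
  | 0 => \d_ ([tuple] : 0.-tuple (measurableTypeR R))
  | m.+1 => measure_function_pushforward__canonical__measure_function_Measure
      (lebesgue_measure_tuple m \x (@lebesgue_measure R))%E
      (@measurable_tuple_of_pair m)
  end.

Definition row_of_tuple n (t : n.-tuple (measurableTypeR R)) : 'rV[R]_n :=
  \row_(i < n) tnth t i.

End lebesgue_measure_Rn.

Section locally_convex.
Variables (R : realType) (X : lmodType R[i]).
Implicit Types (E U : set X) (tau : set (set X)).

(* Topologies on a subspace E of X are given by their open sets, which are
   subsets of E. *)

Definition lc_topology E tau : Prop :=
  exists (T : tvsType R[i]) (f : {linear T -> X}),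
    [/\ injective f, range f = E & tau = [set f @` U | U in open]].

Definition seminorm_topology E (P : set (X -> \bar R)) : set (set X) :=
  [set U | U `<=` E /\ forall x, U x ->
     exists n (p : 'I_n -> X -> \bar R) (e : R),
       [/\ forall i, P (p i), 0 < e &
           forall y, E y -> (forall i, (p i (y - x)%R < e%:E)%E) -> U y]].

(* The finest locally convex topology on the union E of the subspaces F i for
   which every inclusion of F i, with topology sigma i, into E is continuous.
   Since a supremum of locally convex topologies with this property has it too,
   the finest one is the union of all of them. *)
Definition lc_inductive_topology I (F : I -> set X)
    (sigma : I -> set (set X)) : set (set X) :=
  [set U | exists tau, [/\ lc_topology (\bigcup_i F i) tau,
     forall i U', tau U' -> sigma i (F i `&` U') & tau U]].

End locally_convex.

Section tempered_distributions.
Variables (R : realType) (d : nat).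
Local Notation Rd := 'rV[R]_d.
Local Notation Fun := ('rV[R]_d -> R[i]^o).
Local Notation modulus := (@Normc.normc R).
Implicit Types (f g psi phi : Fun) (T : Fun -> R[i]).

Definition cintegral f : R[i] :=
  (\int[lebesgue_measure_tuple R d]_(t in setT) complex.Re (f (row_of_tuple t))) +i*
  (\int[lebesgue_measure_tuple R d]_(t in setT) complex.Im (f (row_of_tuple t))).

Definition dotprod (x y : Rd) : R := \sum_(i < d) x ord0 i * y ord0 i.

Definition fourier f : Fun := fun xi =>
  cintegral (fun t => f t * (cos (2 * pi * dotprod xi t)
                            -i* sin (2 * pi * dotprod xi t))).

(* rpartial [:: i1; ..; ik] f is the iterated partial derivative of f along
   the coordinates ik, then .., then i1; every multi-index arises this way. *)
Definition rpartial (s : seq 'I_d) (f : Rd -> R) : Rd -> R :=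
  foldr (fun i (h : Rd -> R) => 'D_(delta_mx ord0 i) h) f s.

Definition rsmooth (f : Rd -> R) : Prop := forall s,
  continuous (rpartial s f) /\
  forall i x, derivable (rpartial s f) x (delta_mx ord0 i).

Definition cpartial (s : seq 'I_d) f : Fun := fun x =>
  rpartial s (fun y => complex.Re (f y)) x +i* rpartial s (fun y => complex.Im (f y)) x.

Definition csmooth f : Prop :=
  rsmooth (fun y => complex.Re (f y)) /\ rsmooth (fun y => complex.Im (f y)).

Definition test_function : set Fun :=
  [set psi | csmooth psi /\
     exists2 K, compact K & forall x, ~ K x -> psi x = 0].

Definition schwartz_seminorm (k : nat) (s : seq 'I_d) psi : \bar R :=
  ereal_sup [set (`|x| ^+ k * modulus (cpartial s psi x))%:E | x in setT].

Definition schwartz : set Fun :=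
  [set psi | csmooth psi /\ forall k s, (schwartz_seminorm k s psi < +oo)%E].

Definition schwartz_topology : set (set Fun) :=
  seminorm_topology schwartz [set schwartz_seminorm ks.1 ks.2 | ks in setT].

(* T is only meaningful on Schwartz functions; its other values are junk. *)
Definition tempered T : Prop :=
  (forall (a : R[i]) psi1 psi2, schwartz psi1 -> schwartz psi2 ->
     T (a *: psi1 + psi2) = a * T psi1 + T psi2) /\
  (forall psi (e : R), schwartz psi -> 0 < e ->
     exists U, [/\ schwartz_topology U, U psi &
       forall psi', U psi' -> modulus (T psi' - T psi) < e]).

Definition represents f T : Prop :=
  continuous f /\
  forall psi, test_function psi -> T psi = cintegral (fun x => f x * psi x).

Definition is_fourier f g : Prop :=
  exists T, [/\ tempered T, represents f T & represents g (T \o fourier)].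

(* A tempered distribution is determined by its values on test functions, so
   there is at most one such g. *)
Definition hat phi : Fun := xget 0 [set g | is_fourier phi g].

Definition S_norm (v w : Rd -> R) phi : \bar R :=
  (ereal_sup [set (modulus (phi x) * w x)%:E | x in setT] +
   ereal_sup [set (modulus (hat phi xi) * v xi)%:E | xi in setT])%E.

Definition S_space (v w : Rd -> R) : set Fun :=
  [set phi | (exists g, is_fourier phi g) /\ (S_norm v w phi < +oo)%E].

Definition S_topology (v w : Rd -> R) : set (set Fun) :=
  seminorm_topology (S_space v w) [set S_norm v w].

End tempered_distributions.

Section weights.
Variables (R : realType) (d : nat).
Local Notation Rd := 'rV[R]_d.
Implicit Types (V W : {posnum R} -> Rd -> R).

Definition weight_function (w : Rd -> R) : Prop :=
  continuous w /\ forall x, 1 <= w x.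

Definition weight_function_system W : Prop :=
  (forall l, weight_function (W l)) /\
  (forall l m, m%:num <= l%:num -> forall x, W l x <= W m x).

Definition condM W : Prop := forall m n, exists l, exists2 C : R, 0 < C &
  forall x y, W l (x + y) <= C * W m x * W n y.

Definition condSq W : Prop := forall n, exists l m, exists2 C : R, 0 < C &
  forall x, W l x * W m x <= C * W n x.

Definition condN W : Prop := forall m, exists l,
  (lebesgue_measure_tuple R d).-integrable setT
    (fun t => (W l (row_of_tuple t) / W m (row_of_tuple t))%:E).

Definition upper_semicontinuous (w : Rd -> R) : Prop :=
  forall x a, w x < a -> \forall y \near x, w y < a.

Definition nachbin W : set (Rd -> R) :=
  [set w | [/\ forall x, 0 <= w x, upper_semicontinuous w &
     forall l, has_ubound [set w x / W l x | x in setT]]].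

Definition S_ind V W : set (Rd -> R[i]^o) :=
  \bigcup_l S_space (V l) (W l).

Definition S_ind_topology V W : set (set (Rd -> R[i]^o)) :=
  lc_inductive_topology (fun l => S_space (V l) (W l))
                        (fun l => S_topology (V l) (W l)).

Definition S_proj V W : set (Rd -> R[i]^o) :=
  [set phi | continuous phi /\
     forall v w, nachbin V v -> nachbin W w -> S_space v w phi].

Definition S_proj_topology V W : set (set (Rd -> R[i]^o)) :=
  seminorm_topology (S_proj V W)
    [set p | exists v w, [/\ nachbin V v, nachbin W w & p = S_norm v w]].

End weights.

(* Main.v *)
Require Import Defs.
From HB Require Import structures.
From mathcomp Require Import all_boot all_order all_algebra.
From mathcomp Require Import all_classical all_reals all_analysis.
From mathcomp Require Import measurable_realfun complex.
From mathcomp Require Import ring lra.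

(** Write w_n, v_n for the weights of integer index; they are cofinal. By {N},
    every element of the inductive limit is integrable together with its
    transform, so that its distributional transform [hat] is the integral
    [fourier]. This is [is_fourier_unique]: a tempered distribution represented
    by an integrable f takes the value predicted by f at the transform of a
    bump, because that transform is the limit, in the Schwartz topology, of its
    own truncations; and bumps separate continuous functions.

    Equality of the spaces ([S_ind_proj]) rests on [nachbin_bounded]: a function
    h bounded against every element of the Nachbin family is bounded against one
    w_n. Otherwise points x_n with h(x_n) w_n(x_n) > n yield constants B_k such
    that inf_k B_k w_k, an element of the family, is at least w_n at x_n.

    The elements of the Nachbin family are dominated by every weight, so the
    projective topology is a locally convex topology for which the inclusions of
    the steps are continuous ([proj_topology_lc], [proj_topology_step]); hence it
    is among those whose union is the inductive topology. Conversely, let C be a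
    convex neighbourhood of 0 for any such topology. It contains the ball of
    radius eps_m of the m-th step, for each m, and one seminorm of the projective
    description has to be found whose smallness puts phi in C
    ([ind_open_proj]). Expand phi as a superposition of time-frequency
    shifts of a fixed window whose coefficients are its short-time Fourier
    transform F ([synth_stft]). For rapidly increasing constants C_k, the k-th
    piece of F is its restriction to the points where C_k |F| w_k v_k < 1 and
    this fails for smaller k. Synthesis is bounded from coefficients to steps
    ([synth_stepball]), so that the k-th piece contributes less than
    2^-(k+2) eps_m to phi, for some m that depends on k only. By {Sq} and {M}
    the projective seminorm with suitable weights inf_k B_k w_k and
    inf_k B'_k v_k controls F against inf_k C_k^2 w_k^2 in time and
    inf_k C_k^2 v_k^2 in frequency ([nachbin_control]); when it is small, the
    product of both bounds shows that every point belongs to a piece. Finally phi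
    lies in some step, so that F decays against some w_q v_q ([stft_decay]) and
    after finitely many pieces what remains is small in one step. Thus phi is a
    convex combination of points of C ([decomposition]). *)

Set Implicit Arguments.
Unset Strict Implicit.
Unset Printing Implicit Defensive.

Import Order.TTheory GRing.Theory Num.Theory.
Import numFieldNormedType.Exports.

Local Open Scope classical_set_scope.
Local Open Scope ring_scope.
Local Open Scope complex_scope.
Local Notation Re := complex.Re.
Local Notation Im := complex.Im.

(** * Moduli and integrals of complex-valued functions *)

Section modulus.
Variable R : realType.
Implicit Types z w : R[i].
Local Notation nc := (@Normc.normc R).

Lemma nc_ge0 z : 0 <= nc z.
Proof. by case: z => a b /=; exact: sqrtr_ge0. Qed.

Lemma ncM z w : nc (z * w) = nc z * nc w.
Proof. exact: Normc.normcM. Qed.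

Lemma ncD z w : nc (z + w) <= nc z + nc w.
Proof. exact: le_normcD. Qed.

Lemma ncN z : nc (- z) = nc z.
Proof. exact: normcN. Qed.

Lemma ncB z w : nc (z - w) = nc (w - z).
Proof. by rewrite -ncN opprB. Qed.

Lemma ncJ z : nc (z^*) = nc z.
Proof. by case: z => a b /=; rewrite sqrrN. Qed.

Lemma nc0 : nc 0 = 0. Proof. exact: Normc.normc0. Qed.

Lemma nc_eq0 z : nc z = 0 -> z = 0. Proof. exact: Normc.eq0_normc. Qed.

Lemma nc_gt0 z : z <> 0 -> 0 < nc z.
Proof.
by move=> z0; rewrite lt_def nc_ge0 andbT; apply/eqP => /nc_eq0.
Qed.

Lemma ncR (x : R) : nc x%:C = `|x|.
Proof. by rewrite /= expr0n /= addr0 sqrtr_sqr. Qed.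

Lemma nc_sqr z : nc z ^+ 2 = Re z ^+ 2 + Im z ^+ 2.
Proof. by case: z => a b /=; rewrite sqr_sqrtr// addr_ge0// sqr_ge0. Qed.

Lemma norm_Re z : `|Re z| <= nc z.
Proof.
case: z => a b /=; rewrite -sqrtr_sqr; apply: ler_wsqrtr.
by rewrite lerDl sqr_ge0.
Qed.

Lemma norm_Im z : `|Im z| <= nc z.
Proof.
case: z => a b /=; rewrite -[leLHS]sqrtr_sqr; apply: ler_wsqrtr.
by rewrite lerDr sqr_ge0.
Qed.

Lemma nc_ReIm z : nc z <= `|Re z| + `|Im z|.
Proof.
rewrite {1}(complexE z); apply: le_trans (ncD _ _) _.
rewrite ncM ncR.
have -> : nc 'i = 1 by rewrite /= expr0n /= add0r expr1n sqrtr1.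
by rewrite mul1r ncR.
Qed.

Lemma normcE' z : `|z| = (nc z)%:C.
Proof. by case: z. Qed.

Lemma mulcJ_nc z : z^* * z = (nc z ^+ 2)%:C.
Proof.
rewrite nc_sqr; case: z => a b /=; apply/eqP; rewrite eq_complex /=.
by apply/andP; split; apply/eqP; ring.
Qed.

Lemma ReM_nc z w : Re (z * w) <= nc z * nc w.
Proof. by rewrite -ncM (le_trans (ler_norm _)) // norm_Re. Qed.

End modulus.

Section complex_integral.
Context d (T : measurableType d) (R : realType).
Variable mu : {measure set T -> \bar R}.
Local Notation nc := (@Normc.normc R).
Implicit Types f g : T -> R[i].

Definition cmeas f :=
  measurable_fun setT (fun x => Re (f x)) /\
  measurable_fun setT (fun x => Im (f x)).

Definition cint f : R[i] := (\int[mu]_x Re (f x)) +i* (\int[mu]_x Im (f x)).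

Definition L1 f := cmeas f /\ mu.-integrable setT (fun x => (nc (f x))%:E).

Lemma cmeas_nc f : cmeas f -> measurable_fun setT (fun x => nc (f x)).
Proof.
move=> [mr mi].
have -> : (fun x => nc (f x)) =
    (fun x => Num.sqrt (Re (f x) ^+ 2 + Im (f x) ^+ 2)).
  by apply/funext => x; case: (f x).
apply: (measurableT_comp (continuous_measurable_fun (@sqrt_continuous R))).
by apply: measurable_funD; apply: measurable_funX.
Qed.

Lemma cmeasD f g : cmeas f -> cmeas g -> cmeas (fun x => f x + g x).
Proof.
move=> [fr fi] [gr gi]; split.
  apply: eq_measurable_fun (measurable_funD fr gr) => x _ /=.
  by case: (f x) (g x) => ? ? [].
apply: eq_measurable_fun (measurable_funD fi gi) => x _ /=.
by case: (f x) (g x) => ? ? [].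
Qed.

Lemma cmeasM f g : cmeas f -> cmeas g -> cmeas (fun x => f x * g x).
Proof.
move=> [fr fi] [gr gi]; split.
  apply: eq_measurable_fun
    (measurable_funB (measurable_funM fr gr) (measurable_funM fi gi)) => x _ /=.
  by case: (f x) (g x) => ? ? [].
apply: eq_measurable_fun
  (measurable_funD (measurable_funM fr gi) (measurable_funM fi gr)) => x _ /=.
by case: (f x) (g x) => ? ? [].
Qed.

Lemma cmeas_conj f : cmeas f -> cmeas (fun x => (f x)^*).
Proof.
move=> [fr fi]; split.
  by apply: eq_measurable_fun fr => x _ /=; case: (f x).
apply: eq_measurable_fun (measurable_funN fi) => x _ /=.
by case: (f x).
Qed.

Lemma cmeas_cst (c : R[i]) : cmeas (fun=> c).
Proof. by split; exact: measurable_cst. Qed.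

Lemma cmeas_ofR (h : T -> R) : measurable_fun setT h -> cmeas (fun x => (h x)%:C).
Proof. by move=> mh; split => //=; exact: measurable_cst. Qed.

Lemma L1_dom f (g : T -> R) : cmeas f -> mu.-integrable setT (fun x => (g x)%:E) ->
  (forall x, nc (f x) <= g x) -> L1 f.
Proof.
move=> mf ig fg; split=> //; apply: le_integrable ig => //.
  by apply/measurable_EFinP; exact: cmeas_nc.
move=> x _ /=; rewrite lee_fin ger0_norm ?nc_ge0// (le_trans (fg x))//.
exact: ler_norm.
Qed.

Lemma L1_Re f : L1 f -> mu.-integrable setT (fun x => (Re (f x))%:E).
Proof.
move=> [[mr mi] fi]; apply: le_integrable fi => //; first exact/measurable_EFinP.
by move=> x _ /=; rewrite lee_fin [leRHS]ger0_norm ?nc_ge0//; exact: norm_Re.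
Qed.

Lemma L1_Im f : L1 f -> mu.-integrable setT (fun x => (Im (f x))%:E).
Proof.
move=> [[mr mi] fi]; apply: le_integrable fi => //; first exact/measurable_EFinP.
by move=> x _ /=; rewrite lee_fin [leRHS]ger0_norm ?nc_ge0//; exact: norm_Im.
Qed.

Lemma L1_bnd f g (C : R) : L1 f -> cmeas g -> (forall x, nc (g x) <= C) ->
  L1 (fun x => f x * g x).
Proof.
move=> [mf fi] mg gC.
apply: (@L1_dom _ (fun x => C * nc (f x))).
- exact: cmeasM.
- by have := integrableZl measurableT C fi.
- by move=> x; rewrite ncM mulrC ler_wpM2r ?nc_ge0.
Qed.

Lemma L1Zl f c : L1 f -> L1 (fun x => c * f x).
Proof.
move=> fi; have := L1_bnd fi (@cmeas_cst c) (fun=> lexx (nc c)).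
by congr L1; apply/funext => x; rewrite mulrC.
Qed.

Lemma L1_conj f : L1 f -> L1 (fun x => (f x)^*).
Proof.
move=> [mf fi]; apply: (L1_dom (cmeas_conj mf) fi) => x.
by rewrite ncJ.
Qed.

Lemma cintD f g : L1 f -> L1 g ->
  cint (fun x => f x + g x) = cint f + cint g.
Proof.
move=> fi gi; rewrite /cint; apply/eqP; rewrite eq_complex /=.
apply/andP; split; apply/eqP.
  rewrite -RintegralD//; [|exact: L1_Re|exact: L1_Re].
  by apply: eq_Rintegral => x _; case: (f x) (g x) => ? ? [].
rewrite -RintegralD//; [|exact: L1_Im|exact: L1_Im].
by apply: eq_Rintegral => x _; case: (f x) (g x) => ? ? [].
Qed.

Lemma cintZl f c : L1 f -> cint (fun x => c * f x) = c * cint f.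
Proof.
move=> fi; rewrite /cint; case: c => a b; apply/eqP; rewrite eq_complex /=.
have iR r := integrableZl measurableT r (L1_Re fi).
have iI r := integrableZl measurableT r (L1_Im fi).
apply/andP; split; apply/eqP.
  rewrite -!RintegralZl//; [|exact: L1_Im fi|exact: L1_Re fi].
  rewrite -RintegralB//; [|exact: iR|exact: iI].
  by apply: eq_Rintegral => x _; case: (f x).
rewrite -!RintegralZl//; [|exact: L1_Re fi|exact: L1_Im fi].
rewrite -RintegralD//; [|exact: iI|exact: iR].
by apply: eq_Rintegral => x _; case: (f x).
Qed.

Lemma cintZr f c : L1 f -> cint (fun x => f x * c) = cint f * c.
Proof.
move=> fi; rewrite mulrC -cintZl//; congr cint.
by apply/funext => x; rewrite mulrC.
Qed.

Lemma cint_conj f : L1 f -> cint (fun x => (f x)^*) = (cint f)^*.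
Proof.
move=> fi; rewrite /cint; apply/eqP; rewrite eq_complex /=.
apply/andP; split; apply/eqP.
  by apply: eq_Rintegral => x _; case: (f x).
rewrite -mulN1r -RintegralZl//; last exact: L1_Im.
by apply: eq_Rintegral => x _; rewrite mulN1r; case: (f x).
Qed.

Lemma cint_ofR (h : T -> R) : cint (fun x => (h x)%:C) = (\int[mu]_x h x)%:C.
Proof. by rewrite /cint /= Rintegral_cst// mul0r. Qed.

(** Bounding the two parts separately would lose a factor; the integral is rotated
    instead. *)
Lemma le_nc_cint f (g : T -> R) : cmeas f ->
  mu.-integrable setT (fun x => (g x)%:E) ->
  (forall x, nc (f x) <= g x) -> nc (cint f) <= \int[mu]_x g x.
Proof.
move=> mf ig fg; have fi := L1_dom mf ig fg.
have [/eqP|z0] := eqVneq (nc (cint f)) 0.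
  move=> /eqP ->; apply: Rintegral_ge0 => x _.
  exact: le_trans (nc_ge0 _) (fg x).
have zgt : 0 < nc (cint f) by rewrite lt_def z0 nc_ge0.
(* rotate the integral onto the positive real axis *)
rewrite -(ler_pM2l zgt) -expr2.
have -> : nc (cint f) ^+ 2 = Re ((cint f)^* * cint f).
  by rewrite mulcJ_nc.
rewrite -cintZl// -RintegralZl// /cint; apply: le_Rintegral => //.
- exact: L1_Re (L1Zl _ fi).
- by have := integrableZl measurableT (nc (cint f)) ig.
- move=> x _; apply: le_trans (ReM_nc _ _) _.
  by rewrite ncJ ler_wpM2l ?nc_ge0.
Qed.

Lemma cvg_ReIm (u : R[i] ^nat) (l : R[i]) :
  (Re (u n) @[n --> \oo] --> Re l) -> (Im (u n) @[n --> \oo] --> Im l) ->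
  nc (u n - l) @[n --> \oo] --> (0 : R).
Proof.
move=> ur ui.
have h : (`|Re (u n) - Re l| + `|Im (u n) - Im l|) @[n --> \oo] --> (0 : R).
  rewrite -(addr0 (0:R)); apply: cvgD.
    rewrite -(normr0 R) -(subrr (Re l)); apply: cvg_norm; apply: cvgB => //.
    exact: cvg_cst.
  rewrite -(normr0 R) -(subrr (Im l)); apply: cvg_norm; apply: cvgB => //.
  exact: cvg_cst.
apply: (squeeze_cvgr _ (cvg_cst 0) h); apply: nearW => n.
rewrite nc_ge0 /=; apply: le_trans (nc_ReIm _) _.
by case: (u n) l {ur ui h} => a b [].
Qed.

(** The real and the imaginary parts are dominated separately. *)
Lemma cint_dct (f_ : (T -> R[i])^nat) f (g : T -> R) :
  (forall n, cmeas (f_ n)) -> cmeas f ->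
  (forall x, nc (f_ n x - f x) @[n --> \oo] --> (0 : R)) ->
  mu.-integrable setT (fun x => (g x)%:E) ->
  (forall n x, nc (f_ n x) <= g x) ->
  nc (cint (f_ n) - cint f) @[n --> \oo] --> (0 : R).
Proof.
move=> mf_ mf cv ig dom.
have domf x : nc (f x) <= g x.
  have h : (fun n => nc (f_ n x - f x) + g x) @ \oo --> (0 + g x).
    by apply: cvgD; [exact: cv|exact: cvg_cst].
  rewrite add0r in h.
  apply/ler_addgt0Pr => e e0.
  have /cvgr_lt/(_ (g x + e)) := h; rewrite ltrDl => /(_ e0) [n _ /(_ n (leqnn n)) /= hn].
  apply: le_trans _ (ltW hn).
  have -> : f x = f_ n x - (f_ n x - f x) by rewrite opprB addrC subrK.
  apply: le_trans (ncD _ _) _; rewrite ncN addrC opprB.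
  by rewrite addrCA subrr addr0 lerD2l.
have reim (phi : R[i] -> R) : (forall z, `|phi z| <= nc z) ->
    (forall z w, phi (z - w) = phi z - phi w) ->
    (forall n, measurable_fun setT (fun x => phi (f_ n x))) ->
    measurable_fun setT (fun x => phi (f x)) ->
  \int[mu]_x phi (f_ n x) @[n --> \oo] --> \int[mu]_x phi (f x).
  move=> ph1 ph2 mph_ mph.
  have [|||||fint _ h] := @dominated_convergence _ _ R mu setT measurableT
    (fun n x => (phi (f_ n x))%:E) (fun x => (phi (f x))%:E) (fun x => (g x)%:E).
  - by move=> n; exact/measurable_EFinP.
  - exact/measurable_EFinP.
  - apply: nearW => x _; apply: cvg_EFin; first exact: nearW.
    apply/cvgrPdist_lt => e e0.
    have /cvgrPdist_lt/(_ _ e0) := cv x; apply: filterS => n.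
    rewrite sub0r normrN ger0_norm ?nc_ge0// => hh.
    by apply: le_lt_trans hh; rewrite -ph2 (le_trans (ph1 _))// -ncN opprB.
  - exact: ig.
  - by apply: nearW => x n _ /=; rewrite lee_fin (le_trans (ph1 _)).
  by rewrite /Rintegral; apply: fine_cvg; rewrite fineK//;
     exact: integrable_fin_num fint.
apply: cvg_ReIm => /=.
  apply: (reim (@Re R)) => //.
  - exact: norm_Re.
  - by case=> ? ? [].
  - by move=> n; case: (mf_ n).
  - by case: mf.
apply: (reim (@Im R)) => //.
- exact: norm_Im.
- by case=> ? ? [].
- by move=> n; case: (mf_ n).
- by case: mf.
Qed.

End complex_integral.

Lemma cmeas_comp d1 d2 (T1 : measurableType d1) (T2 : measurableType d2)
    (R : realType) (f : T2 -> R[i]) (h : T1 -> T2) :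
  cmeas f -> measurable_fun setT h -> cmeas (fun x => f (h x)).
Proof.
by move=> [fr fi] mh; split; [exact: (measurableT_comp fr)|exact: (measurableT_comp fi)].
Qed.

Section complex_fubini.
Context d1 d2 (T1 : measurableType d1) (T2 : measurableType d2) (R : realType).
Variables (m1 : {sigma_finite_measure set T1 -> \bar R}).
Variables (m2 : {sigma_finite_measure set T2 -> \bar R}).
Local Notation nc := (@Normc.normc R).
Variable f : T1 * T2 -> R[i].
Hypothesis f1 : L1 (m1 \x m2)%E f.

Let fubR (h : T1 * T2 -> R) :
  (m1 \x m2)%E.-integrable setT (EFin \o h) ->
  (forall x, m2.-integrable setT (fun y => (h (x, y))%:E)) ->
  \int[(m1 \x m2)%E]_z h z = \int[m1]_x (\int[m2]_y h (x, y)).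
Proof.
move=> hi hx; rewrite /Rintegral -integral12_prod_meas1//.
congr fine; apply: eq_integral => x _ /=.
by rewrite /fubini_F fineK//; exact: integrable_fin_num (hx x).
Qed.

Let fubR' (h : T1 * T2 -> R) :
  (m1 \x m2)%E.-integrable setT (EFin \o h) ->
  (forall y, m1.-integrable setT (fun x => (h (x, y))%:E)) ->
  \int[(m1 \x m2)%E]_z h z = \int[m2]_y (\int[m1]_x h (x, y)).
Proof.
move=> hi hx; rewrite /Rintegral -integral21_prod_meas1//.
congr fine; apply: eq_integral => x _ /=.
by rewrite /fubini_G fineK//; exact: integrable_fin_num (hx x).
Qed.

Lemma cint_fubini1 : (forall x, L1 m2 (fun y => f (x, y))) ->
  cint (m1 \x m2)%E f = cint m1 (fun x => cint m2 (fun y => f (x, y))).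
Proof.
move=> fx; rewrite /cint /=; congr Complex.
  by apply: fubR => [|x]; [exact: L1_Re|exact: L1_Re (fx x)].
by apply: fubR => [|x]; [exact: L1_Im|exact: L1_Im (fx x)].
Qed.

Lemma cint_fubini2 : (forall y, L1 m1 (fun x => f (x, y))) ->
  cint (m1 \x m2)%E f = cint m2 (fun y => cint m1 (fun x => f (x, y))).
Proof.
move=> fx; rewrite /cint /=; congr Complex.
  by apply: fubR' => [|x]; [exact: L1_Re|exact: L1_Re (fx x)].
by apply: fubR' => [|x]; [exact: L1_Im|exact: L1_Im (fx x)].
Qed.

End complex_fubini.

(** * Lebesgue measure on tuples *)

(** Preimages of intervals are intervals of length divided by |c|, and Lebesgue
    measure is determined by its values on intervals. *)
Lemma lebesgue_measure_affine (R : realType) (c a : R) (A : set R) : c != 0 ->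
  measurable A ->
  lebesgue_measure ((fun x => c * x + a) @^-1` A) =
  (`|c|^-1%:E * lebesgue_measure A)%E.
Proof.
move=> c0 mA.
pose phi : measurableTypeR R -> measurableTypeR R := fun x => c * x + a.
have mphi : measurable_fun [set: measurableTypeR R] phi.
  apply: (@continuous_measurable_fun R) => x.
  by apply: cvgD; [apply: cvgM; [exact: cvg_cst|exact: cvg_id]|exact: cvg_cst].
pose M := mscale (NngNum (normr_ge0 c))
  (measure_function_pushforward__canonical__measure_function_Measure
    (@lebesgue_measure R) mphi).
have cgt : 0 < `|c| by rewrite normr_gt0.
suff -> : lebesgue_measure A = M A.
  by rewrite /M /mscale /= muleA -EFinM mulVf ?mul1e// gt_eqF.
apply: lebesgue_measure_unique => //= X /ocitvP[->|[[p q] /= pq ->]].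
  by rewrite measure0 measure0.
rewrite /M /mscale /= /pushforward lebesgue_measure_itv /= lte_fin pq.
have [cp|cn|/eqP] := ltrgtP 0 c; last by rewrite eq_sym (negbTE c0).
  have -> : phi @^-1` `]p, q] = `](p - a) / c, (q - a) / c]%classic.
    apply/seteqP; split => x /=; rewrite !in_itv /= /phi ltr_pdivrMr// ler_pdivlMr//;
    by rewrite ltrBlDr lerBrDr mulrC.
  rewrite lebesgue_measure_itv /= lte_fin ltr_pM2r ?invr_gt0// ltrD2r pq.
  rewrite -!EFinB -EFinM gtr0_norm//; congr EFin; field.
  by rewrite gt_eqF.
have -> : phi @^-1` `]p, q] = `[(q - a) / c, (p - a) / c[%classic.
  apply/seteqP; split => x /=; rewrite !in_itv /= /phi ler_ndivrMr// ltr_ndivlMr//;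
  by rewrite ltrBlDr lerBrDr mulrC andbC.
rewrite lebesgue_measure_itv /= lte_fin ltr_nM2r ?invr_lt0// ltrD2r pq.
rewrite -!EFinB -EFinM ltr0_norm//; congr EFin; field.
by rewrite lt_eqF.
Qed.

Section tuple_measure.
Variable R : realType.
Local Notation TR := (measurableTypeR R).
Local Notation lam := (@lebesgue_measure R).

(** The same function as [lebesgue_measure_tuple], under a head symbol on which
    the measure instances can be declared. *)
Definition lebT n : set (n.-tuple TR) -> \bar R := lebesgue_measure_tuple R n.

HB.instance Definition _ n := Measure.copy (@lebT n) (lebesgue_measure_tuple R n).

Definition pair_of_tuple n (t : n.+1.-tuple TR) : n.-tuple TR * TR :=
  ([tuple of behead t], thead t).

Lemma tuple_of_pairK n (p : n.-tuple TR * TR) : pair_of_tuple (tuple_of_pair p) = p.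
Proof.
by case: p => x y; rewrite /pair_of_tuple; congr pair; exact: val_inj.
Qed.

Lemma measurable_pair_of_tuple n : measurable_fun setT (@pair_of_tuple n).
Proof.
by apply: measurable_fun_pair; [exact: measurable_behead|exact: measurable_tnth].
Qed.

Lemma lebT_sigma_finite n : sigma_finite setT (@lebT n).
Proof.
elim: n => [|n [F FT Ffin]].
  exists (fun=> setT); first by rewrite bigcup_const.
  by move=> i; split => //; rewrite /lebT /= diracT ltry.
have /sigma_finiteP [G [GT Gnd Gfin]] := sigma_finiteT lam.
have /sigma_finiteP [F' [FT' Fnd Ffin']] : sigma_finite setT (@lebT n) by exists F.
exists (fun i => @pair_of_tuple n @^-1` (F' i `*` G i)).
  rewrite -preimage_bigcup; apply/esym/seteqP; split=> // t _ /=.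
  have : [set: n.-tuple TR] (pair_of_tuple t).1 by [].
  have : [set: TR] (pair_of_tuple t).2 by [].
  rewrite FT' GT => -[i _ Gi] [j _ Fj]; exists (maxn i j) => //=; split.
    by apply: (subsetPset _ _ (Fnd _ _ (leq_maxr i j))).
  by apply: (subsetPset _ _ (Gnd _ _ (leq_maxl i j))).
move=> i; have [mF Fo] := Ffin' i; have [mG Go] := Gfin i; split.
  rewrite -[X in measurable X]setTI; apply: measurable_pair_of_tuple => //.
  exact: measurableX.
rewrite /lebT /= /pushforward.
have -> : @tuple_of_pair R n @^-1` (@pair_of_tuple n @^-1` (F' i `*` G i)) =
    F' i `*` G i.
  by apply/seteqP; split => p; rewrite /preimage /mkset tuple_of_pairK.
rewrite product_measure1E// lte_mul_pinfty//.
by rewrite ge0_fin_numE.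
Qed.

HB.instance Definition _ n :=
  @Measure_isSigmaFinite.Build _ _ _ (@lebT n) (@lebT_sigma_finite n).

Lemma ge0_integral_lebTS n (f : n.+1.-tuple TR -> \bar R) :
  measurable_fun setT f -> (forall t, (0 <= f t)%E) ->
  (\int[@lebT n.+1]_t f t = \int[@lebT n]_x \int[lam]_y f (tuple_of_pair (x, y)))%E.
Proof.
move=> mf f0.
have := @ge0_integral_pushforward _ _ _ _ R _ (@measurable_tuple_of_pair R n)
  (@lebT n \x lam)%E setT f measurableT mf (fun t _ => f0 t).
rewrite preimage_setT => h.
transitivity (\int[(@lebT n \x lam)%E]_x (f \o @tuple_of_pair R n) x)%E.
  by rewrite -h; exact: (@eq_measure_integral _ _ _ _
    (measure_function_pushforward__canonical__measure_function_Measure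
      (@lebT n \x lam)%E (@measurable_tuple_of_pair R n))).
rewrite fubini_tonelli1//; last by move=> x; exact: f0.
by apply: measurableT_comp => //; exact: measurable_tuple_of_pair.
Qed.

Lemma cint_lebTS n (f : n.+1.-tuple TR -> R[i]) : cmeas f ->
  L1 (@lebT n \x lam)%E (fun p => f (tuple_of_pair p)) ->
  cint (@lebT n.+1) f = cint (@lebT n \x lam)%E (fun p => f (tuple_of_pair p)).
Proof.
move=> mf fi.
have key (h : n.+1.-tuple TR -> R) : measurable_fun setT h ->
  (@lebT n \x lam)%E.-integrable setT (fun p => (h (tuple_of_pair p))%:E) ->
  \int[@lebT n.+1]_t h t = \int[(@lebT n \x lam)%E]_p h (tuple_of_pair p).
  move=> mh hi.
  have := @integral_pushforward _ _ _ _ R _ (@measurable_tuple_of_pair R n)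
    (@lebT n \x lam)%E setT (EFin \o h).
  rewrite preimage_setT => /(_ _ _ measurableT) h'.
  rewrite /Rintegral; congr fine; rewrite -h' //; exact/measurable_EFinP.
rewrite /cint; congr Complex; apply: key.
- by case: mf.
- exact: L1_Re.
- by case: mf.
- exact: L1_Im.
Qed.

Definition amap n (c : R) (a t : n.-tuple TR) : n.-tuple TR :=
  [tuple c * tnth t i + tnth a i | i < n].

Lemma measurable_amap n c (a : n.-tuple TR) : measurable_fun setT (amap c a).
Proof.
apply/measurable_fun_tnthP => i.
have -> : tnth (T:=TR) ^~ i \o amap c a = fun t => c * tnth t i + tnth a i.
  by apply/funext => t /=; rewrite tnth_mktuple.
apply: measurable_funD; last exact: measurable_cst.
by apply: measurable_funM; [exact: measurable_cst|exact: measurable_tnth].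
Qed.

Lemma amapS n c (a : n.+1.-tuple TR) (x : n.-tuple TR) (y : TR) :
  amap c a (tuple_of_pair (x, y)) =
  tuple_of_pair (amap c [tuple of behead a] x, c * y + thead a).
Proof.
apply: eq_from_tnth => i; rewrite tnth_mktuple.
have [j ->|->] := unliftP ord0 i; last first.
  by rewrite /thead !(tnth_nth y).
rewrite [a in LHS]tuple_eta /tuple_of_pair !tnthS /=.
by rewrite tnth_mktuple.
Qed.

Lemma lebT_affine n (c : R) (a : n.-tuple TR) (A : set (n.-tuple TR)) :
  c != 0 -> measurable A ->
  lebT (amap c a @^-1` A) = ((`|c| ^+ n)^-1%:E * lebT A)%E.
Proof.
move=> c0; elim: n a A => [|n IH] a A mA.
  rewrite expr0 invr1 mul1e; congr lebT; apply/seteqP; split=> t /=;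
  by rewrite (tuple0 (amap c a t)) (tuple0 t).
have mA' : measurable (@tuple_of_pair R n @^-1` A).
  by rewrite -[X in measurable X]setTI; exact: measurable_tuple_of_pair.
pose h x := lam (xsection (@tuple_of_pair R n @^-1` A) x).
have mh : measurable_fun setT h by apply: measurable_fun_xsection.
have step x : lam (xsection (@tuple_of_pair R n @^-1` (amap c a @^-1` A)) x) =
    (`|c|^-1%:E * h (amap c [tuple of behead a] x))%E.
  rewrite /h -(@lebesgue_measure_affine R c (thead a))//.
    congr (lam _); apply/seteqP; split => y; rewrite /xsection /= !inE /=;
    by rewrite amapS.
  exact: measurable_xsection.
rewrite {1}/lebT /= /pushforward /product_measure1 /=.
rewrite (eq_integral (fun x => `|c|^-1%:E * h (amap c [tuple of behead a] x))%E);
  last by move=> x _; exact: step.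
rewrite ge0_integralZl//=; last first.
  by apply: (measurableT_comp mh); exact: measurable_amap.
have := @ge0_integral_pushforward _ _ _ _ R _
  (@measurable_amap n c [tuple of behead a]) (@lebT n) setT h measurableT mh.
rewrite preimage_setT => <- //.
have k0 : 0 <= (`|c| ^+ n)^-1 by rewrite invr_ge0 exprn_ge0.
rewrite (@eq_measure_integral _ _ _ _ (mscale (NngNum k0) (@lebT n))); last 2 first.
- exact: measurable_amap.
- by move=> ? B mB _; rewrite /= /pushforward IH.
rewrite ge0_integral_mscale//= muleA -EFinM -invfM -exprS.
by [].
Qed.

Lemma ge0_integral_amap n (c : R) (a : n.-tuple TR) (f : n.-tuple TR -> \bar R) :
  c != 0 -> measurable_fun setT f -> (forall t, (0 <= f t)%E) ->
  (\int[@lebT n]_t f (amap c a t) = (`|c| ^+ n)^-1%:E * \int[@lebT n]_t f t)%E.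
Proof.
move=> c0 mf f0.
have k0 : 0 <= (`|c| ^+ n)^-1 by rewrite invr_ge0 exprn_ge0.
have := @ge0_integral_pushforward _ _ _ _ R _
  (@measurable_amap n c a) (@lebT n) setT f measurableT mf (fun t _ => f0 t).
rewrite preimage_setT => <-.
rewrite (@eq_measure_integral _ _ _ _ (mscale (NngNum k0) (@lebT n))); last 2 first.
- exact: measurable_amap.
- by move=> ? B mB _; rewrite /= /pushforward lebT_affine.
by rewrite ge0_integral_mscale.
Qed.

Lemma integrable_amap n (c : R) (a : n.-tuple TR) (f : n.-tuple TR -> R) :
  c != 0 -> (@lebT n).-integrable setT (EFin \o f) ->
  (@lebT n).-integrable setT (fun t => (f (amap c a t))%:E).
Proof.
move=> c0 /integrableP [mf fi]; apply/integrableP; split.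
  by apply: (measurableT_comp mf); exact: measurable_amap.
rewrite (ge0_integral_amap a (f := fun t => `|(f t)%:E|%E) c0)//; last first.
  exact: measurableT_comp.
by rewrite lte_mul_pinfty// ?lee_fin ?invr_ge0 ?exprn_ge0.
Qed.

Lemma Rintegral_amap n (c : R) (a : n.-tuple TR) (f : n.-tuple TR -> R) :
  c != 0 -> (@lebT n).-integrable setT (EFin \o f) ->
  \int[@lebT n]_t f (amap c a t) = (`|c| ^+ n)^-1 * \int[@lebT n]_t f t.
Proof.
move=> c0 fi.
have mf : measurable_fun setT (EFin \o f) by case/integrableP : fi.
have fa := integrable_amap a c0 fi.
rewrite /Rintegral [X in fine X = _]integralE [X in _ = _ * fine X]integralE.
have -> : (\int[@lebT n]_t (fun u => (f (amap c a u))%:E)^\- t =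
    \int[@lebT n]_t ((EFin \o f)^\- (amap c a t)))%E.
  by apply: eq_integral => t _; rewrite !funenegE.
have -> : (\int[@lebT n]_t (fun u => (f (amap c a u))%:E)^\+ t =
    \int[@lebT n]_t ((EFin \o f)^\+ (amap c a t)))%E.
  by apply: eq_integral => t _; rewrite !funeposE.
rewrite !ge0_integral_amap//; [|exact: measurable_funeneg|exact: measurable_funepos].
have fp := integrable_fin_num measurableT (integrable_funepos measurableT fi).
have fn := integrable_fin_num measurableT (integrable_funeneg measurableT fi).
rewrite -[X in _ = _ * fine (X - _)%E](fineK fp).
rewrite -[X in _ = _ * fine (_ - X)%E](fineK fn).
by rewrite -(fineK fp) -(fineK fn) -!EFinM -!EFinB /= mulrBr.
Qed.

Lemma L1_amap n (c : R) (a : n.-tuple TR) (f : n.-tuple TR -> R[i]) :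
  c != 0 -> L1 (@lebT n) f -> L1 (@lebT n) (fun t => f (amap c a t)).
Proof.
move=> c0 [mf fi]; split.
  by apply: cmeas_comp => //; exact: measurable_amap.
exact: (@integrable_amap n c a (fun t => Normc.normc (f t))).
Qed.

Lemma cint_amap n (c : R) (a : n.-tuple TR) (f : n.-tuple TR -> R[i]) :
  c != 0 -> L1 (@lebT n) f ->
  cint (@lebT n) (fun t => f (amap c a t)) =
  ((`|c| ^+ n)^-1)%:C * cint (@lebT n) f.
Proof.
move=> c0 fi; rewrite /cint.
rewrite (@Rintegral_amap n c a (fun t => Re (f t)) c0 (L1_Re fi)).
rewrite (@Rintegral_amap n c a (fun t => Im (f t)) c0 (L1_Im fi)).
by apply/eqP; rewrite eq_complex /= !mul0r subr0 addr0 !eqxx.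
Qed.

End tuple_measure.

Section measurable_continuous.
Variables (R : realType) (d : nat).
Local Notation Rd := 'rV[R]_d.
Context dx (X : measurableType dx).

(** Measurability of a map to row vectors, read off the coordinates. *)
Definition vmeas (u : X -> Rd) :=
  forall i, measurable_fun setT (fun x => u x ord0 i).

(** Rounding down to the lattice of mesh 1/(k+1), indexed by a countable type. *)
Let grid k (x : Rd) : 'rV[int]_d := \row_i Num.floor (k.+1%:R * x ord0 i).
Let ungrid k (z : 'rV[int]_d) : Rd := \row_i ((z ord0 i)%:~R / k.+1%:R).

Lemma rV_norm_le (x : Rd) (e : R) : 0 <= e ->
  (forall i, `|x ord0 i| <= e) -> `|x| <= e.
Proof.
move=> e0 xe; rewrite /Num.norm /=; have [->//|/mx_norm_neq0 [[i j] ->]] := eqVneq (mx_norm x) 0.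
by rewrite (ord1 i); exact: xe.
Qed.

Let grid_near k x : `|x - ungrid k (grid k x)| <= k.+1%:R^-1.
Proof.
apply: rV_norm_le; first by rewrite invr_ge0.
move=> i; rewrite !mxE.
have k0 : 0 < k.+1%:R :> R by rewrite ltr0n.
have /andP[f1 f2] := floor_itv (k.+1%:R * x ord0 i).
have -> : x ord0 i - (Num.floor (k.+1%:R * x ord0 i))%:~R / k.+1%:R =
    (k.+1%:R * x ord0 i - (Num.floor (k.+1%:R * x ord0 i))%:~R) / k.+1%:R.
  by field; rewrite gt_eqF.
rewrite ger0_norm; last by rewrite divr_ge0 ?subr_ge0// ltW.
rewrite ler_pdivrMr// mulVf ?gt_eqF// lerBlDl ltW//.
by rewrite (lt_le_trans f2)// intrD.
Qed.

(** A continuous F is the pointwise limit of its values at lattice points, which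
    depend measurably on the coordinates. *)
Lemma measurable_continuous2 (F : Rd * Rd -> R) (u v : X -> Rd) :
  continuous F -> vmeas u -> vmeas v -> measurable_fun setT (fun x => F (u x, v x)).
Proof.
move=> cF mu mv.
pose h k x := F (ungrid k (grid k (u x)), ungrid k (grid k (v x))).
have mgrid w k z : vmeas w -> measurable [set x | grid k (w x) = z].
  move=> mw.
  have -> : [set x | grid k (w x) = z] =
      \bigcap_(i in [set: 'I_d]) [set x | Num.floor (k.+1%:R * w x ord0 i) = z ord0 i].
    apply/seteqP; split => x /=; first by move=> <- i _; rewrite mxE.
    by move=> H; apply/rowP => i; rewrite mxE; apply: H.
  apply: fin_bigcap_measurable => // i _.
  have -> : [set x | Num.floor (k.+1%:R * w x ord0 i) = z ord0 i] =
    setT `&` (fun x => k.+1%:R * w x ord0 i) @^-1` `[(z ord0 i)%:~R, (z ord0 i + 1)%:~R[.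
    rewrite setTI; apply/seteqP; split => x /=; rewrite in_itv /=.
      by move=> <-; exact: floor_itv.
    by move=> H; apply: floor_def.
  suff H : measurable_fun setT (fun x => k.+1%:R * w x ord0 i) by apply: H.
  by apply: measurable_funM; [exact: measurable_cst|exact: mw].
apply: (@measurable_fun_cvg _ _ _ _ h).
  move=> k _ Y mY; rewrite setTI.
  have -> : h k @^-1` Y = \bigcup_zz
     (if `[< Y (F (ungrid k zz.1, ungrid k zz.2)) >] then
        [set x | grid k (u x) = zz.1] `&` [set x | grid k (v x) = zz.2] else set0).
    apply/seteqP; split => x /=.
      move=> hY; exists (grid k (u x), grid k (v x)) => //=.
      by rewrite asboolT.
    by move=> [[z1 z2] _ /=]; case: asboolP => // hY [/= e1 e2]; rewrite /h e1 e2.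
  apply: countable_bigcupT_measurable => // zz.
  by case: asboolP => _ //; apply: measurableI; exact: mgrid.
move=> x _; apply: (cvg_comp _ F _ (cF (u x, v x))).
have cg (y : Rd) : ungrid k (grid k y) @[k --> \oo] --> y.
  apply/cvgrPdist_le => e e0.
  have := near_infty_natSinv_lt (PosNum e0); apply: filterS => k /= ke.
  exact: le_trans (grid_near k y) (ltW ke).
exact: (cvg_pair (cg (u x)) (cg (v x))).
Qed.

Lemma measurable_continuous (F : Rd -> R) (u : X -> Rd) :
  continuous F -> vmeas u -> measurable_fun setT (fun x => F (u x)).
Proof.
move=> cF mu; apply: (@measurable_continuous2 (F \o fst) u u) => //.
by move=> p; apply: continuous_comp; [exact: cvg_fst|exact: cF].
Qed.

Lemma vmeasD u v : vmeas u -> vmeas v -> vmeas (fun x => u x + v x).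
Proof.
move=> mu mv i; have := measurable_funD (mu i) (mv i).
by apply: eq_measurable_fun => x _; rewrite mxE.
Qed.

Lemma vmeasB u v : vmeas u -> vmeas v -> vmeas (fun x => u x - v x).
Proof.
move=> mu mv i; have := measurable_funB (mu i) (mv i).
by apply: eq_measurable_fun => x _; rewrite !mxE.
Qed.

Lemma vmeasZ c u : vmeas u -> vmeas (fun x => c *: u x).
Proof.
move=> mu i; have := measurable_funM (measurable_cst c) (mu i).
by apply: eq_measurable_fun => x _; rewrite !mxE.
Qed.

Lemma vmeas_cst c : vmeas (fun=> c).
Proof. by move=> i; exact: measurable_cst. Qed.

End measurable_continuous.

(** * Continuity, characters and Fourier integrals *)

Section continuity_shortcuts.
Variables (R : realType) (T U W : topologicalType).
Implicit Types f g : T -> R.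

Lemma contD f g : continuous f -> continuous g -> continuous (fun x => f x + g x).
Proof. by move=> cf cg x; apply: cvgD; [exact: cf|exact: cg]. Qed.

Lemma contB f g : continuous f -> continuous g -> continuous (fun x => f x - g x).
Proof. by move=> cf cg x; apply: cvgB; [exact: cf|exact: cg]. Qed.

Lemma contM f g : continuous f -> continuous g -> continuous (fun x => f x * g x).
Proof. by move=> cf cg x; apply: cvgM; [exact: cf|exact: cg]. Qed.

Lemma contN f : continuous f -> continuous (fun x => - f x).
Proof. by move=> cf x; apply: cvgN; exact: cf. Qed.

Lemma cont_cst (c : U) : continuous (fun _ : T => c).
Proof. by move=> x; exact: cvg_cst. Qed.

Lemma cont_id : continuous (fun x : T => x).
Proof. by move=> x; exact: cvg_id. Qed.

Lemma cont_comp (f : U -> W) (g : T -> U) :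
  continuous f -> continuous g -> continuous (fun x => f (g x)).
Proof. by move=> cf cg x; exact: (continuous_comp (cg x) (cf (g x))). Qed.

Lemma cont_fst : continuous (@fst T U).
Proof. by move=> x; exact: cvg_fst. Qed.

Lemma cont_snd : continuous (@snd T U).
Proof. by move=> x; exact: cvg_snd. Qed.

Lemma cont_pair (f : T -> U) (g : T -> W) :
  continuous f -> continuous g -> continuous (fun x => (f x, g x)).
Proof. by move=> cf cg x; exact: (cvg_pair (cf x) (cg x)). Qed.

End continuity_shortcuts.

Section complex_continuity.
Variables (R : realType) (T : topologicalType).
Local Notation nc := (@Normc.normc R).
Implicit Types f g : T -> R[i].

Definition ccont f :=
  continuous (fun x => Re (f x)) /\ continuous (fun x => Im (f x)).

Lemma ccont_nearP f : ccont f <->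
  forall x (e : R), 0 < e -> \forall y \near x, nc (f x - f y) < e.
Proof.
split=> [[cr ci] x e e0|H].
  have e2 : 0 < e / 2 by rewrite divr_gt0.
  have /cvgrPdist_lt/(_ _ e2) hr := cr x.
  have /cvgrPdist_lt/(_ _ e2) hi := ci x.
  near=> y; apply: le_lt_trans (nc_ReIm _) _.
  rewrite (splitr e); apply: ltrD.
    have : `|Re (f x) - Re (f y)| < e / 2 by near: y.
    by case: (f x) (f y) => ? ? [].
  have : `|Im (f x) - Im (f y)| < e / 2 by near: y.
  by case: (f x) (f y) => ? ? [].
split=> x; apply/cvgrPdist_lt => e e0; have := H x e e0; apply: filterS => y;
  apply: le_lt_trans.
  by apply: le_trans (norm_Re _); case: (f x) (f y) => ? ? [].
by apply: le_trans (norm_Im _); case: (f x) (f y) => ? ? [].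
Unshelve. all: by end_near. Qed.

Lemma ccontP (f : T -> R[i]^o) : continuous f <-> ccont f.
Proof.
rewrite ccont_nearP; split=> [cf x e e0|H x].
  have e0' : 0 < e%:C by rewrite ltcR.
  have /cvgrPdist_lt/(_ _ e0') := cf x; apply: filterS => y.
  by rewrite normcE' ltcR.
apply/cvgrPdist_lt => e; rewrite ltcE /= => /andP[/eqP ie re].
have := H x _ re; apply: filterS => y hy.
by rewrite normcE' ltcE /= ie eqxx.
Qed.

Lemma ccontD f g : ccont f -> ccont g -> ccont (fun x => f x + g x).
Proof.
move=> [fr fi] [gr gi]; split => x.
  have -> : (fun x => Re (f x + g x)) = (fun x => Re (f x) + Re (g x)).
    by apply/funext => y; case: (f y) (g y) => ? ? [].
  by apply: cvgD; [exact: fr|exact: gr].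
have -> : (fun x => Im (f x + g x)) = (fun x => Im (f x) + Im (g x)).
  by apply/funext => y; case: (f y) (g y) => ? ? [].
by apply: cvgD; [exact: fi|exact: gi].
Qed.

Lemma ccontM f g : ccont f -> ccont g -> ccont (fun x => f x * g x).
Proof.
move=> [fr fi] [gr gi]; split => x.
  have -> : (fun x => Re (f x * g x)) =
      (fun x => Re (f x) * Re (g x) - Im (f x) * Im (g x)).
    by apply/funext => y; case: (f y) (g y) => ? ? [].
  apply: cvgB; apply: cvgM; by [exact: fr|exact: gr|exact: fi|exact: gi].
have -> : (fun x => Im (f x * g x)) =
    (fun x => Re (f x) * Im (g x) + Im (f x) * Re (g x)).
  by apply/funext => y; case: (f y) (g y) => ? ? [].
apply: cvgD; apply: cvgM; by [exact: fr|exact: gr|exact: fi|exact: gi].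
Qed.

Lemma ccont_conj f : ccont f -> ccont (fun x => (f x)^*).
Proof.
move=> [fr fi]; split => x.
  have -> : (fun x => Re (f x)^*) = (fun x => Re (f x)).
    by apply/funext => y; case: (f y).
  exact: fr.
have -> : (fun x => Im (f x)^*) = (fun x => - Im (f x)).
  by apply/funext => y; case: (f y).
by apply: cvgN; exact: fi.
Qed.

Lemma ccont_cst (c : R[i]) : ccont (fun=> c).
Proof. by split=> x; exact: cvg_cst. Qed.

Lemma ccont_ofR (h : T -> R) : continuous h -> ccont (fun x => (h x)%:C).
Proof. by move=> ch; split => //= x; exact: cvg_cst. Qed.

Lemma ccont_nc f : ccont f -> continuous (fun x => nc (f x)).
Proof.
move=> /ccont_nearP cf x; apply/cvgrPdist_lt => e e0.
have := cf x e e0; apply: filterS => y; apply: le_lt_trans.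
have nB (z w : R[i]) : nc z - nc w <= nc (z - w).
  by rewrite lerBlDr -{1}(subrK w z) ncD.
by rewrite ler_norml nB andbT lerNl opprB ncB nB.
Qed.

End complex_continuity.

Lemma ccont_comp (R : realType) (T U : topologicalType) (f : U -> R[i]) (u : T -> U) :
  ccont f -> continuous u -> ccont (fun x => f (u x)).
Proof.
move=> [fr fi] cu; split=> x.
  exact: (continuous_comp (cu x) (fr (u x))).
exact: (continuous_comp (cu x) (fi (u x))).
Qed.

(** Dominated convergence along a sequence that would contradict continuity. *)
Lemma ccont_cint d (T : measurableType d) (R : realType)
    (mu : {measure set T -> \bar R}) (X : pseudoMetricType R)
    (F : X -> T -> R[i]) (g : T -> R) :
  (forall x, cmeas (F x)) -> (forall t, ccont (F ^~ t)) ->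
  mu.-integrable setT (fun t => (g t)%:E) ->
  (forall x t, Normc.normc (F x t) <= g t) ->
  ccont (fun x => cint mu (F x)).
Proof.
move=> mF cF ig Fg; apply/ccont_nearP => x e e0.
apply: contrapT => /= H.
have H' n : exists y, ball x n.+1%:R^-1 y /\
    e <= Normc.normc (cint mu (F x) - cint mu (F y)).
  apply: contrapT => K; apply: H; apply/nbhs_ballP; exists n.+1%:R^-1 => /=.
    by rewrite invr_gt0.
  move=> y xy; rewrite ltNge; apply/negP => h; apply: K; by exists y.
have [u uP] := choice H'.
have ux : u n @[n --> \oo] --> x.
  apply/cvg_ballP => eps eps0.
  have := near_infty_natSinv_lt (PosNum eps0); apply: filterS => k /= ke.
  by apply: le_ball (uP k).1; exact: ltW.
have := @cint_dct _ _ R mu (fun n => F (u n)) (F x) g (fun n => mF (u n)) (mF x).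
have cv t : Normc.normc (F (u n) t - F x t) @[n --> \oo] --> (0 : R).
  apply/cvgrPdist_lt => eps eps0.
  have /ccont_nearP/(_ x eps eps0) := cF t.
  move=> /ux; apply: (@filterS _ \oo) => n /=.
  by rewrite sub0r normrN ger0_norm ?nc_ge0// ncB.
move=> /(_ cv ig (fun n t => Fg _ t)) /cvgrPdist_lt/(_ e e0) [N _ /(_ N (leqnn N))].
by rewrite sub0r normrN ger0_norm ?nc_ge0// ncB ltNge (uP N).2.
Qed.

Section product_integrability.
Context d1 d2 (T1 : measurableType d1) (T2 : measurableType d2) (R : realType).
Variables (m1 : {sigma_finite_measure set T1 -> \bar R}).
Variables (m2 : {sigma_finite_measure set T2 -> \bar R}).

Lemma integrable_prod_fiber (k : T1 * T2 -> R) (G : T1 -> R) :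
  measurable_fun setT k -> m1.-integrable setT (fun x => (G x)%:E) ->
  (forall x, (\int[m2]_y `|k (x, y)|%:E <= (G x)%:E)%E) ->
  (m1 \x m2)%E.-integrable setT (fun z => (k z)%:E).
Proof.
move=> mk iG kG.
have mk' : measurable_fun setT (fun z => (k z)%:E) by exact/measurable_EFinP.
apply/integrable12ltyP => //.
have mabs : measurable_fun setT (fun z => `|(k z)%:E|%E) by exact: measurableT_comp.
have mGe : measurable_fun setT (fun x => (G x)%:E) by case/integrableP : iG.
apply: (@le_lt_trans _ _ (\int[m1]_x (G x)%:E)%E); last first.
  by have := integrable_fin_num measurableT iG; rewrite fin_numElt => /andP[].
apply: ge0_le_integral => //.
- by move=> x _; exact: integral_ge0.
- exact: (measurable_fun_fubini_tonelli_F (fun z => `|(k z)%:E|%E)).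
- by move=> x _; exact: kG.
Qed.

Lemma integrable_prod (g : T1 -> R) (h : T2 -> R) :
  m1.-integrable setT (fun x => (g x)%:E) -> m2.-integrable setT (fun x => (h x)%:E) ->
  (m1 \x m2)%E.-integrable setT (fun z => (g z.1 * h z.2)%:E).
Proof.
move=> ig ih.
have mg : measurable_fun setT g by case/integrableP : ig => /measurable_EFinP.
have mh : measurable_fun setT h by case/integrableP : ih => /measurable_EFinP.
have ih' := integrable_abse ih.
pose c := \int[m2]_y `|h y|.
apply: (@integrable_prod_fiber _ (fun x => c * `|g x|)).
- by apply: measurable_funM; [exact: (measurableT_comp mg)|exact: (measurableT_comp mh)].
- by have := integrableZl measurableT c (integrable_abse ig).
- move=> x; under eq_integral do rewrite normrM EFinM /=.
  rewrite (integralZl measurableT ih').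
  rewrite EFinM muleC lee_pmul//; last first.
    by rewrite /c /Rintegral fineK//; exact: integrable_fin_num ih'.
  by apply: integral_ge0 => y _ /=.
Qed.

End product_integrability.

Section character.
Variable R : realType.
Local Notation nc := (@Normc.normc R).

(** The exponential of i x. *)
Definition ech (x : R) : R[i] := cos x +i* sin x.

Lemma ech0 : ech 0 = 1.
Proof. by rewrite /ech cos0 sin0. Qed.

Lemma echD x y : ech (x + y) = ech x * ech y.
Proof.
by apply/eqP; rewrite eq_complex /= cosD sinD !eqxx /= addrC eqxx.
Qed.

Lemma nc_ech x : nc (ech x) = 1.
Proof. by rewrite /= cos2Dsin2 sqrtr1. Qed.

Lemma ech_conj x : (ech x)^* = ech (- x).
Proof. by rewrite /ech /= cosN sinN. Qed.

Lemma ccont_ech (T : topologicalType) (h : T -> R) : continuous h ->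
  ccont (fun x => ech (h x)).
Proof.
move=> ch; split => x /=.
  exact: (continuous_comp (ch x) (@continuous_cos R (h x))).
exact: (continuous_comp (ch x) (@continuous_sin R (h x))).
Qed.

Lemma cmeas_ech d (T : measurableType d) (h : T -> R) : measurable_fun setT h ->
  cmeas (fun x => ech (h x)).
Proof.
move=> mh; split => /=.
  exact: (measurableT_comp (continuous_measurable_fun (@continuous_cos R)) mh).
exact: (measurableT_comp (continuous_measurable_fun (@continuous_sin R)) mh).
Qed.

End character.

Section fourier_basics.
Variables (R : realType) (d : nat).
Local Notation Rd := 'rV[R]_d.
Local Notation nc := (@Normc.normc R).
Local Notation Td := (d.-tuple (measurableTypeR R)).
Local Notation mu := (@lebT R d).
Local Notation row := (@row_of_tuple R d).
Implicit Types (f g : Rd -> R[i]).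

Lemma vmeas_row : vmeas row.
Proof.
move=> i; apply: eq_measurable_fun (@measurable_tnth _ (measurableTypeR R) d i) => t _.
by rewrite mxE.
Qed.

Lemma vmeas_comp d1 d2 (X : measurableType d1) (Y : measurableType d2)
    (u : Y -> Rd) (v : X -> Y) :
  vmeas u -> measurable_fun setT v -> vmeas (fun x => u (v x)).
Proof. by move=> mu' mv i; exact: (measurableT_comp (mu' i) mv). Qed.

Lemma cmeas_cont dx (X : measurableType dx) f (u : X -> Rd) :
  ccont f -> vmeas u -> cmeas (fun x => f (u x)).
Proof.
by move=> [fr fi] mu'; split;
  [exact: (measurable_continuous fr)|exact: (measurable_continuous fi)].
Qed.

Lemma cmeas_cont2 dx (X : measurableType dx) (f : Rd * Rd -> R[i]) (u v : X -> Rd) :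
  ccont f -> vmeas u -> vmeas v -> cmeas (fun x => f (u x, v x)).
Proof.
by move=> [fr fi] mu' mv; split;
  [exact: (measurable_continuous2 fr)|exact: (measurable_continuous2 fi)].
Qed.

Lemma dotprodC (x y : Rd) : dotprod x y = dotprod y x.
Proof. by apply: eq_bigr => i _; rewrite mulrC. Qed.

Lemma dotprodDr (x y z : Rd) : dotprod x (y + z) = dotprod x y + dotprod x z.
Proof. by rewrite -big_split; apply: eq_bigr => i _; rewrite mxE mulrDr. Qed.

Lemma dotprodDl (x y z : Rd) : dotprod (y + z) x = dotprod y x + dotprod z x.
Proof. by rewrite dotprodC dotprodDr !(dotprodC x). Qed.

Lemma dotprodNr (x y : Rd) : dotprod x (- y) = - dotprod x y.
Proof. by rewrite -sumrN; apply: eq_bigr => i _; rewrite mxE mulrN. Qed.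

Lemma dotprodNl (x y : Rd) : dotprod (- x) y = - dotprod x y.
Proof. by rewrite dotprodC dotprodNr dotprodC. Qed.

Lemma dotprodZr c (x y : Rd) : dotprod x (c *: y) = c * dotprod x y.
Proof. by rewrite mulr_sumr; apply: eq_bigr => i _; rewrite mxE mulrCA. Qed.

Lemma dotprodZl c (x y : Rd) : dotprod (c *: x) y = c * dotprod x y.
Proof. by rewrite dotprodC dotprodZr dotprodC. Qed.

Lemma continuous_dotprod : continuous (fun p : Rd * Rd => dotprod p.1 p.2).
Proof.
apply: continuous_big; first exact: add_continuous.
by move=> i _; apply: contM; apply: cont_comp (@coord_continuous _ _ _ _ _) _;
  [exact: cont_fst|exact: cont_snd].
Qed.

Lemma measurable_dotprod dx (X : measurableType dx) (u v : X -> Rd) :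
  vmeas u -> vmeas v -> measurable_fun setT (fun x => dotprod (u x) (v x)).
Proof. exact: (measurable_continuous2 continuous_dotprod). Qed.

Lemma continuous_dotprodl (x : Rd) : continuous (fun y => dotprod y x).
Proof.
apply: (cont_comp continuous_dotprod (g := fun y => (y, x))).
by apply: cont_pair; [exact: cont_id|exact: cont_cst].
Qed.

Lemma continuous_dotprodr (x : Rd) : continuous (dotprod x).
Proof.
have -> : dotprod x = fun y => dotprod y x by apply/funext => y; rewrite dotprodC.
exact: continuous_dotprodl.
Qed.

Lemma ccont_charl c (x : Rd) : ccont (fun t : Rd => ech (c * dotprod t x)).
Proof.
by apply: ccont_ech; apply: contM; [exact: cont_cst|exact: continuous_dotprodl].
Qed.

Lemma ccont_charr c (x : Rd) : ccont (fun t : Rd => ech (c * dotprod x t)).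
Proof.
by apply: ccont_ech; apply: contM; [exact: cont_cst|exact: continuous_dotprodr].
Qed.

Lemma ccont_charNr c (x : Rd) : ccont (fun t : Rd => ech (- (c * dotprod x t))).
Proof. by under eq_fun do rewrite -mulNr; exact: ccont_charr. Qed.

Lemma continuous_shift (a : Rd) : continuous (fun t : Rd => t - a).
Proof.
by move=> t; refine (@cvgB R Rd Rd (nbhs t) _ (fun y => y) (fun=> a) _ _ _ _);
  [exact: cvg_id|exact: cvg_cst].
Qed.

Lemma cintegralE f : cintegral f = cint mu (fun t => f (row t)).
Proof. by []. Qed.

Lemma fourierE f xi :
  fourier f xi = cint mu (fun t => f (row t) * ech (- (2 * pi * dotprod xi (row t)))).
Proof.
rewrite /fourier cintegralE; congr cint; apply/funext => t.
by rewrite /ech cosN sinN.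
Qed.

Lemma cmeas_char dx (X : measurableType dx) (u v : X -> Rd) c : vmeas u -> vmeas v ->
  cmeas (fun x => ech (c * dotprod (u x) (v x))).
Proof.
move=> mu' mv; apply: cmeas_ech; apply: measurable_funM; first exact: measurable_cst.
exact: measurable_dotprod.
Qed.

Lemma echN_mul c (y z : Rd) : ech (- (c * dotprod y z)) = ech ((- c) * dotprod y z).
Proof. by rewrite mulNr. Qed.

Lemma L1_char f c xi : L1 mu (fun t => f (row t)) ->
  L1 mu (fun t => f (row t) * ech (c * dotprod xi (row t))).
Proof.
move=> fi; apply: (L1_bnd fi); last by move=> t; rewrite nc_ech.
by apply: cmeas_char; [exact: vmeas_cst|exact: vmeas_row].
Qed.

Lemma L1_fourier f xi : L1 mu (fun t => f (row t)) ->
  L1 mu (fun t => f (row t) * ech (- (2 * pi * dotprod xi (row t)))).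
Proof. by move=> /(L1_char (- (2 * pi)) xi); under eq_fun do rewrite mulNr. Qed.

Lemma fourierD f g xi : L1 mu (fun t => f (row t)) -> L1 mu (fun t => g (row t)) ->
  fourier (fun x => f x + g x) xi = fourier f xi + fourier g xi.
Proof.
move=> Lf Lg; rewrite !fourierE -(cintD (L1_fourier xi Lf) (L1_fourier xi Lg)).
by congr cint; apply/funext => t; rewrite mulrDl.
Qed.

Lemma fourierZ c f xi : L1 mu (fun t => f (row t)) ->
  fourier (fun x => c * f x) xi = c * fourier f xi.
Proof.
move=> Lf; rewrite !fourierE -(cintZl c (L1_fourier xi Lf)).
by congr cint; apply/funext => t; rewrite mulrA.
Qed.

Lemma fourier_ccont f : L1 mu (fun t => f (row t)) -> ccont (fourier f).
Proof.
move=> fi.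
have -> : fourier f = fun xi => cint mu (fun t => f (row t) * ech ((- (2 * pi)) * dotprod xi (row t))).
  by apply/funext => xi; rewrite fourierE; under eq_fun do rewrite echN_mul.
apply: (@ccont_cint _ _ _ _ Rd _ (fun t => nc (f (row t)))).
- by move=> xi; case: (L1_char (- (2 * pi)) xi fi).
- move=> t; apply: ccontM; first exact: ccont_cst.
  exact: ccont_charl.
- by case: fi.
- by move=> x t; rewrite ncM nc_ech mulr1.
Qed.

Lemma fourier_bnd f xi : L1 mu (fun t => f (row t)) ->
  nc (fourier f xi) <= \int[mu]_t nc (f (row t)).
Proof.
move=> fi; rewrite fourierE; apply: le_nc_cint; first by case: (L1_fourier xi fi).
  by case: fi.
by move=> t; rewrite ncM nc_ech mulr1.
Qed.

Definition tor (x : Rd) : Td := [tuple x ord0 i | i < d].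

Lemma row_amap c a t : row (amap c (tor a) t) = c *: row t + a.
Proof. by apply/rowP => i; rewrite !mxE !tnth_mktuple. Qed.

Lemma L1_affine f c a : c != 0 -> L1 mu (fun t => f (row t)) ->
  L1 mu (fun t => f (c *: row t + a)).
Proof.
move=> c0 fi; have := L1_amap (tor a) c0 fi.
by congr L1; apply/funext => t; rewrite row_amap.
Qed.

Lemma cint_affine f c a : c != 0 -> L1 mu (fun t => f (row t)) ->
  cint mu (fun t => f (c *: row t + a)) =
  ((`|c| ^+ d)^-1)%:C * cint mu (fun t => f (row t)).
Proof.
move=> c0 fi; rewrite -(cint_amap (tor a) c0 fi); congr cint.
by apply/funext => t; rewrite row_amap.
Qed.

Lemma integrable_affine (g : Rd -> R) c a : c != 0 ->
  mu.-integrable setT (fun t => (g (row t))%:E) ->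
  mu.-integrable setT (fun t => (g (c *: row t + a))%:E).
Proof.
move=> c0 fi.
have := @integrable_amap R d c (tor a) (fun t => g (row t)) c0 fi.
by congr (integrable mu setT); apply/funext => t; rewrite row_amap.
Qed.

Lemma Rintegral_affine (g : Rd -> R) c a : c != 0 ->
  mu.-integrable setT (fun t => (g (row t))%:E) ->
  \int[mu]_t g (c *: row t + a) = (`|c| ^+ d)^-1 * \int[mu]_t g (row t).
Proof.
move=> c0 fi.
rewrite -(@Rintegral_amap R d c (tor a) (fun t => g (row t)) c0 fi).
by apply: eq_Rintegral => t _; rewrite row_amap.
Qed.

End fourier_basics.

(** * The Fejer kernel and Fourier inversion *)

Section product_of_integrals.
Variable R : realType.
Local Notation nc := (@Normc.normc R).
Local Notation lam := (@lebesgue_measure R).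

Lemma nc_prod I (r : seq I) (F : I -> R[i]) :
  nc (\prod_(i <- r) F i) = \prod_(i <- r) nc (F i).
Proof. by apply: (big_morph nc (@ncM R)); exact: Normc.normc1. Qed.

Lemma L1_prod2 d1 d2 (T1 : measurableType d1) (T2 : measurableType d2)
    (m1 : {sigma_finite_measure set T1 -> \bar R})
    (m2 : {sigma_finite_measure set T2 -> \bar R}) (f : T1 -> R[i]) (g : T2 -> R[i]) :
  L1 m1 f -> L1 m2 g -> L1 (m1 \x m2)%E (fun z => f z.1 * g z.2).
Proof.
move=> [mf fi] [mg gi].
apply: (L1_dom (g := fun z => nc (f z.1) * nc (g z.2))).
- by apply: cmeasM; [exact: cmeas_comp|exact: cmeas_comp].
- exact: (integrable_prod fi gi).
- by move=> z; rewrite ncM.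
Qed.

(** Induction on the dimension. Integrability comes first, by Tonelli, since Fubini
    requires it. *)
Lemma cint_prod n (h : 'I_n -> R -> R[i]) :
  (forall i, L1 lam (h i)) ->
  L1 (@lebT R n) (fun t => \prod_(i < n) h i (tnth t i)) /\
  cint (@lebT R n) (fun t => \prod_(i < n) h i (tnth t i)) =
  \prod_(i < n) cint lam (h i).
Proof.
elim: n h => [|n IH] h hi.
  have E : (fun t : 0.-tuple (measurableTypeR R) => \prod_(i < 0) h i (tnth t i)) =
      fun=> 1.
    by apply/funext => t; rewrite big_ord0.
  have i1 : (@lebT R 0).-integrable setT (fun=> 1%:E).
    by apply/integrableP; split; [exact: measurable_cst|
      rewrite integral_cst//= /lebT /= diracT normr1 mule1 ltry].
  rewrite E big_ord0; split.
    split; first by split; exact: measurable_cst.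
    by under eq_fun do rewrite Normc.normc1.
  rewrite /cint /= !Rintegral_cst// mul0r mul1r /lebT /=.
  by rewrite indicE mem_set.
have hm i : cmeas (h i) by case: (hi i).
have [L E] := IH (fun i => h (lift ord0 i)) (fun i => hi _).
have mS : cmeas (fun t : n.+1.-tuple (measurableTypeR R) => \prod_(i < n.+1) h i (tnth t i)).
  elim: (index_enum _) => [|i r IHr].
    by under eq_fun do rewrite big_nil; exact: cmeas_cst.
  under eq_fun do rewrite big_cons; apply: cmeasM => //.
  by apply: (cmeas_comp (hm i)); exact: measurable_tnth.
have ES : (fun p : n.-tuple (measurableTypeR R) * measurableTypeR R =>
    \prod_(i < n.+1) h i (tnth (tuple_of_pair p) i)) =
    (fun p => \prod_(i < n) h (lift ord0 i) (tnth p.1 i) * h ord0 p.2).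
  apply/funext => -[x y]; rewrite big_ord_recl mulrC; congr (_ * _).
  by apply: eq_bigr => i _; rewrite /tuple_of_pair tnthS.
have LP := L1_prod2 L (hi ord0).
split.
  split=> //; apply/integrableP; split.
    by apply/measurable_EFinP; exact: cmeas_nc.
  rewrite ge0_integral_lebTS//; last first.
    by apply/measurableT_comp => //; apply/measurable_EFinP; exact: cmeas_nc.
  have [_ iLP] := LP.
  have [/(_ iLP) + _] := @integrable12ltyP _ _ _ _ R (@lebT R n) lam _
    (measurable_int _ iLP).
  apply: le_lt_trans.
  rewrite le_eqVlt; apply/orP; left; apply/eqP.
  apply: eq_integral => x _; apply: eq_integral => y _.
  by rewrite -(congr1 (fun F => F (x, y)) ES).
rewrite cint_lebTS ?ES// cint_fubini1//; last first.
  by move=> x /=; exact: L1Zl (hi ord0).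
rewrite big_ord_recl mulrC -E -cintZr//; congr cint; apply/funext => x /=.
by rewrite cintZl.
Qed.

End product_of_integrals.

Section triangle_kernel.
Variable R : realType.
Local Notation nc := (@Normc.normc R).
Local Notation lam := (@lebesgue_measure R).

(** The triangle function. It serves as summation kernel because its transform,
    the Fejer kernel, is nonnegative and integrable. *)
Definition tri (x : R) : R := Num.max 0 (1 - `|x|).

Lemma tri_ge0 x : 0 <= tri x.
Proof. by rewrite /tri le_max lexx. Qed.

Lemma tri_le1 x : tri x <= 1.
Proof. by rewrite /tri ge_max ler01 lerBlDr lerDl normr_ge0. Qed.

Lemma tri0 : tri 0 = 1.
Proof. by rewrite /tri normr0 subr0; apply/max_idPr. Qed.

Lemma triN x : tri (- x) = tri x.
Proof. by rewrite /tri normrN. Qed.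

Lemma tri_out x : ~ (-1 <= x <= 1) -> tri x = 0.
Proof.
move=> h; apply/max_idPl; rewrite subr_le0 leNgt; apply/negP => h1; apply: h.
by rewrite -ler_norml ltW.
Qed.

Lemma tri_in x : 0 <= x <= 1 -> tri x = 1 - x.
Proof. by move=> /andP[x0 x1]; rewrite /tri ger0_norm//; apply/max_idPr; rewrite subr_ge0. Qed.

Lemma continuous_tri : continuous tri.
Proof.
move=> x; apply: (@continuous_max _ _ (fun=> 0) (fun x => 1 - `|x|)); first exact: cvg_cst.
by apply: cvgB; [exact: cvg_cst|exact: norm_continuous].
Qed.

Lemma integrable_tri_mul (f : R -> R) : continuous f ->
  lam.-integrable setT (fun x => (tri x * f x)%:E).
Proof.
move=> cf.
have c : continuous (fun x => tri x * f x) by exact: contM continuous_tri cf.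
have -> : (fun x => (tri x * f x)%:E) = ((fun x => (tri x * f x)%:E) \_ `[-1, 1]).
  apply/funext => x; rewrite patchE; case: ifPn => //; rewrite notin_setE /= in_itv /=.
  by move=> h; rewrite tri_out ?mul0r//; exact/negP.
apply: (integrable_mkcond _ _).1 => //.
apply: continuous_compact_integrable; first exact: segment_compact.
exact: continuous_subspaceT.
Qed.

Lemma integrable_tri : lam.-integrable setT (EFin \o tri).
Proof.
have := integrable_tri_mul (@cont_cst R R (1:R)).
by congr (integrable _ _); apply/funext => x /=; rewrite mulr1.
Qed.

Lemma Rintegral_FTC (f F : R -> R) (a b : R) : a < b ->
  (forall x : R, is_derive x (1 : R) F (f x)) -> continuous f ->
  \int[lam]_(x in `[a, b]) f x = F b - F a.
Proof.
move=> ab dF cf.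
have cF : continuous F.
  by move=> x; apply: differentiable_continuous; apply/derivable1_diffP; case: (dF x).
rewrite /Rintegral (@continuous_FTC2 _ f F a b ab)//.
- exact: continuous_subspaceT.
- split; first by move=> x _; case: (dF x).
  + by apply: cvg_at_right_filter; exact: cF.
  + by apply: cvg_at_left_filter; exact: cF.
- by move=> x _; rewrite derive1E; exact: derive_val.
Qed.

Lemma Rintegral_tri_sym (g : R -> R) : continuous g -> (forall x, 0 <= g x) ->
  (forall x, g (- x) = g x) ->
  \int[lam]_x (tri x * g x) = 2 * \int[lam]_(x in `[0, 1]) ((1 - x) * g x).
Proof.
move=> cg g0 gN.
have c : continuous (fun x => tri x * g x) by exact: contM continuous_tri cg.
have c' : continuous (fun x : R => (1 - x) * g x).
  by apply: contM cg; apply: contB; [exact: cont_cst|exact: cont_id].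
have i' : lam.-integrable `[0, 1] (fun x => ((1 - x) * g x)%:E).
  apply: continuous_compact_integrable; first exact: segment_compact.
  exact: continuous_subspaceT.
rewrite /Rintegral ge0_symfun_integralT//; first last.
- by move=> x /=; rewrite triN gN.
- by move=> x; rewrite mulr_ge0// tri_ge0.
have -> : (\int[lam]_(x in [set x | (0 <= x)%R]) (tri x * g x)%:E =
    \int[lam]_(x in `[0%R, 1%R]) ((1 - x) * g x)%:E)%E.
  rewrite integral_mkcond [RHS]integral_mkcond; apply: eq_integral => x _.
  rewrite !patchE; have [x1|x1] := boolP (x \in `[0, 1]%classic).
    move: x1; rewrite inE /= in_itv /= => /andP[x0 x1].
    by rewrite mem_set// tri_in ?x0.
  case: ifPn => // /set_mem /= x0; rewrite tri_out ?mul0r// => /andP[_ h].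
  by move: x1; rewrite notin_setE /= in_itv /= x0 h.
by rewrite fineM//; exact: integrable_fin_num i'.
Qed.

Lemma Rintegral_tri : \int[lam]_x tri x = 1.
Proof.
have -> : \int[lam]_x tri x = \int[lam]_x (tri x * 1).
  by apply: eq_Rintegral => x _; rewrite mulr1.
rewrite (@Rintegral_tri_sym (fun=> 1))//; last exact: cont_cst.
have D (x : R) : is_derive x (1 : R) (fun x : R => x - x ^+ 2 / 2) ((1 - x) * 1).
  by apply: is_derive_eq; rewrite /GRing.scale /=; field.
rewrite (Rintegral_FTC _ D)//.
- by rewrite expr1n expr0n /= mul0r subr0 subr0; field.
- by apply: contM; [apply: contB; [exact: cont_cst|exact: cont_id]|exact: cont_cst].
Qed.

(** The integrand is made nonnegative by adding 1 to the cosine, so that the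
    integral over the line is twice that over the half-line. *)
Lemma Rintegral_tri_cos b : b != 0 ->
  \int[lam]_x (tri x * cos (b * x)) = 2 * (1 - cos b) / b ^+ 2.
Proof.
move=> b0.
have ccos : continuous (fun x : R => cos (b * x)).
  apply: (cont_comp (@continuous_cos R)).
  by apply: contM; [exact: cont_cst|exact: cont_id].
have c1 : continuous (fun x : R => 1 + cos (b * x)).
  by apply: contD ccos; exact: cont_cst.
have E : \int[lam]_x (tri x * (1 + cos (b * x))) = 1 + 2 * (1 - cos b) / b ^+ 2.
  rewrite (@Rintegral_tri_sym (fun x => 1 + cos (b * x)))//; last first.
    by move=> x; rewrite mulrN cosN.
  have D (x : R) : is_derive x (1 : R) (fun x : R => x - x ^+ 2 / 2 +
      (1 - x) * sin (b * x) / b - cos (b * x) / b ^+ 2) ((1 - x) * (1 + cos (b * x))).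
    by apply: is_derive_eq; rewrite /GRing.scale /=; field; exact: b0.
  rewrite (Rintegral_FTC _ D)//.
  - by rewrite mulr1 mulr0 cos0 sin0; field.
  - by apply: contM c1; apply: contB; [exact: cont_cst|exact: cont_id].
apply: (@addrI _ 1); rewrite -E -{1}Rintegral_tri -RintegralD//;
  [|exact: integrable_tri|]; last exact: integrable_tri_mul.
by apply: eq_Rintegral => x _; rewrite mulrDr mulr1.
Qed.

Lemma Rintegral_tri_sin b : \int[lam]_x (tri x * sin (b * x)) = 0.
Proof.
have csin : continuous (fun x : R => sin (b * x)).
  apply: (cont_comp (@continuous_sin R)).
  by apply: contM; [exact: cont_cst|exact: cont_id].
set I := Rintegral _ _ _.
have fi := integrable_tri_mul csin.
suff : I = - I by move=> /eqP; rewrite -addr_eq0 -mulr2n mulrn_eq0 /= => /eqP.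
have mN : measurable_fun [set: measurableTypeR R] (-%R : measurableTypeR R -> measurableTypeR R).
  exact: oppr_measurable.
have iN : lam.-integrable setT (fun x => (tri (- x) * sin (b * (- x)))%:E).
  have := integrableN fi; congr (integrable _ _); apply/funext => x /=.
  by rewrite triN mulrN sinN mulrN EFinN.
have := @integral_pushforward _ _ _ _ R _ mN lam setT (fun x => (tri x * sin (b * x))%:E).
rewrite preimage_setT => /(_ _ iN measurableT) h.
rewrite -[RHS]mulN1r /I -RintegralZl// /Rintegral; congr fine.
transitivity (\int[lam]_x ((fun x => (tri x * sin (b * x))%:E) \o -%R) x)%E; last first.
  by apply: eq_integral => x _ /=; rewrite triN mulrN sinN mulrN mulN1r.
rewrite -h; last by case/integrableP : fi.
by apply: eq_measure_integral => //= A mA _; exact/esym/lebesgue_measureN.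
Qed.

Definition fejer (x : R) : R[i] := cint lam (fun xi => (tri xi)%:C * ech (- (2 * pi * (x * xi)))).

Lemma fejerE x : fejer x = (\int[lam]_xi (tri xi * cos (2 * pi * x * xi)))%:C.
Proof.
rewrite /fejer /cint; congr Complex.
  by apply: eq_Rintegral => xi _ /=; rewrite mul0r subr0 cosN !mulrA.
rewrite -(oppr0 R) -(Rintegral_tri_sin (2 * pi * x)) -mulN1r -RintegralZl//.
  by apply: eq_Rintegral => xi _ /=; rewrite mul0r addr0 sinN mulrN mulN1r !mulrA.
apply: integrable_tri_mul; apply: (cont_comp (@continuous_sin R)).
by apply: contM; [exact: cont_cst|exact: cont_id].
Qed.

Lemma L1_tri : L1 lam (fun xi => (tri xi)%:C).
Proof.
apply: (L1_dom _ integrable_tri); last by move=> x; rewrite ncR ger0_norm ?tri_ge0.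
by apply: cmeas_ofR; exact: continuous_measurable_fun continuous_tri.
Qed.

Lemma fejer_ccont : ccont fejer.
Proof.
have mE x : cmeas (fun xi : R => ech (- (2 * pi * (x * xi)))).
  apply: cmeas_ech; apply: continuous_measurable_fun; apply: contN.
  apply: contM; first exact: cont_cst.
  by apply: contM; [exact: cont_cst|exact: cont_id].
apply: (@ccont_cint _ (measurableTypeR R) R (@lebesgue_measure R) _ _ tri).
- by move=> x; have [m _] := L1_tri; apply: cmeasM; [exact: m|exact: mE].
- move=> xi; apply: ccontM; first exact: ccont_cst.
  apply: ccont_ech; apply: contN; apply: contM; first exact: cont_cst.
  by apply: contM; [exact: cont_id|exact: cont_cst].
- exact: integrable_tri.
- by move=> x xi; rewrite ncM nc_ech mulr1 ncR ger0_norm ?tri_ge0.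
Qed.

Lemma Re_fejer_ge0 x : 0 <= Re (fejer x).
Proof.
rewrite fejerE /=; have [->|x0] := eqVneq x 0.
  by apply: Rintegral_ge0 => xi _; rewrite mulr0 mul0r cos0 mulr1 tri_ge0.
rewrite Rintegral_tri_cos; last by rewrite !mulf_neq0// gt_eqF// pi_gt0.
by rewrite divr_ge0 ?sqr_ge0// mulr_ge0// subr_ge0 cos_le1.
Qed.

Lemma nc_fejer x : nc (fejer x) = Re (fejer x).
Proof. by have := Re_fejer_ge0 x; rewrite fejerE /= expr0n /= addr0 sqrtr_sqr => /ger0_norm. Qed.

Lemma fejer_le1 x : Re (fejer x) <= 1.
Proof.
rewrite -nc_fejer -Rintegral_tri /fejer; apply: le_nc_cint.
- by case: L1_tri => m _; apply: cmeasM => //; apply: cmeas_ech;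
  apply: continuous_measurable_fun; apply: contN; apply: contM; [exact: cont_cst|];
  apply: contM; [exact: cont_cst|exact: cont_id].
- exact: integrable_tri.
- by move=> xi; rewrite ncM nc_ech mulr1 ncR ger0_norm ?tri_ge0.
Qed.

(** The closed form gives decay of order 1/x^2 away from the origin; near it the
    kernel is at most 1. *)
Lemma fejer_le x : Re (fejer x) <= 2 * (oneDsqr x)^-1.
Proof.
have o1 : 0 < oneDsqr x by rewrite (lt_le_trans ltr01)// oneDsqr_ge1.
rewrite ler_pdivlMr//.
have [x1|x1] := lerP (x ^+ 2) 1.
  have : oneDsqr x <= 2 by rewrite /oneDsqr -[leRHS]/(1 + 1) lerD2l.
  by move=> h; rewrite -[leRHS]mul1r ler_pM ?Re_fejer_ge0 ?fejer_le1// ltW.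
have x0 : x != 0 by apply: contraTneq x1 => ->; rewrite expr0n /= ltNge ler01.
have p0 : 2 * pi * x != 0 by rewrite !mulf_neq0// gt_eqF// pi_gt0.
rewrite fejerE /= Rintegral_tri_cos//.
have p2 : 2 <= pi :> R by exact: pi_ge2.
have xx : 0 < x ^+ 2 by rewrite exprn_even_gt0.
rewrite mulrAC ler_pdivrMr; last by rewrite exprn_even_gt0.
have c2 : 1 - cos (2 * pi * x) <= 2 by rewrite lerBlDr -lerBlDl; have := cos_geN1 (2 * pi * x); lra.
have : oneDsqr x <= 2 * x ^+ 2 by rewrite /oneDsqr; lra.
move=> h; apply: (@le_trans _ _ (2 * 2 * (2 * x ^+ 2))).
  apply: ler_pM; [|exact: ltW| |exact: h]; last by rewrite ler_wpM2l.
  by rewrite mulr_ge0// subr_ge0 cos_le1.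
rewrite !exprMn; have : 4 <= pi ^+ 2 :> R by rewrite (_ : 4 = 2 ^+ 2) ?lerXn2r// ?nnegrE ?pi_ge0//; ring.
nra.
Qed.

Lemma integrable_oneDsqrV : lam.-integrable setT (fun x => (oneDsqr x)^-1%:E).
Proof.
have c := @continuous_oneDsqrV R.
apply/integrableP; split.
  by apply/measurable_EFinP; exact: continuous_measurable_fun c.
under eq_integral do rewrite gee0_abs ?lee_fin ?invr_ge0 ?(le_trans ler01 (oneDsqr_ge1 _))//.
rewrite (@ge0_symfun_integralT _ (fun x => (oneDsqr x)^-1)) //.
- rewrite (_ : [set x | _] = `[0, +oo[%classic); last first.
    by apply/seteqP; split => x/=; rewrite in_itv/= andbT.
  by rewrite integral0y_oneDsqr -EFinM ltry.
- by move=> x; rewrite /= /oneDsqr sqrrN.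
Qed.

Lemma L1_fejer : L1 lam fejer.
Proof.
apply: (@L1_dom _ (measurableTypeR R) R _ _ (fun x => 2 * (oneDsqr x)^-1)).
- by case: fejer_ccont => cr ci; split; exact: continuous_measurable_fun.
- by have := integrableZl measurableT 2 integrable_oneDsqrV.
- by move=> x; rewrite nc_fejer fejer_le.
Qed.

Lemma cint_fejer_neq0 : cint lam fejer != 0.
Proof.
apply/eqP => h0.
have h : \int[lam]_x Re (fejer x) = 0 by exact: (congr1 (@complex.Re R) h0).
have R0 : Re (fejer 0) = 1.
  rewrite fejerE /= -Rintegral_tri; apply: eq_Rintegral => x _.
  by rewrite mulr0 mul0r cos0 mulr1.
have [e /= e0 He] : exists2 e : R, 0 < e & forall x, x \in `[0, e] -> 2^-1 <= Re (fejer x).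
  have h2 : 0 < 2^-1 :> R by rewrite invr_gt0.
  have [/(_ 0)/cvgrPdist_lt/(_ _ h2) + _] := fejer_ccont.
  move=> /nbhs_ballP [e /= e0 He].
  exists (e / 2); first by rewrite divr_gt0.
  move=> x; rewrite in_itv /= => /andP[x0 xe].
  have xe' : x < e by rewrite (le_lt_trans xe)// ltr_pdivrMr// ltr_pMr// ltr1n.
  have xb : ball (0 : R) e x by rewrite /ball /= sub0r normrN ger0_norm.
  have : `|Re (fejer 0) - Re (fejer x)| < 2^-1 := He x xb.
  rewrite R0 -[leRHS]/(Re (fejer x)) => /ltr_normlP [_].
  by set y := Re (fejer x); lra.
have : e / 2 <= \int[lam]_x Re (fejer x).
  have iD : lam.-integrable `[0, e] (EFin \o (fun=> 2^-1 : R)).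
    apply: continuous_compact_integrable; first exact: segment_compact.
    by apply: continuous_subspaceT => x; exact: cvg_cst.
  have -> : e / 2 = \int[lam]_(x in `[0, e]) (2^-1 : R).
    by rewrite Rintegral_cst//= lebesgue_measure_itv /= lte_fin e0 sube0 /= mulrC.
  rewrite Rintegral_mkcond; apply: le_Rintegral => //.
  - have := (integrable_mkcond _ _).1 iD => /(_ (measurable_itv _)).
    by rewrite restrict_EFin.
  - exact: L1_Re L1_fejer.
  - move=> x _; rewrite patchE; case: ifPn => [/set_mem xe|_]; last exact: Re_fejer_ge0.
    exact: He.
by rewrite h leNgt divr_gt0.
Qed.

End triangle_kernel.

Lemma prod_le1 (R : realDomainType) (I : Type) (r : seq I) (F : I -> R) :
  (forall i, 0 <= F i <= 1) -> \prod_(i <- r) F i <= 1.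
Proof.
move=> F01; have := @ler_prod _ _ r xpredT F (fun=> 1) (fun i _ => F01 i).
by rewrite big1_eq.
Qed.

Section inversion.
Variables (R : realType) (d : nat).
Local Notation Rd := 'rV[R]_d.
Local Notation nc := (@Normc.normc R).
Local Notation mu := (@lebT R d).
Local Notation row := (@row_of_tuple R d).

Let k (xi : Rd) : R := \prod_(i < d) tri (xi ord0 i).
Let K (x : Rd) : R[i] := \prod_(i < d) fejer (x ord0 i).

Let k_ge0 xi : 0 <= k xi.
Proof. by apply: prodr_ge0 => i _; exact: tri_ge0. Qed.

Let k_le1 xi : k xi <= 1.
Proof.
by apply: prod_le1 => i; rewrite tri_ge0 tri_le1.
Qed.

Let k0 : k 0 = 1.
Proof. by apply: big1 => i _; rewrite mxE tri0. Qed.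

Let kcont : continuous k.
Proof.
apply: continuous_big; first exact: mul_continuous.
by move=> i _; apply: cont_comp (@continuous_tri R) (@coord_continuous _ _ _ _ _).
Qed.

Let L1_k : L1 mu (fun t => (k (row t))%:C).
Proof.
have [L _] := @cint_prod R d (fun _ x => (tri x)%:C) (fun=> @L1_tri R).
move: L; congr L1; apply/funext => t; rewrite rmorph_prod /=.
by apply: eq_bigr => i _; rewrite mxE.
Qed.

Let L1_K : L1 mu (fun t => K (row t)).
Proof.
have [L _] := @cint_prod R d (fun _ x => fejer x) (fun=> @L1_fejer R).
by move: L; congr L1; apply/funext => t; apply: eq_bigr => i _; rewrite mxE.
Qed.

Let cint_K : cint mu (fun t => K (row t)) != 0.
Proof.
have [_ E] := @cint_prod R d (fun _ x => fejer x) (fun=> @L1_fejer R).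
have -> : cint mu (fun t => K (row t)) = \prod_(i < d) cint (@lebesgue_measure R) (@fejer R).
  by rewrite -E; congr cint; apply/funext => t; apply: eq_bigr => i _; rewrite mxE.
by apply/prodf_neq0 => i _; exact: cint_fejer_neq0.
Qed.

Let Kcont : ccont K.
Proof.
rewrite /K; elim: (index_enum _) => [|i r IH].
  by under eq_fun do rewrite big_nil; exact: ccont_cst.
under eq_fun do rewrite big_cons; apply: ccontM IH.
exact: ccont_comp (@fejer_ccont R) (@coord_continuous _ _ _ _ _).
Qed.

Let fourier_k x :
  cint mu (fun t => (k (row t))%:C * ech (- (2 * pi) * dotprod (row t) x)) = K x.
Proof.
have hi i : L1 (@lebesgue_measure R)
    (fun y => (tri y)%:C * ech (- (2 * pi * (x ord0 i * y)))).
  apply: (L1_bnd (C := 1) (@L1_tri R)); last by move=> y; rewrite nc_ech.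
  apply: cmeas_ech; apply: continuous_measurable_fun; apply: contN.
  apply: contM; first exact: cont_cst.
  by apply: contM; [exact: cont_cst|exact: cont_id].
have [_ E] := @cint_prod R d _ hi.
rewrite /K -E; congr cint; apply/funext => t.
rewrite big_split /= rmorph_prod /=; congr (_ * _).
  by apply: eq_bigr => i _; rewrite mxE.
rewrite /dotprod mulr_sumr (big_morph (@ech R) (@echD R) (@ech0 R)).
by apply: eq_bigr => i _; rewrite mxE mulNr (mulrC (x _ _)).
Qed.

Let fourier_k_scaled a x : a != 0 ->
  cint mu (fun t => (k (a *: row t))%:C * ech (- (2 * pi) * dotprod (row t) x)) =
  ((`|a| ^+ d)^-1)%:C * K (a^-1 *: x).
Proof.
move=> a0; rewrite -fourier_k.
have L : L1 mu (fun t => (k (row t))%:C * ech (- (2 * pi) * dotprod (row t) (a^-1 *: x))).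
  apply: (L1_bnd (C := 1) L1_k); last by move=> y; rewrite nc_ech.
  by apply: cmeas_char; [exact: vmeas_row|exact: vmeas_cst].
rewrite -(@cint_affine _ _ (fun y => (k y)%:C * ech (- (2 * pi) * dotprod y (a^-1 *: x))) a 0 a0 L).
congr cint; apply/funext => t; rewrite addr0 dotprodZl dotprodZr.
by rewrite mulrA mulfV ?mul1r.
Qed.

Variable f : Rd -> R[i].
Hypotheses (fc : ccont f) (M : R) (fM : forall x, nc (f x) <= M).
Hypothesis f1 : L1 mu (fun t => f (row t)).

(** Fubini: damping the inverse transform by k(a xi) amounts to averaging f
    against the kernel K concentrated at scale a. *)
Let fejer_mean a x : 0 < a ->
  cint mu (fun s => fourier f (row s) * ((k (a *: row s))%:C *
     ech (2 * pi * dotprod (row s) x))) =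
  cint mu (fun s => f (a *: row s + x) * K (row s)).
Proof.
move=> a0; have an0 : a != 0 by rewrite gt_eqF.
have Lk : L1 mu (fun s => (k (a *: row s))%:C).
  by have := @L1_affine R d (fun y => (k y)%:C) a 0 an0 L1_k; congr L1; apply/funext => t; rewrite addr0.
pose G (p : d.-tuple (measurableTypeR R) * d.-tuple (measurableTypeR R)) :=
  f (row p.1) * ((k (a *: row p.2))%:C * (ech (2 * pi * dotprod (row p.2) x) *
    ech (- (2 * pi) * dotprod (row p.2) (row p.1)))).
have m1 : vmeas (fun p : d.-tuple (measurableTypeR R) * d.-tuple (measurableTypeR R) => row p.1).
  exact: vmeas_comp (@vmeas_row R d) measurable_fst.
have m2 : vmeas (fun p : d.-tuple (measurableTypeR R) * d.-tuple (measurableTypeR R) => row p.2).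
  exact: vmeas_comp (@vmeas_row R d) measurable_snd.
have mch : cmeas (fun p : d.-tuple (measurableTypeR R) * d.-tuple (measurableTypeR R) =>
    ech (2 * pi * dotprod (row p.2) x) * ech (- (2 * pi) * dotprod (row p.2) (row p.1))).
  apply: cmeasM; apply: cmeas_char => //; exact: vmeas_cst.
have LG : L1 (mu \x mu)%E G.
  have := L1_bnd (C := 1) (L1_prod2 f1 Lk) mch.
  have E : G = (fun p => f (row p.1) * (k (a *: row p.2))%:C *
    (ech (2 * pi * dotprod (row p.2) x) * ech (- (2 * pi) * dotprod (row p.2) (row p.1)))).
    by apply/funext => p; rewrite /G mulrA.
  by rewrite E; apply => p; rewrite ncM !nc_ech mulr1.
have LG1 t : L1 mu (fun s => G (t, s)).
  rewrite /G /=; apply: (@L1Zl _ _ _ _ (fun s => _) (f (row t))).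
  apply: (L1_bnd (C := 1) Lk); last by move=> s; rewrite ncM !nc_ech mulr1.
  apply: cmeasM; apply: cmeas_char; by [exact: vmeas_cst|exact: vmeas_row].
have LG2 s : L1 mu (fun t => G (t, s)).
  rewrite /G /=; apply: (L1_bnd (C := nc (k (a *: row s))%:C) f1).
    apply: cmeasM; first exact: cmeas_cst.
    apply: cmeasM; first exact: cmeas_cst.
    by apply: cmeas_char; [exact: vmeas_cst|exact: vmeas_row].
  by move=> t; rewrite !ncM !nc_ech !mulr1.
transitivity (cint mu (fun s => cint mu (fun t => G (t, s)))).
  congr cint; apply/funext => s.
  rewrite fourierE -cintZr.
    congr cint; apply/funext => t; rewrite /G /= echN_mul.
    by rewrite -!mulrA; congr (_ * _); rewrite mulrCA; congr (_ * _); exact: mulrC.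
  exact: L1_fourier.
rewrite -(cint_fubini2 LG LG2) (cint_fubini1 LG LG1).
pose g (y : Rd) := f y * K (a^-1 *: (y - x)).
have Kbnd y : nc (K y) <= 1.
  by rewrite /K nc_prod; apply: prod_le1 => i; rewrite nc_ge0 nc_fejer fejer_le1.
have Lg : L1 mu (fun t => g (row t)).
  apply: (L1_bnd f1 _ (fun t => Kbnd _)).
  apply: cmeas_cont => //; apply: vmeasZ; apply: vmeasB; by [exact: vmeas_row|exact: vmeas_cst].
transitivity (cint mu (fun t => ((`|a| ^+ d)^-1)%:C * g (row t))).
  congr cint; apply/funext => t; rewrite /G /=.
  rewrite (@cintZl _ _ R mu (fun s => (k (a *: row s))%:C * (ech (2 * pi *
    dotprod (row s) x) * ech (- (2 * pi) * dotprod (row s) (row t)))) (f (row t))); last first.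
    apply: (L1_bnd (C := 1) Lk); last by move=> s; rewrite ncM !nc_ech mulr1.
    apply: cmeasM; apply: cmeas_char; by [exact: vmeas_cst|exact: vmeas_row].
  rewrite /g mulrCA -fourier_k_scaled//; congr (_ * _); congr cint.
  apply/funext => s; congr (_ * _); rewrite -echD; congr ech.
  by rewrite dotprodDr dotprodNr; ring.
rewrite cintZl// -(cint_affine x an0 Lg); congr cint; apply/funext => s.
by rewrite /g addrK scalerA mulVf// scale1r.
Qed.

Hypothesis ff1 : L1 mu (fun t => fourier f (row t)).

(** The limit a -> 0 of [fejer_mean], by dominated convergence on both sides. *)
Let inversion_aux x :
  cint mu (fun s => fourier f (row s) * ech (2 * pi * dotprod (row s) x)) =
  cint mu (fun t => K (row t)) * f x.
Proof.
pose a_ (n : nat) : R := n.+1%:R^-1.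
have a0 n : 0 < a_ n by rewrite invr_gt0.
have acv (y : Rd) : a_ n *: y @[n --> \oo] --> (0 : Rd).
  rewrite -(scale0r y); apply: cvgZl; exact: cvg_harmonic.
pose L n := cint mu (fun s => fourier f (row s) * ((k (a_ n *: row s))%:C *
     ech (2 * pi * dotprod (row s) x))).
have mch : cmeas (fun t => ech (2 * pi * dotprod (row t) x)).
  by apply: cmeas_char; [exact: vmeas_row|exact: vmeas_cst].
have cv1 : nc (L n - cint mu (fun s => fourier f (row s) * ech (2 * pi * dotprod (row s) x)))
    @[n --> \oo] --> (0 : R).
  apply: (@cint_dct _ _ R mu _ _ (fun s => nc (fourier f (row s)))).
  - move=> n; apply: cmeasM; first by case: ff1.
    apply: cmeasM mch; apply: cmeas_ofR; apply: measurable_continuous => //.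
    by apply: vmeasZ; exact: vmeas_row.
  - by apply: cmeasM mch; case: ff1.
  - move=> s; set A := fourier f _; set B := ech _.
    have -> : (fun n => nc (A * ((k (a_ n *: row s))%:C * B) - A * B)) =
       (fun n => nc A * `|k (a_ n *: row s) - 1|).
      apply/funext => n; rewrite -mulrBr ncM; congr (_ * _).
      rewrite -{2}(mul1r B) -mulrBl ncM nc_ech mulr1 -ncR rmorphB.
      by [].
    have ck := cvg_comp _ k (acv (row s)) (kcont (x := 0)).
    rewrite -(mulr0 (nc A)); apply: cvgM; first exact: cvg_cst.
    rewrite -(normr0 R) -(subrr (1:R)); apply: cvg_norm; apply: cvgB; last exact: cvg_cst.
    by rewrite k0 in ck.
  - by case: ff1.
  - move=> n s; rewrite ncM ler_piMr ?nc_ge0// ncM nc_ech mulr1 ncR.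
    by rewrite ger0_norm ?k_ge0 ?k_le1.
have cv2 : nc (L n - cint mu (fun s => f x * K (row s))) @[n --> \oo] --> (0 : R).
  under eq_fun do rewrite /L fejer_mean//.
  apply: (@cint_dct _ _ R mu _ _ (fun s => M * nc (K (row s)))).
  - move=> n; apply: cmeasM; last by case: L1_K.
    apply: cmeas_cont => //; apply: vmeasD; last exact: vmeas_cst.
    by apply: vmeasZ; exact: vmeas_row.
  - by apply: cmeasM; [exact: cmeas_cst|case: L1_K].
  - move=> s; set B := K _.
    have -> : (fun n => nc (f (a_ n *: row s + x) * B - f x * B)) =
       (fun n => nc (f (a_ n *: row s + x) - f x) * nc B).
      by apply/funext => n; rewrite -mulrBl ncM.
    rewrite -(mul0r (nc B)); apply: cvgM; last exact: cvg_cst.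
    have cx : (a_ n *: row s + x) @[n --> \oo] --> x.
      by rewrite -[X in _ --> X]add0r; apply: cvgD; [exact: acv|exact: cvg_cst].
    case: fc => cr ci; apply: cvg_ReIm.
      exact: (cvg_comp _ (fun x => Re (f x)) cx (cr x)).
    exact: (cvg_comp _ (fun x => Im (f x)) cx (ci x)).
  - by case: L1_K => _ iK; have := integrableZl measurableT M iK.
  - by move=> n s; rewrite ncM ler_wpM2r ?nc_ge0.
transitivity (cint mu (fun s => f x * K (row s))); last by rewrite cintZl// mulrC.
set A := cint mu _ in cv1 *; set B := cint mu _ in cv2 *.
apply/eqP; rewrite -subr_eq0; apply/eqP/nc_eq0/eqP; rewrite eq_le nc_ge0 andbT.
apply/ler_addgt0Pr => e e0; rewrite add0r.
have e2 : 0 < e / 2 by rewrite divr_gt0.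
have /cvgrPdist_lt/(_ _ e2) [N1 _ H1] := cv1.
have /cvgrPdist_lt/(_ _ e2) [N2 _ H2] := cv2.
have := H1 (maxn N1 N2) (leq_maxl _ _); have := H2 (maxn N1 N2) (leq_maxr _ _).
rewrite !sub0r !normrN !ger0_norm ?nc_ge0// => h2 h1.
have -> : A - B = (A - L (maxn N1 N2)) + (L (maxn N1 N2) - B) by rewrite addrA subrK.
apply: le_trans (ncD _ _) _; rewrite (splitr e); apply: lerD; last exact: ltW.
by rewrite ncB ltW.
Qed.

(** The total mass of the kernel. It equals 1; keeping it as a constant spares the
    evaluation of the integral of the Fejer kernel. *)
Definition inversion_constant : R[i] :=
  cint mu (fun t => \prod_(i < d) fejer (row t ord0 i)).

Lemma inversion_constant_neq0 : inversion_constant != 0.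
Proof. exact: cint_K. Qed.

Lemma fourier_inversion x :
  cint mu (fun s => fourier f (row s) * ech (2 * pi * dotprod (row s) x)) =
  inversion_constant * f x.
Proof. exact: inversion_aux. Qed.

End inversion.

(** * Smooth bumps on the line *)

Section derivative_sequences.
Variable R : realType.
Implicit Types (D h k : nat -> R -> R) (u : R -> R).

(** D lists a function together with its successive derivatives; with explicit
    lists, smoothness is stable under products and dilations by construction. *)
Definition dseq D := forall n (x : R), is_derive x (1 : R) (D n) (D n.+1 x).

Definition dshift D : nat -> R -> R := fun n => D n.+1.

Lemma dseq_dshift D : dseq D -> dseq (dshift D).
Proof. by move=> H n x; exact: H. Qed.

Lemma is_derive_continuous (f df : R -> R) :
  (forall x : R, is_derive x (1 : R) f (df x)) -> continuous f.
Proof.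
by move=> H x; apply: differentiable_continuous; apply/derivable1_diffP; case: (H x).
Qed.

Lemma dseq_cont D n : dseq D -> continuous (D n).
Proof. by move=> H; exact: is_derive_continuous (H n). Qed.

Lemma is_derive_affine (f : R -> R) (l c a x : R) : is_derive (c * x + a) (1 : R) f l ->
  is_derive x (1 : R) (fun y => f (c * y + a)) (c * l).
Proof.
move=> H.
have H2 : is_derive x (1 : R) (fun y : R => c * y + a) c.
  by apply: is_derive_eq; rewrite /GRing.scale /=; ring.
have := is_derive1_comp (f := f) (g := fun y : R => c * y + a) H H2.
by rewrite mulrC.
Qed.

Lemma dseq_affine D (c a : R) : dseq D -> dseq (fun n x => c ^+ n * D n (c * x + a)).
Proof.
move=> H n x; have := is_derive_affine (H n (c * x + a)) => H1.
by apply: is_derive_eq; rewrite /GRing.scale /= exprS; ring.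
Qed.

Lemma dseqZ D (c : R) : dseq D -> dseq (fun n x => c * D n x).
Proof.
move=> H n x; have H1 := H n x.
by apply: is_derive_eq; rewrite /GRing.scale /=; ring.
Qed.

(** The derivatives of h 0 * k 0, as a binary recursion in place of binomial
    coefficients. *)
Fixpoint lei h k (m : nat) : R -> R :=
  match m with
  | 0 => fun x => h 0%N x * k 0%N x
  | m'.+1 => fun x => lei (dshift h) k m' x + lei h (dshift k) m' x
  end.

Lemma dseq_lei h k : dseq h -> dseq k -> dseq (lei h k).
Proof.
move=> dh dk n; elim: n h k dh dk => [|n IH] h k dh dk x.
  have H1 := dh 0%N x; have H2 := dk 0%N x.
  rewrite /lei /dshift.
  by apply: is_derive_eq; rewrite /GRing.scale /=; ring.
have H1 := IH _ _ (dseq_dshift dh) dk x; have H2 := IH _ _ dh (dseq_dshift dk) x.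
by rewrite [lei h k n.+1]/=; apply: is_derive_eq.
Qed.

Lemma lei_eq0l h k x m : (forall j, h j x = 0) -> lei h k m x = 0.
Proof.
elim: m h k => [|m IH] h k hx /=; first by rewrite hx mul0r.
by rewrite !IH ?addr0// => j; exact: hx.
Qed.

Lemma lei_eq0r h k x m : (forall j, k j x = 0) -> lei h k m x = 0.
Proof.
elim: m h k => [|m IH] h k hx /=; first by rewrite hx mulr0.
by rewrite !IH ?addr0// => j; exact: hx.
Qed.

Lemma leiZr h k c m x : lei h (fun j y => c * k j y) m x = c * lei h k m x.
Proof.
elim: m h k => [|m IH] h k /=; first by ring.
by rewrite (IH (dshift h) k) (IH h (dshift k)) mulrDr.
Qed.

End derivative_sequences.

Section smooth_bump.
Variable R : realType.
Local Notation lam := (@lebesgue_measure R).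

(** All derivatives of exp(-1/x), extended by 0 to x <= 0, have the form
    p(1/x) exp(-1/x). *)
Definition flat (p : {poly R}) (x : R) : R :=
  if 0 < x then p.[x^-1] * expR (- x^-1) else 0.

Let expR_fact (n : nat) (y : R) : 0 <= y -> y ^+ n * expR (- y) <= n`!%:R.
Proof.
move=> y0; case: n => [|n].
  by rewrite expr0 mul1r fact0 expRN invf_le1 ?expR_gt0// -expR0 ler_expR.
have /= h := expR_ge1Dxn n y0.
rewrite expRN ler_pdivrMr ?expR_gt0//.
have f0 : 0 < (n.+1)`!%:R :> R by rewrite ltr0n fact_gt0.
rewrite mulrC -ler_pdivrMr//.
by apply: le_trans h; rewrite lerDr.
Qed.

Let poly_exp_bound (p : {poly R}) : exists2 C, 0 <= C &
  forall y : R, 0 <= y -> `|p.[y]| * y ^+ 2 * expR (- y) <= C.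
Proof.
exists (\sum_(i < size p) `|p`_i| * (i + 2)`!%:R).
  by apply: sumr_ge0 => i _; rewrite mulr_ge0.
move=> y y0; rewrite horner_coef.
apply: (@le_trans _ _ ((\sum_(i < size p) `|p`_i| * y ^+ i) * y ^+ 2 * expR (- y))).
  rewrite ler_wpM2r ?expR_ge0// ler_wpM2r ?sqr_ge0//.
  apply: le_trans (ler_norm_sum _ _ _) _; apply: ler_sum => i _.
  by rewrite normrM (ger0_norm (exprn_ge0 _ y0)).
rewrite !mulr_suml; apply: ler_sum => i _.
by rewrite -(mulrA `|_|) -exprD -mulrA ler_wpM2l// expR_fact.
Qed.

(** Polynomials in 1/x are absorbed by the exponential, with x^2 to spare, which
    makes the derivative at 0 vanish. *)
Let flat_bound p : exists2 C, 0 <= C & forall x, `|flat p x| <= C * (Num.max 0 x) ^+ 2.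
Proof.
have [C C0 H] := poly_exp_bound p; exists C => // x.
rewrite /flat; case: ifPn => [x0|]; last first.
  by rewrite -leNgt => x0; rewrite normr0 mulr_ge0// sqr_ge0.
have -> : Num.max 0 x = x by apply/max_idPr; exact: ltW.
have xi0 : 0 < x^-1 by rewrite invr_gt0.
have := H x^-1 (ltW xi0).
rewrite normrM (ger0_norm (expR_ge0 _)) -ler_pdivrMr; last by rewrite exprn_gt0.
by rewrite -exprVn => h; rewrite mulrAC.
Qed.

Let is_derive0_quad (u : R -> R) (x C : R) :
  (forall h, `|u (h + x) - u x| <= C * h ^+ 2) -> is_derive x (1 : R) u 0.
Proof.
move=> H.
suff cv : h^-1 *: (u (h *: (1 : R) + x) - u x) @[h --> 0^'] --> (0 : R).
  apply: DeriveDef; last exact/cvg_lim.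
  by apply/cvg_ex; exists 0.
have C1 : 0 < `|C| + 1 by rewrite ltr_wpDl.
apply/cvgr0Pnorm_le => e e0; near=> h.
have h0 : h != 0 by near: h; exact: nbhs_dnbhs_neq.
rewrite /GRing.scale /= mulr1 normrM normfV ler_pdivrMl ?normr_gt0//.
apply: le_trans (H h) _.
rewrite -[h ^+ 2]real_normK ?num_real// expr2 mulrA.
rewrite mulrC ler_wpM2l//.
apply: (@le_trans _ _ (`|h| * (`|C| + 1))).
  by rewrite mulrC ler_wpM2l// (le_trans (ler_norm _))// lerDl.
rewrite -ler_pdivlMr//.
near: h; apply: dnbhs0_le; exact: divr_gt0.
Unshelve. all: by end_near. Qed.

Let flat_derive p x : is_derive x (1 : R) (flat p) (flat ((p - p^`()) * 'X^2) x).
Proof.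
have [x0|x0] := ltrP 0 x; last first.
  have -> : flat ((p - p^`()) * 'X^2) x = 0 by rewrite /flat ltNge x0.
  have [C C0 H] := flat_bound p.
  apply: (@is_derive0_quad _ _ C) => h.
  have -> : flat p x = 0 by rewrite /flat ltNge x0.
  rewrite subr0; apply: le_trans (H _) _; rewrite ler_wpM2l//.
  have [hx|hx] := lerP (h + x) 0.
    by rewrite expr2 mul0r sqr_ge0.
  rewrite ler_sqr ?nnegrE; first by rewrite gerDl.
    exact: ltW.
  by rewrite ltW// (lt_le_trans hx)// gerDl.
have xn0 : x != 0 by rewrite gt_eqF.
have D1 : is_derive x (1 : R) (fun y : R => y^-1) (- (x ^- 2)).
  have := is_deriveV (f := fun y : R => y) xn0 (is_derive_id x (1 : R)).
  by move=> h; apply: is_derive_eq; rewrite /GRing.scale /= mulr1.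
have D2 : is_derive x (1 : R) (fun y : R => p.[y^-1]) (- (x ^- 2) * p^`().[x^-1]).
  have := is_derive1_comp (f := horner p) (g := fun y : R => y^-1) (is_derive_poly p _) D1.
  by rewrite mulrC.
have D3 : is_derive x (1 : R) (fun y : R => expR (- y^-1)) (x ^- 2 * expR (- x^-1)).
  have D4 : is_derive x (1 : R) (fun y : R => - y^-1) (x ^- 2).
    by apply: is_derive_eq; rewrite opprK.
  by have := is_derive1_comp (f := @expR R) (g := fun y : R => - y^-1) (is_derive_expR (- x^-1)) D4; rewrite mulrC.
have D : is_derive x (1 : R) (fun y : R => p.[y^-1] * expR (- y^-1))
    (flat ((p - p^`()) * 'X^2) x).
  apply: is_derive_eq; rewrite /flat x0 !hornerE /GRing.scale /= -?exprVn; ring.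
apply: near_eq_is_derive D.
near=> y; rewrite /flat ifT//; near: y; exact: lt_nbhsr.
Unshelve. all: by end_near. Qed.

Fixpoint flatp (n : nat) : {poly R} :=
  if n is m.+1 then (flatp m - (flatp m)^`()) * 'X^2 else 1.

Definition theta (n : nat) : R -> R := flat (flatp n).

Lemma dseq_theta : dseq theta.
Proof. by move=> n x; exact: flat_derive. Qed.

Lemma theta_le0 n x : x <= 0 -> theta n x = 0.
Proof. by move=> x0; rewrite /theta /flat ltNge x0. Qed.

Lemma theta_gt0 x : 0 < x -> 0 < theta 0 x.
Proof. by move=> x0; rewrite /theta /flat x0 hornerC mul1r expR_gt0. Qed.

(** The product of theta(x - (a - r)) and theta((a + r) - x), with its derivatives. *)
Definition smooth_bump (a r : R) : nat -> R -> R :=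
  lei (fun n x => 1 ^+ n * theta n (1 * x + (r - a)))
      (fun n x => (-1) ^+ n * theta n (-1 * x + (r + a))).

Lemma dseq_bump a r : dseq (smooth_bump a r).
Proof. by apply: dseq_lei; apply: dseq_affine; exact: dseq_theta. Qed.

Lemma bump_out a r n x : r <= `|x - a| -> smooth_bump a r n x = 0.
Proof.
rewrite ler_normr /smooth_bump => /orP[h|h]; [apply: lei_eq0r|apply: lei_eq0l] => j;
  rewrite theta_le0 ?mulr0//; lra.
Qed.

Lemma bump_gt0 a r x : `|x - a| < r -> 0 < smooth_bump a r 0 x.
Proof.
rewrite ltr_norml => /andP[h1 h2]; rewrite /smooth_bump /= !expr0 !mul1r.
by rewrite mulr_gt0// theta_gt0//; lra.
Qed.

Lemma bump_ge0 a r x : 0 <= smooth_bump a r 0 x.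
Proof.
have [h|h] := ltrP `|x - a| r; first exact/ltW/bump_gt0.
by rewrite bump_out.
Qed.

Lemma bump_supp a r n x : `|a| + `|r| <= `|x| -> smooth_bump a r n x = 0.
Proof.
move=> h; apply: bump_out; rewrite (le_trans (ler_norm _))//.
by rewrite -(lerD2r `|a|) addrC (le_trans h)// -{1}[x](subrK a) ler_normD.
Qed.

Lemma dseq_bound D n (M : R) : dseq D -> (forall x, M <= `|x| -> D n x = 0) ->
  exists2 C, 0 <= C & forall x, `|D n x| <= C.
Proof.
move=> dD out.
have [M0|M0] := lerP M 0.
  by exists 0 => // x; rewrite out ?normr0// (le_trans M0).
have le0 : - M <= M by lra.
have [c _ Hc] := EVT_max le0 (continuous_subspaceT (fun x => cvg_norm (@dseq_cont _ _ n dD x))).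
exists `|D n c| => // x.
have [xM|xM] := ltrP `|x| M; last by rewrite out ?normr0.
by apply: Hc; rewrite in_itv /=; move: (ltW xM); rewrite ler_norml.
Qed.

End smooth_bump.

(** * Transforms of bumps, and cutoffs *)

Section bump_transform.
Variable R : realType.
Local Notation lam := (@lebesgue_measure R).

Definition supported (M : R) (g : R -> R) := forall x, M <= `|x| -> g x = 0.

Lemma integrable_supported M (g : R -> R) : continuous g -> supported M g ->
  lam.-integrable setT (EFin \o g).
Proof.
move=> cg sg.
have h : lam.-integrable `[- M, M] (EFin \o g).
  apply: continuous_compact_integrable; first exact: segment_compact.
  exact: continuous_subspaceT.
rewrite (_ : EFin \o g = (EFin \o g) \_ `[- M, M]%classic).
  by apply: (integrable_mkcond _ _).1.
apply/funext => x /=; rewrite patchE; case: ifPn => // /negP xM.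
rewrite sg// leNgt; apply/negP => /ltW h1; apply: xM.
by rewrite inE /= in_itv /= -ler_norml.
Qed.

Lemma Rintegral_supported M (g : R -> R) : supported M g ->
  \int[lam]_x g x = \int[lam]_(x in `[- M, M]) g x.
Proof.
move=> sg; rewrite /Rintegral [in RHS]integral_mkcond; congr fine.
apply: eq_integral => x _; rewrite patchE; case: ifPn => // /negP xM.
rewrite sg// leNgt; apply/negP => /ltW h1; apply: xM.
by rewrite inE /= in_itv /= -ler_norml.
Qed.

Lemma Rintegral_derive0 M (F f : R -> R) : 0 < M ->
  (forall x : R, is_derive x (1 : R) F (f x)) -> continuous f ->
  supported M F -> supported M f -> \int[lam]_x f x = 0.
Proof.
move=> M0 dF cf sF sf; rewrite (Rintegral_supported sf) (Rintegral_FTC _ dF)//; last lra.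
by rewrite !sF ?subrr// ?normrN ler_norm.
Qed.

(** The cosine transform of w with phase th; the phase makes the derivative
    of a cosine transform a cosine transform again. *)
Definition costr (w : R -> R) (th xi : R) : R :=
  \int[lam]_t (w t * cos (2 * pi * xi * t + th)).

Lemma cont_phase (xi th : R) : continuous (fun t : R => cos (2 * pi * xi * t + th)).
Proof.
apply: (cont_comp (@continuous_cos R)); apply: contD (@cont_cst _ _ _).
by apply: contM (@cont_id _); exact: cont_cst.
Qed.

Lemma supportedMl M g h : supported M g -> supported M (fun x => g x * h x).
Proof. by move=> sg x Mx; rewrite sg// mul0r. Qed.

Lemma supportedMr M g h : supported M g -> supported M (fun x => h x * g x).
Proof. by move=> sg x Mx; rewrite sg// mulr0. Qed.

Lemma is_derive_phase (xi th t : R) :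
  is_derive xi (1 : R) (fun xi => cos (2 * pi * xi * t + th))
   (2 * pi * t * cos (2 * pi * xi * t + (th + pi / 2))).
Proof.
have E : cos (2 * pi * xi * t + (th + pi / 2)) = - sin (2 * pi * xi * t + th).
  by rewrite addrA cosDpihalf.
have := is_derive_affine (f := @cos R) (c := 2 * pi * t) (a := th) (x := xi)
   (is_derive_cos _).
rewrite E; congr (is_derive _ _ _ _); first by apply/funext => y; congr (cos (_ + _)); ring.
by congr (_ * - sin (_ + _)); ring.
Qed.

Lemma is_derive_costr M w th xi : continuous w -> supported M w ->
  is_derive xi (1 : R) (costr w th) (costr (fun t => 2 * pi * t * w t) (th + pi / 2) xi).
Proof.
move=> cw sw.
have Ia : `]xi - 1, xi + 1[%classic xi by rewrite /= in_itv /=; lra.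
have i1 x : `]xi - 1, xi + 1[%classic x ->
    lam.-integrable setT (EFin \o (fun t => w t * cos (2 * pi * x * t + th))).
  move=> _; apply: (@integrable_supported M); last exact: supportedMl.
  exact: contM cw (@cont_phase _ _).
have D x t : is_derive x (1 : R) (fun x => w t * cos (2 * pi * x * t + th))
    (2 * pi * t * w t * cos (2 * pi * x * t + (th + pi / 2))).
  have H := is_derive_phase x th t.
  by apply: is_derive_eq; rewrite /GRing.scale /=; ring.
have i2 x t : `]xi - 1, xi + 1[%classic x -> [set: R] t ->
    derivable (fun x => w t * cos (2 * pi * x * t + th)) x (1 : R).
  by move=> _ _; case: (D x t).
have G0 t : 0 <= `|2 * pi * t * w t| by [].
have c2 : continuous (fun t : R => 2 * pi * t * w t).
  by apply: contM cw; apply: contM (@cont_id _); exact: cont_cst.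
have iG : lam.-integrable setT (EFin \o (fun t => `|2 * pi * t * w t|)).
  apply: (@integrable_supported M).
    by move=> x; apply: cvg_norm; exact: c2.
  by move=> x Mx; rewrite sw// mulr0 normr0.
have Gub x t : `]xi - 1, xi + 1[%classic x -> [set: R] t ->
    `|partial1of2 (fun x t => w t * cos (2 * pi * x * t + th)) x t| <= `|2 * pi * t * w t|.
  move=> _ _; rewrite partial1of2E derive_val normrM ler_piMr//.
  by rewrite ler_norml cos_geN1 cos_le1.
have d1 := @derivable_under_integral R _ _ lam
  (fun x t => w t * cos (2 * pi * x * t + th)) setT measurableT xi _ _ Ia i1 i2 _ G0 iG Gub.
have d2 := @differentiation_under_integral R _ _ lam
  (fun x t => w t * cos (2 * pi * x * t + th)) setT measurableT xi _ _ Ia i1 i2 _ G0 iG Gub.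
apply: DeriveDef; first exact: d1.
rewrite -derive1E d2 /costr; apply: eq_Rintegral => t _.
by rewrite /= partial1of2E derive_val.
Qed.

(** Integration by parts: the derivative falls on w, and w vanishes outside
    [-M, M]. *)
Lemma costr_parts M w w' th xi : 0 < M ->
  (forall x : R, is_derive x (1 : R) w (w' x)) -> continuous w' ->
  supported M w -> supported M w' ->
  2 * pi * xi * costr w th xi = - costr w' (th - pi / 2) xi.
Proof.
move=> M0 dw cw' sw sw'.
have cw := is_derive_continuous dw.
have D t : is_derive t (1 : R) (fun t => w t * cos (2 * pi * xi * t + (th - pi / 2)))
   (2 * pi * xi * (w t * cos (2 * pi * xi * t + th)) +
     w' t * cos (2 * pi * xi * t + (th - pi / 2))).
  have E : cos (2 * pi * xi * t + th) = - sin (2 * pi * xi * t + (th - pi / 2)).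
    by rewrite -cosDpihalf; congr cos; ring.
  have H1 := dw t.
  have H2 : is_derive t (1 : R) (fun t => cos (2 * pi * xi * t + (th - pi / 2)))
      (2 * pi * xi * cos (2 * pi * xi * t + th)).
    by rewrite E; exact: (is_derive_affine (is_derive_cos _)).
  by apply: is_derive_eq; rewrite /GRing.scale /=; ring.
have c1 := contM cw (@cont_phase xi th).
have c2 := contM cw' (@cont_phase xi (th - pi / 2)).
have := Rintegral_derive0 M0 D.
rewrite RintegralD//; first last.
- exact: (integrable_supported c2 (supportedMl _ sw')).
- apply: (@integrable_supported M); last exact/supportedMr/supportedMl.
  by apply: contM c1; exact: cont_cst.
rewrite RintegralZl//; last exact: (integrable_supported c1 (supportedMl _ sw)).
move=> H; apply/eqP; rewrite -addr_eq0 /costr; apply/eqP; apply: H.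
- by apply: contD c2; apply: contM c1; exact: cont_cst.
- exact: supportedMl.
- by move=> x Mx; rewrite sw// sw'// !mul0r mulr0 addr0.
Qed.

Lemma costr_bound M w : continuous w -> supported M w ->
  exists2 C, 0 <= C & forall th xi, `|costr w th xi| <= C.
Proof.
move=> cw sw; exists (\int[lam]_t `|w t|).
  by apply: Rintegral_ge0 => t _.
move=> th xi.
have c1 := contM cw (@cont_phase xi th).
have i1 := integrable_supported c1 (supportedMl (fun t => cos (2 * pi * xi * t + th)) sw).
apply: le_trans (le_normr_Rintegral _ i1) _ => //.
apply: le_Rintegral => //.
- by have := integrable_norm i1.
- by have := integrable_norm (integrable_supported cw sw).
- by move=> t _; rewrite normrM ler_piMr// ler_norml cos_geN1 cos_le1.
Qed.

(** Each of k integrations by parts gains one power of the frequency. *)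
Lemma costr_decay M (b : nat -> R -> R) k : 0 < M -> dseq b ->
  (forall n, supported M (b n)) -> 
  exists2 C, 0 <= C & forall th xi, `|xi| ^+ k * `|costr (b 0%N) th xi| <= C.
Proof.
move=> M0; elim: k b => [|k IH] b db sb.
  have [C C0 H] := costr_bound (dseq_cont (n := 0) db) (sb 0%N).
  by exists C => // th xi; rewrite expr0 mul1r.
have [C C0 H] := IH _ (dseq_dshift db) (fun n => sb n.+1).
exists C => // th xi.
have p0 := pi_gt0 R.
have := costr_parts th xi M0 (db 0%N) (dseq_cont (n := 1) db) (sb 0%N) (sb 1%N).
have p2 : 2 <= @pi R by exact: pi_ge2.
move=> /(congr1 Num.norm); rewrite normrN !normrM (gtr0_norm p0) ger0_norm// => E.
have h := H (th - pi / 2) xi; rewrite /dshift -E in h.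
apply: le_trans h; rewrite exprS mulrCA mulrAC -mulrA mulrA -!mulrA.
have x0 : 0 <= `|xi| ^+ k * (`|xi| * `|costr (b 0%N) th xi|) by rewrite !mulr_ge0// exprn_ge0.
nra.
Qed.

Definition freqseq : nat -> R -> R := fun n t =>
  if n is m.+1 then (if m is 0 then 2 * pi else 0) else 2 * pi * t.

Lemma dseq_freqseq : dseq freqseq.
Proof.
case=> [|[|n]] x; rewrite /freqseq; [|exact: is_derive_cst|exact: is_derive_cst].
by apply: is_derive_eq; rewrite /GRing.scale /= mulr1.
Qed.

(** The function (2 pi t)^m b(t) with its derivatives. *)
Fixpoint freqpow (b : nat -> R -> R) (m : nat) : nat -> R -> R :=
  if m is m'.+1 then lei freqseq (freqpow b m') else b.

Lemma dseq_freqpow b m : dseq b -> dseq (freqpow b m).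
Proof. by move=> db; elim: m => //= m IH; apply: dseq_lei IH; exact: dseq_freqseq. Qed.

Lemma supported_freqpow M b m : (forall n, supported M (b n)) ->
  forall n, supported M (freqpow b m n).
Proof.
move=> sb; elim: m => //= m IH n x Mx.
by apply: lei_eq0r => j; exact: IH.
Qed.

(** The cosine transform of b with phase th, with its derivatives: each of them
    multiplies b by 2 pi t and advances the phase by pi/2. *)
Definition bumphat b (th : R) (m : nat) (xi : R) : R :=
  costr (freqpow b m 0) (th + m%:R * (pi / 2)) xi.

Lemma dseq_bumphat M b th : dseq b -> (forall n, supported M (b n)) ->
  dseq (bumphat b th).
Proof.
move=> db sb m xi.
have := is_derive_costr (th + m%:R * (pi / 2)) xi
  (dseq_cont (n := 0) (dseq_freqpow m db)) (supported_freqpow m sb 0).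
congr (is_derive _ _ _ _); rewrite /bumphat /=; congr (costr _ _ _).
by rewrite -[in RHS]natr1; ring.
Qed.

Definition rapid (h : nat -> R -> R) := forall k m, exists2 C, 0 <= C &
  forall x, (1 + `|x|) ^+ k * `|h m x| <= C.

Lemma rapid_bumphat M b th : 0 < M -> dseq b -> (forall n, supported M (b n)) ->
  rapid (bumphat b th).
Proof.
move=> M0 db sb k m.
have dW := dseq_freqpow m db; have sW := supported_freqpow m sb.
have [C C0 HC] := costr_decay 0 M0 dW sW.
have [D D0 HD] := costr_decay k M0 dW sW.
exists (2 ^+ k * (C + D)); first by rewrite mulr_ge0// ?exprn_ge0// addr_ge0.
move=> x; rewrite /bumphat.
set th' := th + _; have := HC th' x; have := HD th' x.
rewrite expr0 mul1r; set c := `|costr _ _ _| => h1 h2.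
have c0 : 0 <= c by exact: normr_ge0.
apply: (@le_trans _ _ (2 ^+ k * ((1 + `|x| ^+ k) * c))).
  rewrite mulrA ler_wpM2r//.
  have [x1|x1] := lerP `|x| 1.
    apply: (@le_trans _ _ (2 ^+ k)).
      by rewrite lerXn2r ?nnegrE//; have := normr_ge0 x; lra.
    by rewrite ler_peMr ?exprn_ge0// lerDl exprn_ge0.
  apply: (@le_trans _ _ (2 ^+ k * `|x| ^+ k)).
    by rewrite -exprMn lerXn2r ?nnegrE//; have := normr_ge0 x; lra.
  by rewrite ler_wpM2l ?exprn_ge0// lerDr.
by rewrite ler_wpM2l ?exprn_ge0// mulrDl mul1r lerD.
Qed.

End bump_transform.

Section cutoff.
Variable R : realType.
Implicit Types h c : nat -> R -> R.

Definition dilate (e : R) c : nat -> R -> R := fun n x => e ^+ n * c n (e * x).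

Lemma dseq_dilate e c : dseq c -> dseq (dilate e c).
Proof.
move=> dc n x; have := dseq_affine e 0 dc n x.
congr (is_derive _ _ _ _); last by rewrite /dilate addr0.
by apply/funext => y; rewrite /dilate addr0.
Qed.

(** Each derivative that falls on the dilated cutoff brings a factor e <= 1. *)
Lemma lei_dilate_bound h c k m : rapid h ->
  (forall n, exists2 C, 0 <= C & forall x, `|c n x| <= C) ->
  exists2 C, 0 <= C & forall e x, 0 <= e <= 1 ->
    (1 + `|x|) ^+ k * `|lei h (dilate e c) m x| <= C.
Proof.
elim: m h c => [|m IH] h c rh bc.
  have [C C0 HC] := rh k 0%N; have [D D0 HD] := bc 0%N.
  exists (C * D) => [|e x _]; first exact: mulr_ge0.
  by rewrite /= /dilate expr0 mul1r normrM mulrA ler_pM// mulr_ge0// exprn_ge0// addr_ge0.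
have [C C0 HC] := IH (dshift h) c (fun k n => rh k n.+1) bc.
have [D D0 HD] := IH h (dshift c) rh (fun n => bc n.+1).
exists (C + D) => [|e x e01]; first exact: addr_ge0.
have [e0 e1] := andP e01.
rewrite /=; have -> : dshift (dilate e c) = fun j y => e * dilate e (dshift c) j y.
  by apply/funext => j; apply/funext => y; rewrite /dshift /dilate exprS mulrA.
rewrite leiZr; apply: (@le_trans _ _ ((1 + `|x|) ^+ k *
    (`|lei (dshift h) (dilate e c) m x| + `|lei h (dilate e (dshift c)) m x|))).
  rewrite ler_wpM2l ?exprn_ge0 ?addr_ge0//; apply: le_trans (ler_normD _ _) _.
  by rewrite lerD2l normrM (ger0_norm e0) ler_piMl.
by rewrite mulrDr lerD ?HC ?HD.
Qed.

(** The cutoff c(e x) differs from 1 by O(e |x|), and the factor |x| is absorbed by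
    the decay of h; every derivative of the cutoff brings a factor e. *)
Lemma cutoff_approx h c k m (L : R) : rapid h ->
  (forall n, exists2 C, 0 <= C & forall x, `|c n x| <= C) ->
  0 <= L -> (forall x, `|c 0%N x - 1| <= L * `|x|) ->
  exists2 C, 0 <= C & forall e x, 0 <= e <= 1 ->
    (1 + `|x|) ^+ k * `|lei h (dilate e c) m x - h m x| <= C * e.
Proof.
move=> + bc L0 lip; elim: m h => [|m IH] h rh.
  have [C C0 HC] := rh k.+1 0%N.
  exists (C * L) => [|e x /andP[e0 e1]]; first exact: mulr_ge0.
  rewrite /= /dilate expr0 mul1r -[X in _ - X]mulr1 -mulrBr normrM mulrA.
  apply: (@le_trans _ _ ((1 + `|x|) ^+ k * `|h 0%N x| * (L * (e * `|x|)))).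
    rewrite ler_wpM2l ?mulr_ge0 ?exprn_ge0 ?addr_ge0//.
    by have := lip (e * x); rewrite normrM (ger0_norm e0).
  rewrite (_ : _ * (L * (e * _)) = (`|x| * ((1 + `|x|) ^+ k * `|h 0%N x|)) * (L * e));
    last by ring.
  rewrite -(mulrA C) ler_wpM2r ?mulr_ge0//; apply: le_trans (HC x).
  by rewrite exprS -mulrA ler_wpM2r ?lerDr// mulr_ge0// exprn_ge0// addr_ge0.
have [C C0 HC] := IH (dshift h) (fun k n => rh k n.+1).
have [D D0 HD] := @lei_dilate_bound h (dshift c) k m rh (fun n => bc n.+1).
exists (C + D) => [|e x e01]; first exact: addr_ge0.
have [e0 e1] := andP e01.
rewrite /=; have -> : dshift (dilate e c) = fun j y => e * dilate e (dshift c) j y.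
  by apply/funext => j; apply/funext => y; rewrite /dshift /dilate exprS mulrA.
rewrite leiZr; apply: (@le_trans _ _ ((1 + `|x|) ^+ k *
    (`|lei (dshift h) (dilate e c) m x - dshift h m x| +
     e * `|lei h (dilate e (dshift c)) m x|))).
  rewrite ler_wpM2l ?exprn_ge0 ?addr_ge0// addrAC; apply: le_trans (ler_normD _ _) _.
  by rewrite normrM (ger0_norm e0).
by rewrite mulrDr mulrDl lerD ?HC// mulrCA mulrC ler_wpM2r ?HD.
Qed.

Definition cutoff : nat -> R -> R := fun n x => (smooth_bump 0 1 0%N 0)^-1 * smooth_bump 0 1 n x.

Lemma dseq_cutoff : dseq cutoff.
Proof. by apply: dseqZ; exact: dseq_bump. Qed.

Lemma cutoff_supp n x : 1 <= `|x| -> cutoff n x = 0.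
Proof. by move=> x1; rewrite /cutoff [X in _ * X]bump_out ?subr0// mulr0. Qed.

Lemma cutoff_bound n : exists2 C, 0 <= C & forall x, `|cutoff n x| <= C.
Proof. exact: dseq_bound dseq_cutoff (cutoff_supp n). Qed.

Lemma cutoff_lip : exists2 L, 0 <= L & forall x, `|cutoff 0%N x - 1| <= L * `|x|.
Proof.
have [L L0 HL] := cutoff_bound 1; exists L => // x.
have c0 : cutoff 0%N 0 = 1.
  by rewrite /cutoff mulVf// gt_eqF// bump_gt0// subr0 normr0.
have D y : is_derive y (1 : R) (cutoff 0) (cutoff 1 y) by exact: dseq_cutoff.
have cc := dseq_cont (n := 0) dseq_cutoff.
rewrite -c0; have [x0|x0|->] := ltrgtP x 0; last by rewrite subrr !normr0 mulr0.
- have [c _ E] := MVT x0 (fun y _ => D y) (continuous_subspaceT cc).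
  by rewrite distrC E sub0r normrM normrN ler_wpM2r.
- have [c _ ->] := MVT x0 (fun y _ => D y) (continuous_subspaceT cc).
  by rewrite subr0 normrM ler_wpM2r.
Qed.

End cutoff.

(** * Tensor products as Schwartz functions *)

Section jets.
Variables (R : realType) (d : nat).
Local Notation Rd := 'rV[R]_d.
Local Notation nc := (@Normc.normc R).
Local Notation dir i := (delta_mx (ord0 : 'I_1) i : 'rV[R]_d).

(** A jet lists a smooth function with all its iterated partial derivatives;
    explicit jets reduce the iterated partial derivatives of the definition of a
    Schwartz function to checking one derivative at a time. *)
Definition jet (G : seq 'I_d -> Rd -> R) := forall s,
  continuous (G s) /\ forall i x, is_derive x (dir i) (G s) (G (i :: s) x).

Lemma jet_rpartial G s : jet G -> rpartial s (G [::]) = G s.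
Proof.
move=> jG; elim: s => //= i s IH; rewrite IH.
by apply/funext => x; have [_ /(_ i x) h] := jG s; exact: derive_val.
Qed.

Lemma jet_rsmooth G : jet G -> rsmooth (G [::]).
Proof.
move=> jG s; rewrite jet_rpartial//; by have [c h] := jG s; split=> // i x; case: (h i x).
Qed.

Lemma jet_cst0 : jet (fun _ _ => 0).
Proof. by move=> s; split; [exact: cont_cst|move=> i x; exact: is_derive_cst]. Qed.

Lemma jetD G H : jet G -> jet H -> jet (fun s x => G s x + H s x).
Proof.
move=> jG jH s; have [cG dG] := jG s; have [cH dH] := jH s.
by split=> [|i x]; [exact: contD|exact: is_deriveD].
Qed.

Lemma jetZ c G : jet G -> jet (fun s x => c * G s x).
Proof.
move=> jG s; have [cG dG] := jG s; split=> [|i x].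
  by apply: contM cG; exact: cont_cst.
exact: (is_deriveZ c).
Qed.

Definition cjet (G : seq 'I_d -> Rd -> R[i]) :=
  jet (fun s x => Re (G s x)) /\ jet (fun s x => Im (G s x)).

Lemma cjetD G H : cjet G -> cjet H -> cjet (fun s x => G s x + H s x).
Proof.
move=> [g1 g2] [h1 h2]; split.
  by have := jetD g1 h1; congr jet; apply/funext => s; apply/funext => x; case: (G s x); case: (H s x).
by have := jetD g2 h2; congr jet; apply/funext => s; apply/funext => x; case: (G s x); case: (H s x).
Qed.

Lemma cjetN G : cjet G -> cjet (fun s x => - G s x).
Proof.
move=> [g1 g2]; split.
  by have := jetZ (-1) g1; congr jet; apply/funext => s; apply/funext => x; case: (G s x) => a b /=; rewrite mulN1r.
by have := jetZ (-1) g2; congr jet; apply/funext => s; apply/funext => x; case: (G s x) => a b /=; rewrite mulN1r.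
Qed.

Lemma cjetZ (c : R[i]) G : jet G -> cjet (fun s x => c * (G s x)%:C).
Proof.
move=> jG; case: c => a b; split.
  by have := jetZ a jG; congr jet; apply/funext => s; apply/funext => x /=; rewrite mulr0 subr0.
by have := jetZ b jG; congr jet; apply/funext => s; apply/funext => x /=; rewrite mulr0 add0r.
Qed.

Lemma cjet_sum (J : Type) (r : seq J) (G : J -> seq 'I_d -> Rd -> R[i]) :
  (forall j, cjet (G j)) -> cjet (fun s x => \sum_(j <- r) G j s x).
Proof.
move=> jG; elim: r => [|j r IH].
  by split; (have := jet_cst0; congr jet; apply/funext => s; apply/funext => x; rewrite big_nil).
have := cjetD (jG j) IH; congr cjet.
by apply/funext => s; apply/funext => x; rewrite big_cons.
Qed.

Lemma cjet_cpartial G s : cjet G -> cpartial s (G [::]) = G s.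
Proof.
move=> [g1 g2]; apply/funext => x.
by rewrite /cpartial (jet_rpartial _ g1) (jet_rpartial _ g2); case: (G s x).
Qed.

Lemma cjet_csmooth G : cjet G -> csmooth (G [::]).
Proof. by move=> [g1 g2]; split; [exact: (jet_rsmooth g1)|exact: (jet_rsmooth g2)]. Qed.

Lemma cjet_seminorm_le G k s (C : R) : cjet G ->
  (forall x, `|x| ^+ k * nc (G s x) <= C) -> (schwartz_seminorm k s (G [::]) <= C%:E)%E.
Proof.
move=> jG H; apply: ge_ereal_sup => _ [x _ <-]; by rewrite lee_fin cjet_cpartial.
Qed.

Lemma cjet_schwartz G : cjet G ->
  (forall k s, exists C, forall x, `|x| ^+ k * nc (G s x) <= C) -> schwartz (G [::]).
Proof.
move=> jG H; split; first exact: cjet_csmooth.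
move=> k s; have [C HC] := H k s; apply: le_lt_trans (cjet_seminorm_le jG HC) _.
exact: ltry.
Qed.

(** The partial derivative along s differentiates the i-th factor as many times as
    i occurs in s. *)
Definition tensor (h : 'I_d -> nat -> R -> R) : seq 'I_d -> Rd -> R :=
  fun s x => \prod_(i < d) h i (count_mem i s) (x ord0 i).

(** Along a coordinate direction a tensor product is a multiple of one factor. *)
Lemma is_derive_slice (f : Rd -> R) (u : R -> R) (c l : R) (i : 'I_d) (x : Rd) :
  (forall h, f (h *: dir i + x) = c * u (h + x ord0 i)) ->
  is_derive (x ord0 i) (1 : R) u l -> is_derive x (dir i) f (c * l).
Proof.
move=> E [du <-].
have E0 : f x = c * u (x ord0 i) by rewrite -{1}[x]add0r -(scale0r (dir i)) E add0r.
have EE : (fun h : R => h^-1 *: ((f \o shift x) (h *: dir i) - f x)) =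
  (fun h => c * (h^-1 *: ((u \o shift (x ord0 i)) (h *: (1 : R)) - u (x ord0 i)))).
  apply/funext => h /=; rewrite E E0 /GRing.scale /= mulr1; ring.
have cv : h^-1 *: ((f \o shift x) (h *: dir i) - f x) @[h --> 0^'] -->
   c * 'D_1 u (x ord0 i).
  rewrite EE; apply: cvgM; [exact: cvg_cst|exact: du].
by apply: DeriveDef; [apply/cvg_ex; eexists; exact: cv|exact/cvg_lim].
Qed.

Lemma jet_tensor h : (forall i, dseq (h i)) -> jet (tensor h).
Proof.
move=> dh s; split.
  apply: continuous_big => [|i _].
    by move=> p; apply: cvgM; [exact: cvg_fst|exact: cvg_snd].
  apply: (cont_comp (dseq_cont (n := count_mem i s) (dh i))).
  exact: coord_continuous.
move=> i x.
have -> : tensor h (i :: s) x =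
   (\prod_(j < d | j != i) h j (count_mem j s) (x ord0 j)) *
   h i (count_mem i s).+1 (x ord0 i).
  rewrite /tensor (bigD1 i)//= eqxx add1n mulrC; congr (_ * _).
  by apply: eq_bigr => j /negPf ji; rewrite eq_sym ji.
apply: is_derive_slice; last exact: dh.
move=> e; rewrite /tensor (bigD1 i)//= mulrC; congr (_ * _).
  apply: eq_bigr => j /negPf ji; congr (h _ _ _).
  by rewrite !mxE eqxx ji mulr0 add0r.
by rewrite !mxE !eqxx mulr1.
Qed.

(** The difference of two products telescopes. *)
Lemma prod_dist (r : seq 'I_d) (a b : 'I_d -> R) (A e : R) : 1 <= A ->
  (forall i, `|a i| <= A) -> (forall i, `|b i| <= A) -> (forall i, `|a i - b i| <= e * A) ->
  0 <= e ->
  `|\prod_(i <- r) a i - \prod_(i <- r) b i| <= (size r)%:R * A ^+ size r * e /\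
  `|\prod_(i <- r) b i| <= A ^+ size r.
Proof.
move=> A1 ha hb hab e0; have A0 : 0 <= A by apply: le_trans A1.
elim: r => [|i r [IH1 IH2]] /=.
  by rewrite !big_nil subrr normr0 mul0r mul0r normr1 expr0.
rewrite !big_cons; split; last by rewrite normrM exprS ler_pM.
set P := \prod_(j <- r) _; set Q := \prod_(j <- r) _.
rewrite (_ : _ - _ = a i * (P - Q) + (a i - b i) * Q); last by ring.
apply: le_trans (ler_normD _ _) _; rewrite !normrM.
rewrite (_ : _.+1%:R * A ^+ (size r).+1 * e = A * ((size r)%:R * A ^+ size r * e) +
  (e * A) * A ^+ size r); last by rewrite -natr1 exprS; ring.
by apply: lerD; apply: ler_pM.
Qed.

Let norm_le_prod (x : Rd) : `|x| <= `|\prod_(i < d) (1 + `|x ord0 i|)|.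
Proof.
have p1 (r : seq 'I_d) : 1 <= \prod_(i <- r) (1 + `|x ord0 i|).
  elim: r => [|i r IH]; first by rewrite big_nil.
  by rewrite big_cons -[leLHS]mulr1 ler_pM// lerDl.
rewrite ger0_norm; last by rewrite (le_trans _ (p1 _)).
apply: rV_norm_le; first by rewrite (le_trans _ (p1 _)).
move=> i; rewrite (bigD1 i)//=.
have p2 : 1 <= \prod_(j < d | j != i) (1 + `|x ord0 j|) by rewrite -big_filter.
apply: (@le_trans _ _ (1 + `|x ord0 i|)); first by rewrite lerDr.
by rewrite ler_peMr// addr_ge0.
Qed.

(** The norm of x is at most the product of the 1 + |x_i|, so that polynomial weights
    may be distributed over the factors. *)
Let wprod k (x : Rd) (F : 'I_d -> R) : `|x| ^+ k * `|\prod_(i < d) F i| <=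
  `|\prod_(i < d) ((1 + `|x ord0 i|) ^+ k * F i)|.
Proof.
rewrite big_split /= normrM ler_wpM2r// prodrXl normrX.
by rewrite lerXn2r ?nnegrE.
Qed.

Let uniform_bound (F : 'I_d -> R -> Prop) :
  (forall i, exists2 C, 0 <= C & F i C) -> (forall i C D, C <= D -> F i C -> F i D) ->
  exists2 C, 1 <= C & forall i, F i C.
Proof.
move=> H mon.
have /choice [c Hc] i : exists C, 0 <= C /\ F i C by have [C] := H i; exists C.
exists (1 + \sum_i c i).
  by rewrite lerDl sumr_ge0// => i _; case: (Hc i).
move=> i; apply: mon (Hc i).2; rewrite (bigD1 i)//= addrCA lerDl.
by rewrite addr_ge0// sumr_ge0// => j _; case: (Hc j).
Qed.

Lemma tensor_rapid h k s : (forall i, rapid (h i)) ->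
  exists C, forall x, `|x| ^+ k * `|tensor h s x| <= C.
Proof.
move=> rh; have [A A1 HA] := @uniform_bound
  (fun i C => forall y, (1 + `|y|) ^+ k * `|h i (count_mem i s) y| <= C)
  (fun i => rh i k _) (fun i C D CD H y => le_trans (H y) CD).
exists (A ^+ size (index_enum 'I_d)) => x.
apply: le_trans (wprod _ _ _) _.
pose a i := (1 + `|x ord0 i|) ^+ k * h i (count_mem i s) (x ord0 i).
have a1 i : `|a i| <= A.
  by rewrite normrM ger0_norm ?exprn_ge0 ?addr_ge0//; exact: HA.
have a0 i : `|a i - a i| <= 0 * A by rewrite subrr normr0 mul0r.
by have [_ ->] := @prod_dist (index_enum 'I_d) a a A 0 A1 a1 a1 a0 (lexx 0).
Qed.

Definition truncate (h : 'I_d -> nat -> R -> R) (e : R) : 'I_d -> nat -> R -> R :=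
  fun i => lei (h i) (dilate e (@cutoff R)).

Lemma dseq_truncate h e i : (forall i, dseq (h i)) -> dseq (truncate h e i).
Proof.
by move=> dh; apply: dseq_lei; [exact: dh|exact: dseq_dilate (@dseq_cutoff R)].
Qed.

(** A telescoping product of the one-dimensional estimates [cutoff_approx]. *)
Lemma tensor_truncate h k s : (forall i, rapid (h i)) ->
  exists2 C, 0 <= C & forall e x, 0 <= e <= 1 ->
    `|x| ^+ k * `|tensor (truncate h e) s x - tensor h s x| <= C * e.
Proof.
move=> rh; have [L L0 lip] := @cutoff_lip R.
pose F i C := (forall y, (1 + `|y|) ^+ k * `|h i (count_mem i s) y| <= C) /\
  forall e y, 0 <= e <= 1 ->
    ((1 + `|y|) ^+ k * `|lei (h i) (dilate e (@cutoff R)) (count_mem i s) y| <= C /\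
     (1 + `|y|) ^+ k * `|lei (h i) (dilate e (@cutoff R)) (count_mem i s) y -
       h i (count_mem i s) y| <= C * e).
have Fmon i C D : C <= D -> F i C -> F i D.
  move=> CD [H1 H2]; split=> [y|e y e01]; first exact: le_trans (H1 y) CD.
  have [h1 h2] := H2 e y e01; have /andP[e0 _] := e01.
  by split; [exact: le_trans h1 CD|apply: le_trans h2 _; rewrite ler_wpM2r].
have Fex i : exists2 C, 0 <= C & F i C.
  have [C C0 HC] := rh i k (count_mem i s).
  have [D D0 HD] := lei_dilate_bound k (count_mem i s) (rh i) (@cutoff_bound R).
  have [E E0 HE] := cutoff_approx k (count_mem i s) (rh i) (@cutoff_bound R) L0 lip.
  exists (C + D + E) => [|]; first by rewrite !addr_ge0.
  split=> [y|e y e01]; first by apply: le_trans (HC y) _; rewrite -addrA lerDl addr_ge0.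
  have /andP[e0 _] := e01; split.
    by apply: le_trans (HD e y e01) _; rewrite addrAC addrC lerDl addr_ge0.
  by apply: le_trans (HE e y e01) _; rewrite ler_wpM2r// lerDr addr_ge0.
have [A A1 HA] := uniform_bound Fex Fmon.
exists (d%:R * A ^+ d); first by rewrite mulr_ge0// exprn_ge0// (le_trans _ A1).
move=> e x e01; have /andP[e0 _] := e01.
pose w i := (1 + `|x ord0 i|) ^+ k.
have w0 i : 0 <= w i by rewrite exprn_ge0// addr_ge0.
pose a i := w i * truncate h e i (count_mem i s) (x ord0 i).
pose b i := w i * h i (count_mem i s) (x ord0 i).
have a1 i : `|a i| <= A by rewrite normrM ger0_norm//; exact: ((HA i).2 _ _ e01).1.
have b1 i : `|b i| <= A by rewrite normrM ger0_norm//; exact: (HA i).1.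
have ab i : `|a i - b i| <= e * A.
  by rewrite -mulrBr normrM ger0_norm// [leRHS]mulrC; exact: ((HA i).2 _ _ e01).2.
have [H _] := @prod_dist (index_enum 'I_d) a b A e A1 a1 b1 ab e0.
have sz : size (index_enum 'I_d) = d by rewrite -[RHS]card_ord cardT enumT.
rewrite sz in H; apply: le_trans H.
rewrite /a /b !big_split /= -mulrBr normrM ler_wpM2r// prodrXl normrX.
by rewrite lerXn2r ?nnegrE.
Qed.

Lemma tensor_truncate_out h e x : 0 < e -> e^-1 < `|x| -> tensor (truncate h e) [::] x = 0.
Proof.
move=> e0 ex.
have [i ei] : exists i, e^-1 <= `|x ord0 i|.
  apply: contrapT => /forallNP H; move: ex; rewrite ltNge => /negP; apply.
  apply: rV_norm_le; first by rewrite invr_ge0 ltW.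
  by move=> i; rewrite ltW// ltNge; exact/negP.
rewrite /tensor (bigD1 i)//= /truncate /= /dilate cutoff_supp ?mulr0 ?mul0r//.
by rewrite normrM (gtr0_norm e0) mulrC -ler_pdivrMr// div1r.
Qed.

End jets.

(** * The multiplication formula *)

Section multiplication_formula.
Variables (R : realType) (d : nat).
Local Notation Rd := 'rV[R]_d.
Local Notation nc := (@Normc.normc R).
Local Notation mu := (@lebT R d).
Local Notation row := (@row_of_tuple R d).
Local Notation Td := (d.-tuple (measurableTypeR R)).
Implicit Types (f g : Rd -> R[i]).

Lemma L1_char2 f g c : L1 mu (fun t => f (row t)) -> L1 mu (fun t => g (row t)) ->
  L1 (mu \x mu)%E (fun p : Td * Td =>
    f (row p.1) * g (row p.2) * ech (c * dotprod (row p.1) (row p.2))).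
Proof.
move=> Lf Lg; apply: (L1_bnd (C := 1)) (L1_prod2 Lf Lg) _ _.
  apply: cmeas_ech; apply: measurable_funM; first exact: measurable_cst.
  by apply: measurable_dotprod; exact: vmeas_comp (@vmeas_row R d) _.
by move=> x; rewrite nc_ech.
Qed.

(** Fubini, by symmetry of the kernel. *)
Lemma fourier_mult f g : L1 mu (fun t => f (row t)) -> L1 mu (fun t => g (row t)) ->
  cint mu (fun t => f (row t) * fourier g (row t)) =
  cint mu (fun t => fourier f (row t) * g (row t)).
Proof.
move=> Lf Lg.
have L2 := L1_char2 (- (2 * pi)) Lf Lg.
have E1 x : (fun y => f (row x) * g (row y) * ech (- (2 * pi) * dotprod (row x) (row y))) =
  (fun y => f (row x) * (g (row y) * ech (- (2 * pi * dotprod (row x) (row y))))).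
  by apply/funext => y; rewrite mulrA mulNr.
have E2 y : (fun x => f (row x) * g (row y) * ech (- (2 * pi) * dotprod (row x) (row y))) =
  (fun x => f (row x) * ech (- (2 * pi * dotprod (row y) (row x))) * g (row y)).
  by apply/funext => x; rewrite mulrAC mulNr dotprodC.
have S1 x : L1 mu (fun y => f (row x) * g (row y) * ech (- (2 * pi) * dotprod (row x) (row y))).
  by rewrite E1; apply: L1Zl; exact: L1_fourier.
have S2 y : L1 mu (fun x => f (row x) * g (row y) * ech (- (2 * pi) * dotprod (row x) (row y))).
  rewrite E2; under eq_fun do rewrite mulrC.
  by apply: L1Zl; exact: L1_fourier.
have := cint_fubini1 L2 S1; rewrite (cint_fubini2 L2 S2) => h.
transitivity (cint mu (fun x => cint mu (fun y =>
   f (row x) * g (row y) * ech (- (2 * pi) * dotprod (row x) (row y))))).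
  congr cint; apply/funext => x; apply: etrans (congr1 (cint mu) (esym (E1 x))).
  by rewrite (cintZl (f (row x)) (L1_fourier (row x) Lg)) fourierE.
apply: etrans (esym h) _; congr cint; apply/funext => y.
apply: etrans (congr1 (cint mu) (E2 y)) _.
by rewrite (cintZr (g (row y)) (L1_fourier (row y) Lf)) fourierE.
Qed.

(** The product of the 1/(1+x_i^2) dominates bounded functions of fast decay. *)
Lemma L1_compact_support f (K : set Rd) : ccont f -> compact K ->
  (forall x, ~ K x -> f x = 0) -> L1 mu (fun t => f (row t)).
Proof.
move=> cf cK fK.
pose P (x : Rd) : R := \prod_(i < d) oneDsqr (x ord0 i).
have o0 (y : R) : 0 < oneDsqr y by rewrite (lt_le_trans ltr01)// oneDsqr_ge1.
have P0 x : 0 < P x by apply: prodr_gt0 => i _; exact: o0.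
have cP : continuous P.
  apply: continuous_big => [|i _].
    by move=> p; apply: cvgM; [exact: cvg_fst|exact: cvg_snd].
  apply: (cont_comp (f := @oneDsqr R)); last exact: coord_continuous.
  exact: continuous_oneDsqr.
have [B HB] : exists B, forall x, nc (f x) * P x <= B.
  have cg : continuous (fun x => nc (f x) * P x) by apply: contM cP; exact: ccont_nc.
  have [[x0 Kx0]|K0] := pselect (K !=set0); last first.
    exists 0 => x; rewrite fK ?nc0 ?mul0r// => Kx; apply: K0; by exists x.
  have [c _ Hc] := EVT_max_rV (ex_intro _ x0 Kx0) cK (continuous_subspaceT cg).
  exists (nc (f c) * P c) => x.
  have [Kx|nKx] := pselect (K x); first exact/Hc/mem_set.
  by rewrite fK// nc0 mul0r mulr_ge0// ?nc_ge0// ltW.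
have L1o : L1 (@lebesgue_measure R) (fun t => ((oneDsqr t)^-1)%:C).
  apply: L1_dom (integrable_oneDsqrV R) _.
    exact: cmeas_ofR (continuous_measurable_fun (@continuous_oneDsqrV R)).
  by move=> t; rewrite ncR ger0_norm// invr_ge0 ltW// o0.
have [LP _] := @cint_prod R d (fun _ t => ((oneDsqr t)^-1)%:C) (fun _ => L1o).
have iP : mu.-integrable setT (fun t => (B * (P (row t))^-1)%:E).
  have := integrableZl measurableT B LP.2; congr (integrable _ _).
  apply/funext => t; rewrite -EFinM; congr (_ * _)%:E.
  rewrite nc_prod /P -prodfV; apply: eq_bigr => i _.
  by rewrite ncR ger0_norm ?mxE// invr_ge0 ltW// o0.
apply: L1_dom iP _; first exact: (cmeas_cont cf (@vmeas_row R d)).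
by move=> t; rewrite ler_pdivlMr.
Qed.

(** The distribution is integration against f, and the multiplication formula
    identifies its transform. *)
Lemma is_fourier_fourier (f : Rd -> R[i]^o) : ccont f -> L1 mu (fun t => f (row t)) ->
  is_fourier f (fourier f).
Proof.
move=> cf Lf.
have ncS (psi : Rd -> R[i]^o) x : ((nc (psi x))%:E <= schwartz_seminorm 0 [::] psi)%E.
  apply: ereal_sup_ubound; exists x => //; rewrite expr0 mul1r /cpartial /=.
  by case: (psi x).
have SB (psi : Rd -> R[i]^o) : schwartz psi -> exists C, forall x, nc (psi x) <= C.
  move=> [_ /(_ 0%N [::])]; case: schwartz_seminorm (ncS psi) => [r| |] h //.
    by move=> _; exists r => x; rewrite -lee_fin.
  by exists 0 => x; have := h x; rewrite leeNy_eq.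
have Sc (psi : Rd -> R[i]^o) : csmooth psi -> ccont psi.
  by move=> [/(_ [::])[c1 _] /(_ [::])[c2 _]].
have LS (psi : Rd -> R[i]^o) : schwartz psi -> L1 mu (fun t => f (row t) * psi (row t)).
  move=> sp; have [C HC] := SB _ sp; apply: L1_bnd Lf _ _; last by move=> x; exact: HC.
  by apply: cmeas_cont (@vmeas_row R d); apply: Sc; case: sp.
exists (fun psi => cintegral (fun x => f x * psi x)); split.
- split.
    move=> a p1 p2 s1 s2; rewrite !cintegralE.
    rewrite -(cintZl a (LS _ s1)) -cintD; [|exact/L1Zl/LS|exact: LS].
    by congr cint; apply/funext => t; rewrite mulrDr mulrCA.
  move=> psi e sp e0.
  pose K := \int[mu]_t nc (f (row t)).
  have K0 : 0 <= K by apply: Rintegral_ge0 => t _; exact: nc_ge0.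
  pose dl := e / (K + 1).
  have K1 : 0 < K + 1 by rewrite ltr_wpDl.
  have dl0 : 0 < dl by rewrite divr_gt0.
  exists [set p | schwartz p /\ exists2 c, c < dl & forall x, nc (p x - psi x) <= c]; split.
  + split=> [p []//|p [spp [c cdl Hc]]].
    exists 1%N, (fun=> schwartz_seminorm 0 [::]), ((dl - c) / 2); split.
    * by move=> _; exists (0%N, [::]).
    * by rewrite divr_gt0// subr_gt0.
    * move=> y sy /(_ ord0) hy; split=> //; exists (c + (dl - c) / 2); first lra.
      move=> x; rewrite (_ : _ - _ = (p x - psi x) + (y x - p x)); last by ring.
      apply: le_trans (ncD _ _) _; rewrite lerD//.
      rewrite -lee_fin; apply: le_trans (ltW hy).
      exact: (ncS (y - p) x).
  + by split=> //; exists 0 => // x; rewrite subrr nc0.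
  + move=> p [spp [c cdl Hc]].
    have -> : cintegral (fun x => f x * p x) - cintegral (fun x => f x * psi x) =
      cint mu (fun t => f (row t) * (p (row t) - psi (row t))).
      rewrite !cintegralE -[X in _ - X]mul1r -mulNr -cintZl; last exact: LS.
      rewrite -cintD; [|exact: LS|exact/L1Zl/LS].
      by congr cint; apply/funext => t; rewrite mulN1r mulrBr.
    have c0 : 0 <= c by apply: le_trans (Hc 0); exact: nc_ge0.
    apply: (@le_lt_trans _ _ (c * K)).
      have [mf fi] := Lf.
      apply: le_trans (le_nc_cint (g := fun t => c * nc (f (row t))) _ _ _) _.
      * apply: cmeasM mf _; apply: (cmeasD (cmeas_cont (Sc _ spp.1) (@vmeas_row R d))).
        have := cmeasM (cmeas_cst Td (-1 : R[i])) (cmeas_cont (Sc _ sp.1) (@vmeas_row R d)).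
        by congr cmeas; apply/funext => t; rewrite mulN1r.
      * by have := integrableZl measurableT c fi.
      * by move=> t; rewrite ncM mulrC ler_wpM2r ?nc_ge0.
      * by rewrite RintegralZl.
    apply: (@le_lt_trans _ _ (c * (K + 1))); first by rewrite ler_wpM2l// lerDl.
    by rewrite -ltr_pdivlMr.
- by split=> //; exact/ccontP.
- split; first by apply/ccontP; exact: fourier_ccont.
  move=> psi [sp [K cK HK]] /=; rewrite !cintegralE.
  by apply: fourier_mult => //; apply: L1_compact_support cK HK; exact: Sc.
Qed.

End multiplication_formula.

(** * Uniqueness of the distributional Fourier transform *)

Section fourier_uniqueness.
Variables (R : realType) (d : nat).
Local Notation Rd := 'rV[R]_d.
Local Notation nc := (@Normc.normc R).
Local Notation lam := (@lebesgue_measure R).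
Local Notation mu := (@lebT R d).
Local Notation row := (@row_of_tuple R d).
Local Notation Td := (d.-tuple (measurableTypeR R)).

Section box_bump.
Variables (a : Rd) (r : R).
Hypothesis r0 : 0 < r.

Definition box_bump : Rd -> R[i]^o :=
  fun x => (tensor (fun i => smooth_bump (a ord0 i) r) [::] x)%:C.

Lemma box_bump_ge0 x : 0 <= tensor (fun i => smooth_bump (a ord0 i) r) [::] x.
Proof. by apply: prodr_ge0 => i _; exact: bump_ge0. Qed.

Lemma box_bump_out x : r < `|x - a| -> box_bump x = 0.
Proof.
move=> rx; have [i ri] : exists i, r <= `|(x - a) ord0 i|.
  apply: contrapT => /forallNP H; move: rx; rewrite ltNge => /negP; apply.
  apply: rV_norm_le; first exact: ltW.
  by move=> i; rewrite ltW// ltNge; exact/negP.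
by rewrite /box_bump /tensor (bigD1 i)//= bump_out ?mul0r//; move: ri; rewrite !mxE.
Qed.

Lemma compact_norm_ball (c : Rd) (M : R) : compact [set x : Rd | `|x - c| <= M].
Proof.
apply: bounded_closed_compact.
  exists (M + `|c|); split; first exact: num_real.
  move=> y My x /= xM; rewrite -[x](subrK c).
  by apply: le_trans (ler_normD _ _) _; apply: le_trans (ltW My); rewrite lerD2r.
have cn : continuous (fun x : Rd => `|x - c|).
  exact: (cont_comp (f := fun y : Rd => `|y|) (@norm_continuous _ _)
    (@continuous_shift R d c)).
apply: (@closed_comp _ _ (fun x : Rd => `|x - c|) [set y | y <= M]); last exact: closed_le.
by move=> x _; exact: cn.
Qed.

Lemma test_function_box_bump : test_function box_bump.
Proof.
split.
  have := cjet_csmooth (cjetZ 1 (jet_tensor (fun i : 'I_d => dseq_bump (a ord0 i) r))).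
  by congr csmooth; apply/funext => x; rewrite mul1r.
exists [set x | `|x - a| <= r]; first exact: compact_norm_ball.
by move=> x /negP; rewrite -ltNge; exact: box_bump_out.
Qed.

Let b i := smooth_bump (a ord0 i) r.
Let M i := `|a ord0 i| + `|r|.
Let M0 i : 0 < M i. Proof. by rewrite ltr_wpDl// normr_gt0 gt_eqF. Qed.
Let sb i n : supported (M i) (b i n).
Proof. by move=> x; exact: bump_supp. Qed.
Let db i : dseq (b i). Proof. exact: dseq_bump. Qed.

Lemma L1_bump (h : R -> R[i]) i : ccont h -> (forall x, nc (h x) <= 1) ->
  L1 lam (fun t => (b i 0 t)%:C * h t).
Proof.
move=> ch h1; have cb := dseq_cont (n := 0) (db i).
apply: (@L1_dom _ (measurableTypeR R) R _ _ (b i 0)).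
- apply: cmeasM.
    exact: cmeas_ofR (continuous_measurable_fun cb).
  by case: ch => c1 c2; split; exact: continuous_measurable_fun.
- exact: (integrable_supported cb (@sb i 0%N)).
- move=> x; rewrite ncM ncR ger0_norm; last exact: bump_ge0.
  by rewrite ler_piMr// bump_ge0.
Qed.

Lemma cint_box_bump : cint mu (fun t => box_bump (row t)) =
  (\prod_(i < d) \int[lam]_x b i 0 x)%:C.
Proof.
have L i : L1 lam (fun t => (b i 0 t)%:C).
  have := @L1_bump (fun=> 1) i (ccont_cst _ (1 : R[i])).
  under eq_fun do rewrite mulr1.
  by apply => // x; rewrite Normc.normc1.
have [_] := cint_prod L.
rewrite rmorph_prod /=; under [in RHS]eq_bigr do rewrite cint_ofR.
move=> <-; congr cint; apply/funext => t.
by rewrite /box_bump /tensor rmorph_prod; apply: eq_bigr => i _; rewrite mxE.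
Qed.

Lemma Rintegral_bump_gt0 i : 0 < \int[lam]_x b i 0 x.
Proof.
have cb := dseq_cont (n := 0) (db i).
have ib := integrable_supported cb (@sb i 0%N).
have lt1 : a ord0 i - r / 2 < a ord0 i + r / 2.
  by rewrite ltrBlDr -addrA ltrDl addr_gt0 ?divr_gt0.
have [c + Hc] := EVT_min (ltW lt1) (continuous_subspaceT cb).
rewrite in_itv /= => /andP[c1 c2].
have bc : 0 < b i 0 c by apply: bump_gt0; rewrite ltr_norml; apply/andP; split; lra.
apply: (@lt_le_trans _ _ (b i 0 c * r)); first exact: mulr_gt0.
set I := `[a ord0 i - r / 2, a ord0 i + r / 2] in Hc *.
have iD : lam.-integrable [set` I] (EFin \o (fun=> b i 0 c)).
  apply: continuous_compact_integrable; first exact: segment_compact.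
  by apply: continuous_subspaceT => x; exact: cvg_cst.
have -> : b i 0 c * r = \int[lam]_(x in [set` I]) (b i 0 c).
  rewrite Rintegral_cst//= lebesgue_measure_itv /= lte_fin lt1 -EFinB /=.
  by congr (_ * _); lra.
rewrite Rintegral_mkcond; apply: le_Rintegral => //.
- have := (integrable_mkcond _ _).1 iD => /(_ (measurable_itv _)).
  by rewrite restrict_EFin.
- move=> x _; rewrite patchE; case: ifPn => [/set_mem xe|_]; last exact: bump_ge0.
  exact: Hc.
Qed.

Let hh (J : {ffun 'I_d -> bool}) i := bumphat (b i) (if J i then pi / 2 else 0).
(** Multiplying out the product over the coordinates of (real part) + i (imaginary
    part), J selects the coordinates that contribute their imaginary part. *)
Let kap (J : {ffun 'I_d -> bool}) : R[i] := \prod_i (if J i then 'i else 1).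

Let dhh J i : dseq (hh J i).
Proof. exact: dseq_bumphat (db i) (@sb i). Qed.

Let rhh J i : rapid (hh J i).
Proof. exact: rapid_bumphat (M0 i) (db i) (@sb i). Qed.

(** The imaginary part is a cosine transform with phase pi/2. *)
Let bump_hat1 i xi : cint lam (fun t => (b i 0 t)%:C * ech (- (2 * pi * xi * t))) =
  (bumphat (b i) 0 0 xi)%:C + (bumphat (b i) (pi / 2) 0 xi)%:C * 'i.
Proof.
rewrite /cint /bumphat /costr /= !mul0r !addr0.
have -> : (fun t : measurableTypeR R => b i 0 t * cos (- (2 * pi * xi * t)) -
    0 * sin (- (2 * pi * xi * t))) = (fun t => b i 0 t * cos (2 * pi * xi * t + 0)).
  by apply/funext => t; rewrite mul0r subr0 addr0 cosN.
have -> : (fun t : measurableTypeR R => b i 0 t * sin (- (2 * pi * xi * t)) +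
    0 * cos (- (2 * pi * xi * t))) = (fun t => b i 0 t * cos (2 * pi * xi * t + pi / 2)).
  by apply/funext => t; rewrite mul0r addr0 cosDpihalf sinN.
by apply/eqP; rewrite eq_complex /= !mul0r !mulr0 !mulr1 !subr0 !addr0 !add0r !eqxx.
Qed.

Let F s (x : Rd) : R[i] := \sum_(J : {ffun 'I_d -> bool}) kap J * (tensor (hh J) s x)%:C.

Lemma fourier_box_bump : fourier box_bump = F [::].
Proof.
apply/funext => xi; rewrite fourierE.
have L i : L1 lam (fun t => (b i 0 t)%:C * ech (- (2 * pi * xi ord0 i * t))).
  apply: L1_bump; last by move=> x; rewrite nc_ech.
  apply: ccont_ech; apply: contN; apply: contM; [exact: cont_cst|exact: cont_id].
have [_] := cint_prod L.
under [X in _ = X -> _]eq_bigr do rewrite bump_hat1.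
have -> : (fun t : Td => \prod_(i < d) ((b i 0 (tnth t i))%:C *
    ech (- (2 * pi * xi ord0 i * tnth t i)))) =
  (fun t => box_bump (row t) * ech (- (2 * pi * dotprod xi (row t)))).
  apply/funext => t; rewrite big_split /=; congr (_ * _).
    by rewrite /box_bump /tensor rmorph_prod; apply: eq_bigr => i _; rewrite mxE.
  rewrite /dotprod mulr_sumr -sumrN (big_morph (@ech R) (@echD R) (@ech0 R)).
  by apply: eq_bigr => i _; rewrite mxE mulrA.
move=> ->; rewrite /F.
transitivity (\prod_(i < d) \sum_(j : bool) ((if j then 'i else 1) *
   (bumphat (b i) (if j then pi / 2 else 0) 0 (xi ord0 i))%:C)).
  apply: eq_bigr => i _; rewrite big_bool /= addrC mul1r; congr (_ + _).
  exact: mulrC.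
rewrite bigA_distr_bigA; apply: eq_bigr => J _.
by rewrite big_split /= /tensor rmorph_prod.
Qed.

(** The truncations of the transform of the bump, which are test functions. *)
Let Fe e s (x : Rd) : R[i] :=
  \sum_(J : {ffun 'I_d -> bool}) kap J * (tensor (truncate (hh J) e) s x)%:C.

Let cjF : cjet F.
Proof. by apply: cjet_sum => J; apply: cjetZ; apply: jet_tensor => i; exact: dhh. Qed.

Let cjFe e : cjet (Fe e).
Proof.
apply: cjet_sum => J; apply: cjetZ; apply: jet_tensor => i.
by apply: dseq_truncate => j; exact: dhh.
Qed.

Let FeF k s : exists2 C, 0 <= C & forall e x, 0 <= e <= 1 ->
  `|x| ^+ k * nc (Fe e s x - F s x) <= C * e.
Proof.
have /choice [C HC] J : exists C, 0 <= C /\ forall e x, 0 <= e <= 1 ->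
    `|x| ^+ k * `|tensor (truncate (hh J) e) s x - tensor (hh J) s x| <= C * e.
  have [C C0 HC] := tensor_truncate k s (fun i => rhh J i).
  by exists C.
exists (\sum_J nc (kap J) * C J).
  by apply: sumr_ge0 => J _; rewrite mulr_ge0 ?nc_ge0//; case: (HC J).
move=> e x e01; rewrite /Fe /F -sumrB.
apply: (@le_trans _ _ (`|x| ^+ k * \sum_J nc (kap J) *
   `|tensor (truncate (hh J) e) s x - tensor (hh J) s x|)).
  rewrite ler_wpM2l ?exprn_ge0//.
  elim/big_rec2 : _ => [|J y1 y2 _ IH]; first by rewrite nc0.
  apply: le_trans (ncD _ _) _; rewrite lerD// -mulrBr ncM ler_wpM2l ?nc_ge0//.
  by rewrite -ncR rmorphB.
rewrite mulr_sumr mulr_suml; apply: ler_sum => J _.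
rewrite mulrCA -(mulrA (nc _)) ler_wpM2l ?nc_ge0//.
exact: (HC J).2.
Qed.

Let schF : schwartz (F [::]).
Proof.
apply: cjet_schwartz cjF _ => k s.
have /choice [C HC] J : exists C, forall x, `|x| ^+ k * `|tensor (hh J) s x| <= C.
  exact: tensor_rapid (fun i => rhh J i).
exists (\sum_J nc (kap J) * C J) => x; rewrite /F.
apply: (@le_trans _ _ (`|x| ^+ k * \sum_J nc (kap J) * `|tensor (hh J) s x|)).
  rewrite ler_wpM2l ?exprn_ge0//.
  elim/big_rec2 : _ => [|J y1 y2 _ IH]; first by rewrite nc0.
  by apply: le_trans (ncD _ _) _; rewrite lerD// ncM ncR.
rewrite mulr_sumr; apply: ler_sum => J _.
by rewrite mulrCA ler_wpM2l ?nc_ge0.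
Qed.

Let schFe e : 0 <= e <= 1 -> schwartz (Fe e [::]).
Proof.
move=> e01; apply: cjet_schwartz (cjFe e) _ => k s.
have [C C0 HC] := FeF k s.
have [_ /(_ k s)] := schF.
case E: schwartz_seminorm => [D| |]//= _.
  exists (C * e + D) => x.
  have -> : Fe e s x = (Fe e s x - F s x) + F s x by ring.
  apply: (@le_trans _ _ (`|x| ^+ k * (nc (Fe e s x - F s x) + nc (F s x)))).
    by rewrite ler_wpM2l ?exprn_ge0// ncD.
  rewrite mulrDr lerD ?HC// -lee_fin -E.
  by apply: ereal_sup_ubound; exists x => //; rewrite cjet_cpartial.
have : ((`|0 : Rd| ^+ k * nc (cpartial s (F [::]) 0))%:E <= schwartz_seminorm k s (F [::]))%E.
  by apply: ereal_sup_ubound; exists 0.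
by rewrite E leeNy_eq.
Qed.

Let testFe e : 0 < e -> test_function (Fe e [::]).
Proof.
move=> e0; split; first exact: cjet_csmooth (cjFe e).
exists [set x | `|x - 0| <= e^-1]; first exact: compact_norm_ball.
move=> x /negP; rewrite -ltNge subr0 => ex.
by rewrite /Fe big1// => J _; rewrite tensor_truncate_out// mulr0.
Qed.

(** The transform of a bump is not compactly supported, so [represents] says nothing
    about it directly; its truncations converge to it in the Schwartz topology and,
    f being integrable, in the integral against f. *)
Lemma tempered_box_bump_hat (f : Rd -> R[i]^o) T : ccont f -> L1 mu (fun t => f (row t)) ->
  tempered T -> represents f T ->
  T (fourier box_bump) = cintegral (fun x => f x * fourier box_bump x).
Proof.
move=> cf Lf [_ cT] [_ rT]; rewrite fourier_box_bump.
pose e_ (n : nat) : R := n.+1%:R^-1.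
have e01 n : 0 <= e_ n <= 1.
  by rewrite invr_ge0 ler0n /= invf_le1 ?ltr0n// ler1n.
have eg0 n : 0 < e_ n by rewrite invr_gt0 ltr0n.
have ecvg (C dl : R) : 0 <= C -> 0 < dl -> \forall n \near \oo, C * e_ n < dl.
  move=> C0 dl0; have C1 : 0 < C + 1 by rewrite ltr_wpDl.
  have := near_infty_natSinv_lt (PosNum (divr_gt0 dl0 C1)).
  apply: filterS => n /= hn; apply: (@le_lt_trans _ _ ((C + 1) * e_ n)).
    by rewrite ler_wpM2r ?lerDl// ltW.
  by rewrite mulrC -ltr_pdivlMr.
have close1 dl : 0 < dl -> \forall n \near \oo, nc (T (Fe (e_ n) [::]) - T (F [::])) < dl.
  move=> dl0; have [U [[_ oU] UF HU]] := cT _ _ schF dl0.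
  have [m [p [dd [Pp dd0 Hp]]]] := oU _ UF.
  have H : \forall n \near \oo, forall i, (p i (Fe (e_ n) [::] - F [::])%R < dd%:E)%E.
    apply: filter_forall => i; have [[k s] _ <-] := Pp i.
    have [C C0 HC] := FeF k s.
    apply: filterS (ecvg C dd C0 dd0) => n hn.
    apply: (@le_lt_trans _ _ (C * e_ n)%:E); last by rewrite lte_fin.
    have := @cjet_seminorm_le R d (fun s x => Fe (e_ n) s x - F s x) k s (C * e_ n)
      (cjetD (cjFe (e_ n)) (cjetN cjF)).
    by apply => x; exact: HC.
  apply: filterS H => n hn; apply: HU; apply: Hp => //; exact: schFe.
have cF0 e : ccont (Fe e [::]) by have [/(_ [::])[? _] /(_ [::])[? _]] := cjFe e.
have cF1 : ccont (F [::]) by have [/(_ [::])[? _] /(_ [::])[? _]] := cjF.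
have [C C0 HC] := FeF 0 [::].
have HC' n x : nc (Fe (e_ n) [::] x - F [::] x) <= C * e_ n.
  by have := HC (e_ n) x (e01 n); rewrite expr0 mul1r.
have [B HB] : exists B, forall x, nc (F [::] x) <= B.
  have [D HD] : exists D, forall x : Rd, `|x| ^+ 0 * nc (F [::] x) <= D.
    have [_ /(_ 0%N [::])] := schF.
    case E: schwartz_seminorm => [D| |]//= _.
      exists D => x; rewrite -lee_fin -E; apply: ereal_sup_ubound; exists x => //.
      by rewrite cjet_cpartial.
    exists 0 => x; have : ((`|x| ^+ 0 * nc (cpartial [::] (F [::]) x))%:E <=
      schwartz_seminorm 0 [::] (F [::]))%E by apply: ereal_sup_ubound; exists x.
    by rewrite E leeNy_eq.
  by exists D => x; have := HD x; rewrite expr0 mul1r.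
have LF : L1 mu (fun t => f (row t) * F [::] (row t)).
  by apply: L1_bnd Lf _ _; [exact: cmeas_cont cF1 (@vmeas_row R d)|move=> x; exact: HB].
have mD n : cmeas (fun t => Fe (e_ n) [::] (row t) - F [::] (row t)).
  apply: cmeasD; first exact: cmeas_cont (cF0 _) (@vmeas_row R d).
  have := cmeasM (cmeas_cst Td (-1 : R[i])) (cmeas_cont cF1 (@vmeas_row R d)).
  by congr cmeas; apply/funext => t; rewrite mulN1r.
have LD n : L1 mu (fun t => f (row t) * (Fe (e_ n) [::] (row t) - F [::] (row t))).
  by apply: L1_bnd Lf (mD n) _ => x; exact: HC'.
pose K := \int[mu]_t nc (f (row t)).
have K0 : 0 <= K by apply: Rintegral_ge0 => t _; exact: nc_ge0.
have close2 n : nc (cintegral (fun x => f x * Fe (e_ n) [::] x) -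
    cintegral (fun x => f x * F [::] x)) <= K * C * e_ n.
  have -> : cintegral (fun x => f x * Fe (e_ n) [::] x) =
    cint mu (fun t => f (row t) * (Fe (e_ n) [::] (row t) - F [::] (row t))) +
    cintegral (fun x => f x * F [::] x).
    rewrite !cintegralE -cintD//; congr cint; apply/funext => t.
    by rewrite -mulrDr subrK.
  rewrite addrK; have [mf fi] := Lf.
  apply: le_trans (le_nc_cint (g := fun t => C * e_ n * nc (f (row t))) _ _ _) _.
  - exact: cmeasM mf (mD n).
  - by have := integrableZl measurableT (C * e_ n) fi.
  - by move=> t; rewrite ncM mulrC ler_wpM2r ?nc_ge0.
  - by rewrite RintegralZl// -/K mulrC mulrA.
apply/eqP; rewrite -subr_eq0; apply/eqP; apply: contrapT => /nc_gt0 ne0.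
set z := T _ - _ in ne0.
have h2 : 0 < nc z / 2 by rewrite divr_gt0.
near \oo => n.
have l1 : nc (T (Fe (e_ n) [::]) - T (F [::])) < nc z / 2.
  by near: n; exact: close1.
have l2 : K * C * e_ n < nc z / 2.
  by near: n; apply: ecvg => //; exact: mulr_ge0.
have rr := rT _ (testFe (eg0 n)).
have := ncD (T (F [::]) - T (Fe (e_ n) [::]))
  (cintegral (fun x => f x * Fe (e_ n) [::] x) - cintegral (fun x => f x * F [::] x)).
rewrite -rr addrA subrK -/z ncB leNgt => /negP; apply.
by have := close2 n; rewrite -rr => h; lra.
Unshelve. all: by end_near. Qed.

End box_bump.

(** Where D does not vanish, multiply by the conjugate of its value: on a small
    ball the real part stays positive, and so does its integral against a bump. *)
Lemma box_bump_separates (D : Rd -> R[i]) : ccont D ->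
  (forall a r, 0 < r -> cint mu (fun t => D (row t) * box_bump a r (row t)) = 0) ->
  forall x, D x = 0.
Proof.
move=> cD H a; apply: contrapT => D0.
pose E x := Re ((D a)^* * D x).
have [cE _] : ccont (fun x => (D a)^* * D x) by apply: ccontM cD; exact: ccont_cst.
have Ea : 0 < E a.
  by rewrite /E mulcJ_nc /= exprn_gt0//; exact: nc_gt0.
have h2 : 0 < E a / 2 by rewrite divr_gt0.
have [r /= r0 Hr] : exists2 r, 0 < r & forall x, `|x - a| <= r -> E a / 2 <= E x.
  move/(_ a)/cvgrPdist_lt/(_ _ h2)/nbhs_ballP: cE => [e /= e0 He].
  exists (e / 2); first by rewrite divr_gt0.
  move=> x xe; have : `|E a - E x| < E a / 2.
    apply: He; rewrite -ball_normE /= distrC; apply: le_lt_trans xe _.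
    by rewrite ltr_pdivrMr// ltr_pMr// ltr1n.
  by move=> /ltr_normlP [_]; lra.
have [_ [K cK HK]] := test_function_box_bump a r0.
have cb : ccont (box_bump a r).
  by have [[/(_ [::])[? _] /(_ [::])[? _]] _] := test_function_box_bump a r0.
have Lb := L1_compact_support cb cK HK.
have LD : L1 mu (fun t => D (row t) * box_bump a r (row t)).
  apply: (L1_compact_support (f := fun x => D x * box_bump a r x) _ cK); first exact: ccontM.
  by move=> x /HK ->; rewrite mulr0.
have := congr1 (@complex.Re R) (cintZl ((D a)^*) LD).
rewrite (H a r r0) mulr0 /=.
have := congr1 (@complex.Re R) (cint_box_bump a r); rewrite /=.
have pp : 0 < \prod_(i < d) (\int[lam]_x smooth_bump (a ord0 i) r 0 x).
  by apply: prodr_gt0 => i _; exact: Rintegral_bump_gt0.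
move=> Eb E0.
have : E a / 2 * \int[mu]_t Re (box_bump a r (row t)) <=
  \int[mu]_t Re ((D a)^* * (D (row t) * box_bump a r (row t))).
  rewrite -RintegralZl//; last exact: L1_Re Lb.
  apply: le_Rintegral => //.
  - by have := integrableZl measurableT (E a / 2) (L1_Re Lb).
  - exact: L1_Re (L1Zl _ LD).
  - move=> t _; rewrite mulrA /box_bump.
    set v := tensor _ _ _.
    have -> : Re ((D a)^* * D (row t) * v%:C) = E (row t) * v.
      by rewrite /E; case: ((D a)^* * D (row t)) => p q /=; rewrite mulr0 subr0.
    have [hr|hr] := lerP `|row t - a| r.
      by rewrite ler_wpM2r ?Hr//; exact: box_bump_ge0.
    have := congr1 (@complex.Re R) (box_bump_out r0 hr); rewrite /= -/v => ->.
    by rewrite !mulr0.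
rewrite /= in Eb E0 *.
by rewrite Eb E0 leNgt mulr_gt0.
Qed.

(** Against box bumps the values of g are prescribed by [tempered_box_bump_hat], and
    those of the integral transform agree with them by [fourier_mult]. *)
Lemma is_fourier_unique (f g : Rd -> R[i]^o) : ccont f -> L1 mu (fun t => f (row t)) ->
  is_fourier f g -> g = fourier f.
Proof.
move=> cf Lf [T [tT rf [cg rg]]].
have cg' : ccont g by exact/ccontP.
have cF := fourier_ccont Lf.
apply/funext => x; apply/eqP; rewrite -subr_eq0; apply/eqP.
move: x; apply: (box_bump_separates (D := fun x => g x - fourier f x)).
  apply: ccontD => //; have := ccontM (ccont_cst Rd (-1 : R[i])) cF.
  by congr ccont; apply/funext => x; rewrite mulN1r.
move=> a r r0.
have tb := test_function_box_bump a r0.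
have [_ [K cK HK]] := tb.
have cb : ccont (box_bump a r) by have [[/(_ [::])[? _] /(_ [::])[? _]] _] := tb.
have Lb := L1_compact_support cb cK HK.
have LM (h : Rd -> R[i]) : ccont h -> L1 mu (fun t => h (row t) * box_bump a r (row t)).
  move=> ch; apply: (L1_compact_support (f := fun x => h x * box_bump a r x) _ cK).
    exact: ccontM.
  by move=> x /HK ->; rewrite mulr0.
have := rg _ tb; rewrite /= (tempered_box_bump_hat a r0 cf Lf tT rf) !cintegralE fourier_mult// => e.
transitivity (cint mu (fun t => g (row t) * box_bump a r (row t) +
   (-1) * (fourier f (row t) * box_bump a r (row t)))).
  by congr cint; apply/funext => t; rewrite mulN1r mulrBl.
rewrite cintD; [|exact: LM|exact/L1Zl/LM].
by rewrite cintZl; [rewrite mulN1r -e subrr|exact: LM].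
Qed.

End fourier_uniqueness.

(** * Topologies generated by seminorms *)

Section seminormed_space.
Variables (R : realType) (X : lmodType R[i]) (S : submodClosed X).
Variables (I : Type) (q : I -> X -> R).
Local Notation nc := (@Normc.normc R).

Definition seminorms_on :=
  (forall i x y, x \in S -> y \in S -> q i (x + y) <= q i x + q i y) /\
  (forall i a x, x \in S -> q i (a *: x) = nc a * q i x).

(** The type of the elements of S, under a name that mentions the seminorms, so
    that the topology they generate can be attached to it. *)
Definition snspace (_ : seminorms_on) := {x : X | x \in S}.

Variable hq : seminorms_on.
Local Notation T := (snspace hq).

HB.instance Definition _ := SubChoice.copy T {x : X | x \in S}.
HB.instance Definition _ := [SubChoice_isSubLmodule of T by <:].

Let qv i (x : T) : R := q i (\val x).

Let qvD i x y : qv i (x + y) <= qv i x + qv i y.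
Proof. by rewrite /qv raddfD; apply: hq.1; exact: valP. Qed.

Let qvZ i (a : R[i]) x : qv i (a *: x) = nc a * qv i x.
Proof. by rewrite /qv linearZ; apply: hq.2; exact: valP. Qed.

Let qv0 i : qv i 0 = 0.
Proof. by rewrite -(scale0r 0) qvZ nc0 mul0r. Qed.

Let qvN i x : qv i (- x) = qv i x.
Proof. by rewrite -scaleN1r qvZ ncN Normc.normc1 mul1r. Qed.

Let qv_ge0 i x : 0 <= qv i x.
Proof.
have := qvD i x (- x); rewrite subrr qv0 qvN -mulr2n.
by rewrite pmulrn_lge0.
Qed.

Let snball n (k : 'I_n -> I) (x : T) (e : R) : set T :=
  [set y | forall j, qv (k j) (y - x) < e].

Let snnbhs (x : T) : set_system T :=
  [set A | exists n (k : 'I_n -> I) (e : R), 0 < e /\ snball k x e `<=` A].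

HB.instance Definition _ := hasNbhs.Build T snnbhs.

Let snball_center n (k : 'I_n -> I) x e : 0 < e -> snball k x e x.
Proof. by move=> e0 j; rewrite subrr qv0. Qed.

Let snnbhs_filter (x : T) : ProperFilter (nbhs x).
Proof.
apply: Build_ProperFilter_ex.
  by move=> A [n [k [e [e0 kA]]]]; exists x; apply: kA; exact: snball_center.
split.
- exists 0%N, (fun j : 'I_0 => match j with Ordinal _ h => False_rect I (notF h) end), 1.
  by split.
- move=> A B [n [k [e [e0 kA]]]] [n' [k' [e' [e0' kB]]]].
  exists (n + n')%N, (fun j : 'I_(n + n') => match fintype.split j with inl u => k u | inr v => k' v end),
    (Num.min e e'); split; first by rewrite lt_min e0.
  move=> y H; split.
    apply: kA => j; have := H (lshift n' j).
    by rewrite (unsplitK (inl j)) lt_min => /andP[].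
  apply: kB => j; have := H (rshift n j).
  by rewrite (unsplitK (inr j)) lt_min => /andP[].
- move=> A B AB [n [k [e [e0 kA]]]]; exists n, k, e; split => //.
  exact: subset_trans AB.
Qed.

Let snball_nbhs n (k : 'I_n -> I) (x : T) e : 0 < e -> nbhs x (snball k x e).
Proof. by move=> e0; exists n, k, e; split. Qed.

Let snnbhs_singleton (x : T) (A : set T) : nbhs x A -> A x.
Proof. by move=> [n [k [e [e0 kA]]]]; apply: kA; exact: snball_center. Qed.

Let max_qv n (k : 'I_n -> I) (z : T) e : 0 < e -> (forall j, qv (k j) z < e) ->
  exists2 e', 0 < e' & forall j, qv (k j) z <= e - e'.
Proof.
move=> e0 H.
exists (e - \big[Num.max/0]_(j < n) qv (k j) z).
  rewrite subr_gt0; apply: (big_ind (fun v => v < e)) => //.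
  by move=> x y xe ye; rewrite gt_max xe.
by move=> j; rewrite subKr; exact: le_bigmax.
Qed.

Let snball_open n (k : 'I_n -> I) (x y : T) e : 0 < e -> snball k x e y ->
  exists2 e', 0 < e' & snball k y e' `<=` snball k x e.
Proof.
move=> e0 xy; have [e' e0' H] := max_qv e0 xy; exists e' => // z yz j.
rewrite -(subrK y z) -addrA; apply: le_lt_trans (qvD _ _ _) _.
have -> : e = e' + (e - e') by rewrite addrC subrK.
by apply: ltr_leD; [exact: yz|exact: H].
Qed.

Let snnbhs_nbhs (x : T) (A : set T) : nbhs x A -> nbhs x (nbhs^~ A).
Proof.
move=> [n [k [e [e0 kA]]]]; exists n, k, e; split => // y xy.
have [e' e0' sub] := snball_open e0 xy; exists n, k, e'; split => //.
exact: subset_trans kA.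
Qed.

HB.instance Definition _ := Nbhs_isNbhsTopological.Build T
  snnbhs_filter snnbhs_singleton snnbhs_nbhs.

Let snadd_continuous : continuous (fun x : T * T => x.1 + x.2).
Proof.
move=> [x y] A /= [n [k [e [e0 kA]]]].
have e2 : 0 < e / 2 by rewrite divr_gt0.
exists (snball k x (e / 2), snball k y (e / 2)) => /=.
  by split; exact: snball_nbhs.
move=> [u v] /= [xu yv]; apply: kA => j /=.
rewrite opprD addrACA; apply: le_lt_trans (qvD _ _ _) _.
by rewrite (splitr e); apply: ltrD; [exact: xu|exact: yv].
Qed.

Let snscale_continuous : continuous (fun z : R[i]^o * T => z.1 *: z.2).
Proof.
move=> [a x] A /= [n [k [e [e0 kA]]]].
have e2 : 0 < e / 2 by rewrite divr_gt0.
pose m := \big[Num.max/0]_(j < n) qv (k j) x.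
have mP j : qv (k j) x <= m by exact: le_bigmax.
have m0 : 0 <= m by rewrite /m; elim/big_ind : _ => // u v u0 v0; rewrite le_max u0.
pose r := Num.min 1 (e / 2 / (m + 1)).
have m1 : 0 < m + 1 by rewrite ltr_wpDl.
have r0 : 0 < r by rewrite lt_min ltr01 divr_gt0.
pose s := e / 2 / (nc a + 1).
have na1 : 0 < nc a + 1 by rewrite ltr_wpDl ?nc_ge0.
have s0 : 0 < s by rewrite divr_gt0.
exists ([set b | nc (b - a) < r], snball k x s) => /=.
  split; last exact: snball_nbhs.
  exists r%:C; first by rewrite /= ltcR.
  by move=> b /=; rewrite /ball_ /= -opprB normrN normcE' ltcR.
move=> [b y] /= [ab xy]; apply: kA => j /=.
have -> : b *: y - a *: x = b *: (y - x) + (b - a) *: x.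
  by rewrite scalerBr scalerBl addrA subrK.
apply: le_lt_trans (qvD _ _ _) _; rewrite !qvZ (splitr e).
have b1 : nc b <= nc a + 1.
  rewrite -(subrK a b) addrC; apply: le_trans (ncD _ _) _.
  by rewrite lerD2l ltW// (lt_le_trans ab)// ge_min lexx.
apply: ltr_leD.
  apply: (@le_lt_trans _ _ ((nc a + 1) * qv (k j) (y - x))).
    by rewrite ler_wpM2r.
  by rewrite mulrC -ltr_pdivlMr//; exact: xy.
apply: (@le_trans _ _ (e / 2 / (m + 1) * (m + 1))).
  apply: ler_pM; rewrite ?nc_ge0//.
    by rewrite ltW// (lt_le_trans ab)// ge_min lexx orbT.
  by rewrite (le_trans (mP j))// lerDl.
by rewrite divfK// gt_eqF.
Qed.

Let snlocally_convex : exists2 B : set_system T,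
  (forall b, b \in B -> convex_set b) & basis B.
Proof.
exists [set A | exists n (k : 'I_n -> I) x e, 0 < e /\ A = snball k x e].
  move=> A /set_mem [n [k [x [e [e0 ->]]]]] y z l /set_mem yA /set_mem zA.
  apply/mem_set => j.
  have l0 : 0 <= l%:num by [].
  have l1 : l%:num <= 1 by [].
  have [lr li] : l%:num = (Re l%:num)%:C /\ 0 <= Re l%:num <= 1.
    move: l0 l1; case: (l%:num) => a b; rewrite !lecE /= => /andP[/eqP -> a0] /andP[_ a1].
    by rewrite a0.
  have -> : (conv l y z : T) - x = l%:num *: (y - x) + (1 - l%:num) *: (z - x).
    have -> : conv l y z = l%:num *: (y : T) + (1 - l%:num) *: (z : T) :> T by [].
    rewrite !scalerBr addrACA -opprD; congr (_ - _).
    by rewrite -scalerDl addrC subrK scale1r.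
  apply: le_lt_trans (qvD _ _ _) _; rewrite !qvZ.
  move: li; set t := Re _ in lr * => /andP[t0 t1].
  have -> : nc l%:num = t by rewrite lr ncR ger0_norm.
  have -> : nc (1 - l%:num) = 1 - t.
    by rewrite lr -(rmorph1 (real_complex R)) -rmorphB ncR ger0_norm// subr_ge0.
  have := yA j; have := zA j.
  set u := qv _ (y - x); set v := qv _ (z - x) => ve ue.
  have : 0 <= (e - u) * t by rewrite mulr_ge0 ?subr_ge0 ?(ltW ue).
  have : 0 <= (e - v) * (1 - t) by rewrite mulr_ge0 ?subr_ge0 ?(ltW ve).
  have [t0'|t0'] := ltrP 0 t.
    have : 0 < (e - u) * t by rewrite mulr_gt0// subr_gt0.
    lra.
  have -> : t = 0 by apply/eqP; rewrite eq_le t0'.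
  lra.
split.
  move=> A [n [k [x [e [e0 ->]]]]]; rewrite openE => y xy.
  by have [e' e0' sub] := snball_open e0 xy; exists n, k, e'.
move=> x A [n [k [e [e0 kA]]]]; exists (snball k x e) => //; split.
  by exists n, k, x, e.
exact: snball_center.
Qed.

HB.instance Definition _ := PreTopologicalLmod_isTvs.Build R[i] T
  snadd_continuous snscale_continuous snlocally_convex.
HB.instance Definition _ :=
  PreTopologicalNmodule_isTopologicalNmodule.Build T snadd_continuous.
HB.instance Definition _ :=
  TopologicalNmodule_isTopologicalLmodule.Build R[i] T snscale_continuous.
HB.instance Definition _ := Uniform_isTvs.Build R[i] T snlocally_convex.

Lemma snspace_nbhsP (x : T) (A : set T) : nbhs x A <->
  exists n (k : 'I_n -> I) (e : R), 0 < e /\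
    forall y : T, (forall j, q (k j) (\val y - \val x) < e) -> A y.
Proof.
by split=> -[n [k [e [e0 kA]]]]; exists n, k, e.
Qed.

End seminormed_space.

Lemma seminorm_topology_lc (R : realType) (X : lmodType R[i]) (E : set X)
    (P : set (X -> \bar R)) :
  E 0 -> (forall (a : R[i]) x y, E x -> E y -> E (a *: x + y)) ->
  (forall p, P p -> exists r : X -> R, [/\ forall x, E x -> p x = (r x)%:E,
     forall x y, E x -> E y -> r (x + y) <= r x + r y &
     forall a x, E x -> r (a *: x) = Normc.normc a * r x]) ->
  lc_topology E (seminorm_topology E P).
Proof.
move=> E0 Elin HP.
pose pE : {pred X} := fun x => x \in E.
have clE : submod_closed pE.
  by split; [exact: mem_set|move=> a x y /set_mem Ex /set_mem Ey; apply/mem_set/Elin].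
pose Sc := GRing.isSubmodClosed.Build R[i] X pE clE.
pose S : submodClosed X := HB.pack pE Sc.
have SE x : (x \in S) = (x \in E) by [].
pose I := {p | P p}.
have rex (i : I) : exists r : X -> R, [/\ forall x, E x -> proj1_sig i x = (r x)%:E,
     forall x y, E x -> E y -> r (x + y) <= r x + r y &
     forall a x, E x -> r (a *: x) = Normc.normc a * r x].
  by apply: HP; case: i.
have [r rP] := choice rex.
have hq : seminorms_on S r.
  by split=> [i x y|i a x]; have [_ h1 h2] := rP i; rewrite !SE => /set_mem Ex;
    [move=> /set_mem Ey; exact: h1|exact: h2].
exists [the tvsType R[i] of snspace hq], [the {linear snspace hq -> X} of \val]; split.
- exact: val_inj.
- apply/seteqP; split => x /=.
    by move=> [y _ <-]; apply/set_mem; exact: (valP y).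
  by move=> Ex; exists (exist _ x (mem_set Ex)).
apply/seteqP; split => U.
  move=> [UE Unb]; exists (\val @^-1` U); last first.
    apply/seteqP; split => x /=; first by move=> [y Uy <-].
    by move=> Ux; exists (exist _ x (mem_set (UE _ Ux))).
  rewrite openE => x Ux; apply/snspace_nbhsP.
  have [n [p [e [Pp e0 H]]]] := Unb _ Ux.
  exists n, (fun j => exist _ (p j) (Pp j)), e; split => // y Hy.
  have Ev (z : snspace hq) : E (\val z) by apply/set_mem; exact: (valP z).
  apply: H => [|j]; first exact: Ev.
  have [h _ _] := rP (exist _ (p j) (Pp j)).
  have Exy : E (\val y - \val x) by rewrite -raddfB; exact: Ev.
  by have /= -> := h _ Exy; rewrite lte_fin.
move=> [V Vo <-]; split=> [x [y _ <-]|x [y Vy <-]].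
  by apply/set_mem; exact: (valP y).
move: Vo; rewrite openE => /(_ y Vy) /snspace_nbhsP [n [k [e [e0 H]]]].
exists n, (fun j => proj1_sig (k j)), e; split => //.
  by move=> j; exact: (proj2_sig (k j)).
move=> z Ez Hz; exists (exist _ z (mem_set Ez)) => //; apply: H => j /=.
have [h _ _] := rP (k j).
have Ezy : E (z - \val y).
  rewrite addrC -scaleN1r; apply: Elin => //; apply/set_mem; exact: (valP y).
by have := Hz j; rewrite (h _ Ezy) lte_fin.
Qed.

(** A convex neighbourhood of the origin, carried to E by the linear injection that
    defines the topology. *)
Lemma lc_topology_convex_nbhs (R : realType) (X : lmodType R[i]) (E : set X)
    (tau : set (set X)) (U : set X) (x : X) :
  lc_topology E tau -> tau U -> U x ->
  exists C : set X, [/\ tau C, C 0, forall y, C y -> U (x + y) &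
    forall (t : R) y z, 0 <= t <= 1 -> C y -> C z -> C (t%:C *: y + (1 - t)%:C *: z)].
Proof.
move=> [T [f [finj fE ->]]] [V Vo <-] [u Vu <-].
have nV : nbhs 0 [set z | V (u + z)].
  have /(_ V) := @add_continuous T (u, 0); rewrite /= addr0.
  move=> /(_ _)[|[A B] /= [nA nB] AB]; first exact: open_nbhs_nbhs.
  by apply: filterS nB => z Bz; apply: (AB (u, z)); split => //; exact: nbhs_singleton.
have [B Bconv [Bopen /(_ 0)/(_ _ nV) [C /= [BC C0] CV]]] := @locally_convex _ T.
exists (f @` C); split.
- by exists C => //; exact: Bopen.
- by exists 0 => //; rewrite linear0.
- by move=> _ [y Cy <-]; exists (u + y); [exact: CV|rewrite linearD].
- move=> t _ _ /andP[t0 t1] [y Cy <-] [z Cz <-].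
  have tc0 : 0 <= t%:C by rewrite lecR.
  have tc1 : t%:C <= 1 :> R[i] by rewrite lecR.
  have := Bconv C (mem_set BC) y z (Itv01 tc0 tc1) (mem_set Cy) (mem_set Cz).
  move=> /set_mem Cc; exists (t%:C *: y + (1 - t)%:C *: z).
    by rewrite rmorphB /= rmorph1.
  by rewrite linearD !linearZ.
Qed.

(** * Weight sequences and the Nachbin family *)

Lemma contV (R : realType) (T : topologicalType) (f : T -> R) : continuous f ->
  (forall x, 0 < f x) -> continuous (fun x => (f x)^-1).
Proof.
move=> cf f0 x; have /inv_continuous ci : f x != 0 by rewrite gt_eqF.
exact: (continuous_comp (cf x) ci).
Qed.

Section weight_sequences.
Variables (R : realType) (d : nat).
Local Notation Rd := 'rV[R]_d.
Local Notation nc := (@Normc.normc R).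
Local Notation mu := (@lebT R d).
Local Notation row := (@row_of_tuple R d).
Implicit Types (w : nat -> Rd -> R).

(** The members of integer index are cofinal in a weight function system, so that
    its conditions restrict to sequences; in Sq, monotonicity merges the two
    indices into one. *)
Record wseq w : Prop := WSeq {
  wseq_cont : forall n, continuous (w n);
  wseq_ge1 : forall n x, 1 <= w n x;
  wseq_dec : forall n m x, (n <= m)%N -> w m x <= w n x;
  wseq_M : forall m n, exists l, exists2 C : R, 0 < C &
    forall x y, w l (x + y) <= C * w m x * w n y;
  wseq_Sq : forall n, exists m, exists2 C : R, 0 < C &
    forall x, w m x ^+ 2 <= C * w n x;
  wseq_N : forall m, exists l,
    mu.-integrable setT (fun t => (w l (row t) / w m (row t))%:E) }.

Definition nat_pos (n : nat) : {posnum R} := PosNum (ltr0Sn R n).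

Definition wnat (W : {posnum R} -> Rd -> R) : nat -> Rd -> R := fun n => W (nat_pos n).

Lemma wnat_cofinal W l : weight_function_system W -> exists n, forall x, wnat W n x <= W l x.
Proof.
move=> [_ Wd]; exists (Num.truncn l%:num) => x; apply: Wd.
by rewrite /= ltW// -natr1 natr1 truncnS_gt.
Qed.

Lemma wseq_system W : weight_function_system W -> condM W -> condSq W -> condN W ->
  wseq (wnat W).
Proof.
move=> hW hM hSq hN; have [Ww Wd] := hW.
have c n : continuous (wnat W n) by case: (Ww (nat_pos n)).
have g n x : 1 <= wnat W n x by have [_ h] := Ww (nat_pos n); exact: h.
have g0 n x : 0 < wnat W n x by apply: lt_le_trans (g n x).
split=> //.
- by move=> n m x nm; apply: Wd; rewrite /= ler_nat.
- move=> m n; have [l [C C0 H]] := hM (nat_pos m) (nat_pos n).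
  have [k Hk] := wnat_cofinal l hW; exists k, C => // x y.
  exact: le_trans (Hk _) (H x y).
- move=> n; have [l [m [C C0 H]]] := hSq (nat_pos n).
  have [k Hk] := wnat_cofinal l hW; have [k' Hk'] := wnat_cofinal m hW.
  exists (maxn k k'), C => // x; apply: le_trans (H x).
  have dk : wnat W (maxn k k') x <= wnat W k x.
    by apply: Wd; rewrite /= ler_nat ltnS leq_maxl.
  have dk' : wnat W (maxn k k') x <= wnat W k' x.
    by apply: Wd; rewrite /= ler_nat ltnS leq_maxr.
  rewrite expr2 ler_pM// ?(ltW (g0 _ _))//.
    exact: le_trans dk (Hk x).
  exact: le_trans dk' (Hk' x).
- move=> m; have [l H] := hN (nat_pos m).
  have [k Hk] := wnat_cofinal l hW; exists k.
  apply: le_integrable H => //.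
    apply/measurable_EFinP; apply: measurable_funM.
      exact: (measurable_continuous (c k) (@vmeas_row R d)).
    apply: (measurable_continuous (F := fun x => (wnat W m x)^-1) _ (@vmeas_row R d)).
    exact: contV (c m) (g0 m).
  move=> t _; rewrite lee_fin ger0_norm; last by rewrite divr_ge0// ltW.
  apply: le_trans (ler_norm _).
  by rewrite ler_wpM2r// invr_ge0 ltW.
Qed.

(** With g = w these are elements of the Nachbin family for all constants B >= 1,
    and B can be adapted to the data at hand. *)
Definition infw (g : nat -> Rd -> R) (B : nat -> R) (x : Rd) : R :=
  inf [set B k * g k x | k in setT].

Section infimum.
Variables (g : nat -> Rd -> R) (B : nat -> R).
Hypotheses (g1 : forall k x, 1 <= g k x) (B1 : forall k, 1 <= B k).

Let B0 k : 0 <= B k. Proof. exact: le_trans (B1 k). Qed.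

Let lb x : has_lbound [set B k * g k x | k in setT].
Proof. by exists 0 => _ [k _ <-]; rewrite mulr_ge0// (le_trans _ (g1 k x)). Qed.

Lemma infw_le k x : infw g B x <= B k * g k x.
Proof. by apply: ge_inf => //; exists k. Qed.

Lemma le_infw c x : (forall k, c <= B k * g k x) -> c <= infw g B x.
Proof. by move=> H; apply: lb_le_inf; [exists (B 0%N * g 0%N x), 0|move=> _ [k _ <-]]. Qed.

Lemma infw_ge1 x : 1 <= infw g B x.
Proof. by apply: le_infw => k; rewrite -[leLHS]mulr1 ler_pM. Qed.

Lemma infw_lt x a : infw g B x < a -> exists k, B k * g k x < a.
Proof.
move=> h; apply: contrapT => /forallNP H; move: h; rewrite ltNge => /negP; apply.
by apply: le_infw => k; rewrite leNgt; exact/negP.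
Qed.

Lemma infw_usc : (forall k, continuous (g k)) -> upper_semicontinuous (infw g B).
Proof.
move=> cg x a /infw_lt[k Hk].
have ck : continuous (fun y => B k * g k y).
  by apply: contM; [exact: cont_cst|exact: cg].
have := ck x; move/cvgr_lt => /(_ _ Hk).
by apply: filterS => y; apply: le_lt_trans; exact: infw_le.
Qed.

End infimum.

Section theory.
Variable w : nat -> Rd -> R.
Hypothesis hw : wseq w.

Lemma wseq_gt0 n x : 0 < w n x.
Proof. exact: lt_le_trans (wseq_ge1 hw n x). Qed.

Lemma wseq_ge0 n x : 0 <= w n x.
Proof. exact: ltW (wseq_gt0 n x). Qed.

Lemma continuous_wseqV n : continuous (fun x => (w n x)^-1).
Proof. exact: contV (@wseq_cont w hw n) (wseq_gt0 n). Qed.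

Lemma integrable_wseqV n : mu.-integrable setT (fun t => ((w n (row t))^-1)%:E).
Proof.
have [l H] := wseq_N hw n; apply: le_integrable H => //.
  apply/measurable_EFinP.
  exact: (measurable_continuous (F := fun x => (w n x)^-1) (@continuous_wseqV n)
    (@vmeas_row R d)).
move=> t _; rewrite lee_fin !ger0_norm ?divr_ge0 ?invr_ge0 ?wseq_ge0//.
by rewrite -[leLHS]mul1r ler_wpM2r ?invr_ge0 ?wseq_ge0// wseq_ge1.
Qed.

Lemma L1_wseq (f : Rd -> R[i]) n C : ccont f -> (forall x, nc (f x) * w n x <= C) ->
  L1 mu (fun t => f (row t)).
Proof.
move=> cf fw; have := integrableZl measurableT C (integrable_wseqV n).
move/L1_dom; apply; first exact: (cmeas_cont cf (@vmeas_row R d)).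
by move=> t; rewrite ler_pdivlMr ?wseq_gt0.
Qed.

End theory.

Lemma nachbin_infw W B : weight_function_system W -> (forall k, 1 <= B k) -> wseq (wnat W) ->
  nachbin W (infw (wnat W) B).
Proof.
move=> hW B1 hw; split.
- by move=> x; apply: le_trans (infw_ge1 (wseq_ge1 hw) B1 x).
- exact: infw_usc (wseq_ge1 hw) B1 (wseq_cont hw).
- move=> l; have [n Hn] := wnat_cofinal l hW.
  exists (B n) => _ [x _ <-]; have W1 : 0 < W l x by apply: lt_le_trans (Hn x); exact: wseq_gt0.
  rewrite ler_pdivrMr//; apply: le_trans (infw_le (wseq_ge1 hw) B1 n x) _.
  by rewrite ler_wpM2l// (le_trans _ (B1 n)).
Qed.

(** If every weight of the sequence failed as a bound, an infimum of weights that is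
    large at the successive points of failure would detect it. *)
Lemma nachbin_bounded W (h : Rd -> R) : weight_function_system W -> wseq (wnat W) ->
  (forall x, 0 <= h x) ->
  (forall v, nachbin W v -> exists C, forall x, h x * v x <= C) ->
  exists n C, forall x, h x * wnat W n x <= C.
Proof.
move=> hW hw h0 H; apply: contrapT => N.
have /choice [x Hx] n : exists x, n%:R < h x * wnat W n x.
  apply: contrapT => /forallNP K; apply: N; exists n, n%:R => x.
  by rewrite leNgt; exact/negP.
set w := wnat W in Hx N *.
(* makes B k * w k at least w n at x n for n < k; monotonicity covers k <= n *)
pose B k := 1 + \sum_(n < k) w n (x n) / w k (x n).
have q0 n k y : 0 <= w n y / w k y by rewrite divr_ge0// wseq_ge0.
have B1 k : 1 <= B k by rewrite lerDl sumr_ge0.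
have [C HC] := H _ (nachbin_infw hW B1 hw).
have C0 : 0 <= C.
  apply: le_trans (HC 0); rewrite mulr_ge0//.
  by apply: le_trans (infw_ge1 (wseq_ge1 hw) B1 0).
have [n Cn] : exists n, C < n%:R.
  by exists (Num.truncn C).+1; rewrite truncnS_gt.
have := HC (x n); apply/negP; rewrite -ltNge; apply: lt_trans Cn _.
apply: lt_le_trans (Hx n) _; rewrite ler_wpM2l//.
apply: le_infw => k; have [kn|nk] := leqP k n.
  apply: le_trans (wseq_dec hw (x n) kn) _.
  by rewrite ler_peMl// wseq_ge0.
rewrite -ler_pdivrMr ?wseq_gt0// /B.
rewrite (bigD1 (Ordinal nk))//= addrCA lerDl addr_ge0// sumr_ge0//.
Qed.

End weight_sequences.

(** * The short-time Fourier transform *)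

Section window_transform.
Variables (R : realType) (d : nat).
Local Notation Rd := 'rV[R]_d.
Local Notation nc := (@Normc.normc R).
Local Notation mu := (@lebT R d).
Local Notation row := (@row_of_tuple R d).
Local Notation Td := (d.-tuple (measurableTypeR R)).
Implicit Types (phi rho f g : Rd -> R[i]).

Lemma ccont_reflect f (x : Rd) : ccont f -> ccont (fun t : Rd => f (x - t)).
Proof.
move=> cf; apply: (ccont_comp (f := f)) => // t.
by refine (@cvgB R Rd Rd (nbhs t) _ (fun=> x) (fun y => y) _ _ _ _);
  [exact: cvg_cst|exact: cvg_id].
Qed.

Lemma bounded_L1_mul f g C : L1 mu (fun t => f (row t)) -> ccont g ->
  (forall x, nc (g x) <= C) -> L1 mu (fun t => f (row t) * g (row t)).
Proof.
move=> Lf cg gC; apply: L1_bnd Lf _ _; last by move=> x; exact: gC.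
exact: cmeas_cont (@vmeas_row R d).
Qed.

Definition convn f g x : R := \int[mu]_t (nc (f (row t)) * nc (g (x - row t))).

Lemma convn_integrable f g C x : L1 mu (fun t => f (row t)) -> ccont g ->
  (forall x, nc (g x) <= C) ->
  mu.-integrable setT (fun t => (nc (f (row t)) * nc (g (x - row t)))%:E).
Proof.
move=> Lf cg gC.
have [_] := bounded_L1_mul Lf (ccont_reflect x cg) (fun y => gC _).
by congr (integrable _ _); apply/funext => t; rewrite ncM.
Qed.

(** The short-time Fourier transform of phi with the window rho reflected at x. *)
Definition stft phi rho x xi : R[i] := fourier (fun t => phi t * conjc (rho (x - t))) xi.

Section bounds.
Variables (phi rho : Rd -> R[i]) (C : R).
Hypotheses (cphi : ccont phi) (Lphi : L1 mu (fun t => phi (row t))).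
Hypotheses (crho : ccont rho) (rhoC : forall x, nc (rho x) <= C).

Let cJ (x : Rd) : ccont (fun t : Rd => conjc (rho (x - t))).
Proof. by apply: ccont_conj; exact: ccont_reflect. Qed.

Lemma L1_stft_integrand x : L1 mu (fun t => phi (row t) * conjc (rho (x - row t))).
Proof.
apply: (bounded_L1_mul (g := fun t => conjc (rho (x - t))) (C := C)) => // y.
by rewrite ncJ.
Qed.

Lemma stft_le_conv x xi : nc (stft phi rho x xi) <= convn phi rho x.
Proof.
apply: le_trans (fourier_bnd _ (L1_stft_integrand x)) _.
rewrite /convn le_eqVlt; apply/orP; left; apply/eqP.
by apply: eq_Rintegral => t _; rewrite ncM ncJ.
Qed.

Lemma ccont_stft : ccont (fun p : Rd * Rd => stft phi rho p.1 p.2).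
Proof.
have E p : stft phi rho p.1 p.2 = cint mu (fun t => phi (row t) * conjc (rho (p.1 - row t)) *
    ech (- (2 * pi * dotprod p.2 (row t)))) by rewrite /stft fourierE.
under eq_fun do rewrite E.
have [_ Li] := Lphi.
apply: (ccont_cint (g := fun t => C * nc (phi (row t)))).
- move=> p; case: (L1_stft_integrand p.1) => m _; apply: cmeasM m _.
  apply: cmeas_ech; apply: measurable_funN; apply: measurable_funM.
    exact: measurable_cst.
  exact: measurable_continuous (@continuous_dotprodr R d p.2) (@vmeas_row R d).
- move=> t; apply: ccontM; first apply: ccontM (ccont_cst _ _) _.
    apply: ccont_conj; apply: (ccont_comp (f := rho)) => //.
    exact: cont_comp (@continuous_shift R d (row t)) (@cont_fst _ _).
  apply: ccont_ech; apply: contN; apply: contM; first exact: cont_cst.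
  apply: (cont_comp (f := fun y => dotprod y (row t))); last exact: cont_snd.
  exact: continuous_dotprodl.
- by have := integrableZl measurableT C Li.
- move=> p t; rewrite !ncM nc_ech ncJ mulr1 mulrC.
  by rewrite ler_wpM2r// nc_ge0.
Qed.

Hypotheses (Lrho : L1 mu (fun t => rho (row t))) (LFrho : L1 mu (fun t => fourier rho (row t))).

(** The frequency side of the transform: by inversion the window is itself a
    Fourier integral, and Fubini exchanges the roles of time and frequency. *)
Lemma stft_le_conv_fourier x xi : L1 mu (fun t => fourier phi (row t)) ->
  nc (stft phi rho x xi) <=
  (nc (inversion_constant R d))^-1 * convn (fourier phi) (fourier rho) xi.
Proof.
move=> LFphi.
set c0 := inversion_constant R d.
have cJM (a b : R[i]) : conjc (a * b) = conjc a * conjc b by exact: (rmorphM (@conjc R)).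
have c00 : c0 != 0 := inversion_constant_neq0 R d.
pose g eta := conjc (fourier rho (xi - eta)) * ech (- (2 * pi * dotprod (xi - eta) x)).
pose h s := conjc (fourier rho s) * ech (- (2 * pi * dotprod s x)).
have cF : ccont (fourier rho) := fourier_ccont Lrho.
have Lh : L1 mu (fun s => h (row s)).
  apply: (bounded_L1_mul (f := fun s => conjc (fourier rho s))
    (g := fun s => ech (- (2 * pi * dotprod s x))) (C := 1)).
  - exact: L1_conj LFrho.
  - by under eq_fun do rewrite -mulNr; exact: ccont_charl.
  - by move=> s; rewrite nc_ech.
have m1 : (-1 : R) != 0 by rewrite oppr_eq0 oner_eq0.
have gE eta : g eta = h ((-1) *: eta + xi) by rewrite /g /h scaleN1r addrC.
have Lg : L1 mu (fun s => g (row s)).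
  by have := L1_affine xi m1 Lh; congr L1; apply/funext => s; rewrite gE.
have Fg t : fourier g t = conjc c0 * conjc (rho (x - t)) * ech (- (2 * pi * dotprod xi t)).
  rewrite fourierE.
  have Lk : L1 mu (fun s => h (row s) * ech (- (2 * pi * dotprod t (xi - row s)))).
    apply: (bounded_L1_mul (f := h) (g := fun s => ech (- (2 * pi * dotprod t (xi - s)))) (C := 1)) => //.
      apply: (ccont_reflect (f := fun u => ech (- (2 * pi * dotprod t u)))).
      exact: ccont_charNr.
    by move=> s; rewrite nc_ech.
  have := cint_affine (f := fun s => h s * ech (- (2 * pi * dotprod t (xi - s)))) xi m1 Lk.
  rewrite normrN normr1 expr1n invr1 mul1r => E1.
  have -> : (fun s => g (row s) * ech (- (2 * pi * dotprod t (row s)))) =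
    (fun s => h (-1 *: row s + xi) * ech (- (2 * pi * dotprod t (xi - (-1 *: row s + xi))))).
    apply/funext => s; rewrite gE; congr (_ * ech (- (_ * dotprod _ _))).
    by rewrite scaleN1r opprD opprK addrCA subrr addr0.
  rewrite E1.
  have -> : (fun s => h (row s) * ech (- (2 * pi * dotprod t (xi - row s)))) =
    (fun s => ech (- (2 * pi * dotprod xi t)) *
      conjc (fourier rho (row s) * ech (2 * pi * dotprod (row s) (x - t)))).
    apply/funext => s; rewrite /h cJM ech_conj mulrCA -mulrA; congr (_ * _).
    rewrite -!echD; congr ech.
    by rewrite !dotprodDr !dotprodNr (dotprodC t xi) (dotprodC t (row s)); ring.
  have Lc : L1 mu (fun s => fourier rho (row s) * ech (2 * pi * dotprod (row s) (x - t))).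
    have cE : ccont (fun s : Rd => ech (2 * pi * dotprod s (x - t))).
      exact: ccont_charl.
    have bE s : nc (ech (2 * pi * dotprod s (x - t))) <= 1 by rewrite nc_ech.
    exact: (bounded_L1_mul LFrho cE bE).
  rewrite (cintZl _ (L1_conj Lc)) (cint_conj Lc).
  by rewrite (fourier_inversion crho rhoC Lrho LFrho) cJM mulrC.
have E : conjc c0 * stft phi rho x xi = cint mu (fun t => fourier phi (row t) * g (row t)).
  rewrite -fourier_mult// /stft fourierE -cintZl; last first.
    apply: (bounded_L1_mul (f := fun t => phi t * conjc (rho (x - t)))
      (g := fun t => ech (- (2 * pi * dotprod xi t))) (C := 1)).
    - exact: L1_stft_integrand.
    - exact: ccont_charNr.
    - by move=> t; rewrite nc_ech.
  congr cint; apply/funext => t; rewrite Fg; ring.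
have cn : 0 < nc c0 by apply: nc_gt0; exact/eqP.
rewrite -ler_pdivrMl ?invr_gt0// invrK -[X in X * _]ncJ -ncM E.
have [K HK] : exists K, forall s, nc (fourier rho s) <= K.
  by exists (\int[mu]_t nc (rho (row t))) => s; exact: fourier_bnd.
apply: le_nc_cint.
- have [mf _] := LFphi; have [mg _] := Lg; exact: cmeasM.
- exact: convn_integrable LFphi cF HK.
- by move=> t; rewrite ncM ler_wpM2l ?nc_ge0// /g ncM nc_ech mulr1 ncJ.
Qed.

Lemma stft_inversion M x t : (forall y, nc (phi y) <= M) -> L1 mu (fun s => stft phi rho x (row s)) ->
  cint mu (fun s => stft phi rho x (row s) * ech (2 * pi * dotprod (row s) t)) =
  inversion_constant R d * (phi t * conjc (rho (x - t))).
Proof.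
move=> pM LV.
have cf : ccont (fun t => phi t * conjc (rho (x - t))) := ccontM cphi (@cJ x).
have HM y : nc (phi y * conjc (rho (x - y))) <= M * C.
  by rewrite ncM ncJ ler_pM ?nc_ge0.
exact: (fourier_inversion cf HM (L1_stft_integrand x) LV t).
Qed.

End bounds.

End window_transform.

(** * Synthesis from time-frequency coefficients *)

Section squared_measure.
Variables (R : realType) (d : nat).
Local Notation mu := (@lebT R d).

(** The product of Lebesgue measure with itself, under a head symbol on which
    sigma-finiteness can be declared: it becomes a factor of a product in turn. *)
Definition lebT2 : set (d.-tuple (measurableTypeR R) * d.-tuple (measurableTypeR R))%type
  -> \bar R := (mu \x mu)%E.

HB.instance Definition _ := Measure.on lebT2.

Lemma lebT2_sigma_finite : sigma_finite setT lebT2.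
Proof.
have /sigma_finiteP [F [FT Fnd Ffin]] := sigma_finiteT mu.
exists (fun i => F i `*` F i) => [|i].
  apply/esym/seteqP; split=> // -[x y] _; have := I.
  rewrite -[True]/([set: d.-tuple (measurableTypeR R)] x) {1}FT => -[i _ Fx].
  have := I; rewrite -[True]/([set: d.-tuple (measurableTypeR R)] y) {1}FT => -[j _ Fy].
  exists (maxn i j) => //; split=> /=.
    by apply: (subsetPset _ _ (Fnd _ _ (leq_maxl i j))).
  by apply: (subsetPset _ _ (Fnd _ _ (leq_maxr i j))).
have [mF Fo] := Ffin i; split; first exact: measurableX.
by rewrite /lebT2 product_measure1E// lte_mul_pinfty// ge0_fin_numE.
Qed.

HB.instance Definition _ :=
  @Measure_isSigmaFinite.Build _ _ _ lebT2 lebT2_sigma_finite.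

End squared_measure.

Section synthesis.
Variables (R : realType) (d : nat).
Local Notation Rd := 'rV[R]_d.
Local Notation nc := (@Normc.normc R).
Local Notation mu := (@lebT R d).
Local Notation row := (@row_of_tuple R d).
Local Notation Td := (d.-tuple (measurableTypeR R)).
Local Notation mu2 := (@lebT2 R d).
Variables v w : nat -> Rd -> R.
Hypotheses (hv : wseq v) (hw : wseq w).
Implicit Types (phi f g : Rd -> R[i]) (Phi : Td * Td -> R[i]).

(** Bounding both suprema by A, rather than their sum, keeps time and frequency
    symmetric; the norm is then at most 2 A. The integral transform replaces [hat],
    with which it agrees on these functions. *)
Definition stepball n (A : R) f := [/\ ccont f, forall x, nc (f x) * w n x <= A &
  forall xi, nc (fourier f xi) * v n xi <= A].

Section step_facts.
Variables (n : nat) (A : R) (f : Rd -> R[i]).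
Hypothesis Sf : stepball n A f.

Lemma stepball_ge0 : 0 <= A.
Proof.
have [_ H _] := Sf; apply: le_trans (H 0).
by rewrite mulr_ge0 ?nc_ge0// wseq_ge0.
Qed.

Lemma stepball_bound x : nc (f x) <= A.
Proof.
have [_ H _] := Sf; apply: le_trans (H x).
by rewrite ler_peMr ?nc_ge0// wseq_ge1.
Qed.

Lemma stepball_L1 : L1 mu (fun t => f (row t)).
Proof. by have [c H _] := Sf; exact (L1_wseq hw c H). Qed.

Lemma stepball_ccontF : ccont (fourier f).
Proof. exact: fourier_ccont stepball_L1. Qed.

Lemma stepball_L1F : L1 mu (fun t => fourier f (row t)).
Proof. by have [_ _ H] := Sf; exact (L1_wseq hv stepball_ccontF H). Qed.

End step_facts.

Lemma stepball_le n m A B f : (n <= m)%N -> A <= B -> stepball n A f -> stepball m B f.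
Proof.
move=> nm AB [c H1 H2]; split=> // x.
- apply: le_trans (le_trans (H1 x) AB); rewrite ler_wpM2l ?nc_ge0//.
  exact: wseq_dec.
- apply: le_trans (le_trans (H2 x) AB); rewrite ler_wpM2l ?nc_ge0//.
  exact: wseq_dec.
Qed.

Lemma fourier_shift f (eta a zeta : Rd) : L1 mu (fun t => f (row t)) ->
  fourier (fun t => ech (2 * pi * dotprod eta t) * f (t - a)) zeta =
  ech (2 * pi * dotprod (eta - zeta) a) * fourier f (zeta - eta).
Proof.
move=> Lf.
rewrite !fourierE.
have Lk : L1 mu (fun t => f (row t) * ech (- (2 * pi * dotprod (zeta - eta) (row t)))).
  have bE t : nc (ech (- (2 * pi * dotprod (zeta - eta) t))) <= 1 by rewrite nc_ech.
  apply: (bounded_L1_mul (g := fun t => ech (- (2 * pi * dotprod (zeta - eta) t))) Lf _ bE).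
  exact: ccont_charNr.
have := cint_affine (f := fun t => f t * ech (- (2 * pi * dotprod (zeta - eta) t)))
  (- a) (oner_neq0 R) Lk.
rewrite normr1 expr1n invr1 mul1r => <-; rewrite -cintZl; last first.
  by have := L1_affine (f := fun t => f t * ech (- (2 * pi * dotprod (zeta - eta) t)))
    (- a) (oner_neq0 R) Lk.
congr cint; apply/funext => t; rewrite scale1r mulrCA -!mulrA mulrC -!mulrA; congr (_ * _).
rewrite -!echD; congr ech.
by rewrite !dotprodDr !dotprodNr !dotprodDl !dotprodNl; ring.
Qed.

(** By M, a translation costs a change of step and a constant; a modulation
    translates the transform. *)
Lemma stepball_shift n A f (eta a : Rd) : stepball n A f -> exists m B,
  stepball m B (fun t => ech (2 * pi * dotprod eta t) * f (t - a)).
Proof.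
move=> Sf; have A0 := stepball_ge0 Sf; have [cf fw fv] := Sf.
have [l1 [C1 C10 H1]] := wseq_M hw n 0; have [l2 [C2 C20 H2]] := wseq_M hv n 0.
have cE : ccont (fun t : Rd => ech (2 * pi * dotprod eta t)).
  exact: ccont_charr.
have cs : ccont (fun t : Rd => f (t - a)).
  exact: ccont_comp cf (@continuous_shift R d a).
have Lf := stepball_L1 Sf.
have Fn := fun zeta => fourier_shift eta a zeta Lf.
exists (maxn l1 l2), (A * (C1 * w 0 a + C2 * v 0 eta)).
have pos1 : 0 <= C1 * w 0 a by rewrite mulr_ge0 ?(ltW C10)// wseq_ge0.
have pos2 : 0 <= C2 * v 0 eta by rewrite mulr_ge0 ?(ltW C20)// wseq_ge0.
split=> [|x|zeta].
- exact: ccontM.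
- rewrite ncM nc_ech mul1r; apply: (@le_trans _ _ (nc (f (x - a)) * (C1 * w n (x - a) * w 0 a))).
    rewrite ler_wpM2l ?nc_ge0//; apply: le_trans (wseq_dec hw x (leq_maxl l1 l2)) _.
    by have := H1 (x - a) a; rewrite subrK.
  rewrite (_ : _ * (_ * _ * _) = (nc (f (x - a)) * w n (x - a)) * (C1 * w 0 a)); last by ring.
  by apply: ler_pM; rewrite ?fw ?lerDl ?mulr_ge0 ?nc_ge0 ?wseq_ge0// ltW.
- rewrite Fn ncM nc_ech mul1r.
  apply: (@le_trans _ _ (nc (fourier f (zeta - eta)) * (C2 * v n (zeta - eta) * v 0 eta))).
    rewrite ler_wpM2l ?nc_ge0//; apply: le_trans (wseq_dec hv zeta (leq_maxr l1 l2)) _.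
    by have := H2 (zeta - eta) eta; rewrite subrK.
  rewrite (_ : _ * (_ * _ * _) = (nc (fourier f (zeta - eta)) * v n (zeta - eta)) * (C2 * v 0 eta)); last by ring.
  by apply: ler_pM; rewrite ?fv ?lerDr ?mulr_ge0 ?nc_ge0 ?wseq_ge0// ltW.
Qed.

Section window.
Variables (kap : nat) (G : R) (gam : Rd -> R[i]).
Hypothesis Sgam : stepball kap G gam.

Let cgam : ccont gam. Proof. by case: Sgam. Qed.
Let G0 : 0 <= G. Proof. exact: stepball_ge0 Sgam. Qed.

Definition synth_kernel t (p : Td * Td) : R[i] :=
  ech (2 * pi * dotprod (row p.2) t) * gam (t - row p.1).

Definition synth Phi t : R[i] := cint mu2 (fun p => Phi p * synth_kernel t p).

Definition coef_bound n (A : R) Phi := cmeas Phi /\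
  forall p, nc (Phi p) * (w n (row p.1) * v n (row p.2)) <= A.

Lemma coef_bound_ge0 n A Phi : coef_bound n A Phi -> 0 <= A.
Proof.
case=> _ H; apply: le_trans (H ([tuple 0 | _ < d], [tuple 0 | _ < d])).
by rewrite !mulr_ge0 ?nc_ge0// wseq_ge0.
Qed.

Lemma coef_boundE n A Phi p : coef_bound n A Phi ->
  nc (Phi p) <= A * ((w n (row p.1))^-1 * (v n (row p.2))^-1).
Proof.
by move=> [_ H]; rewrite -invfM ler_pdivlMr ?mulr_gt0 ?wseq_gt0.
Qed.

Let vrow1 : vmeas (fun p : Td * Td => row p.1).
Proof. exact: vmeas_comp (@vmeas_row R d) _. Qed.
Let vrow2 : vmeas (fun p : Td * Td => row p.2).
Proof. exact: vmeas_comp (@vmeas_row R d) _. Qed.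

Let cmeas_kernel t : cmeas (synth_kernel t).
Proof.
apply: cmeasM.
  apply: cmeas_ech; apply: measurable_funM; first exact: measurable_cst.
  apply: (measurable_continuous (F := fun y => dotprod y t)) => //.
  exact: continuous_dotprodl.
exact: (cmeas_cont (f := fun x => gam (t - x)) (ccont_reflect t cgam)).
Qed.

Lemma integrable_coef n A : mu2.-integrable setT
  (fun p => (A * ((w n (row p.1))^-1 * (v n (row p.2))^-1))%:E).
Proof.
by have := integrableZl measurableT A (integrable_prod (integrable_wseqV hw n) (integrable_wseqV hv n)).
Qed.

Lemma L1_coef n A Phi : coef_bound n A Phi -> L1 mu2 Phi.
Proof.
move=> H; apply: L1_dom (integrable_coef n A) _; first by case: H.
by move=> p; exact: coef_boundE.
Qed.

Let kernel_bound t p : nc (synth_kernel t p) <= G.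
Proof. by rewrite /synth_kernel ncM nc_ech mul1r; exact (stepball_bound Sgam _). Qed.

Lemma L1_synth n A Phi t : coef_bound n A Phi -> L1 mu2 (fun p => Phi p * synth_kernel t p).
Proof. by move=> /L1_coef LP; exact: L1_bnd LP (cmeas_kernel t) (kernel_bound t). Qed.

Lemma synthD n A m B Phi Psi t : coef_bound n A Phi -> coef_bound m B Psi ->
  synth (fun p => Phi p + Psi p) t = synth Phi t + synth Psi t.
Proof.
move=> HP HQ; rewrite /synth -(cintD (L1_synth t HP) (L1_synth t HQ)).
by congr cint; apply/funext => p; rewrite mulrDl.
Qed.

Lemma ccont_synth n A Phi : coef_bound n A Phi -> ccont (synth Phi).
Proof.
move=> H; have mP : cmeas Phi by case: H.
apply: (ccont_cint (g := fun p => G * (A * ((w n (row p.1))^-1 * (v n (row p.2))^-1)))).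
- by move=> t; exact: cmeasM.
- move=> p; apply: ccontM (ccont_cst _ _) _; apply: ccontM.
    exact: ccont_charr.
  exact: ccont_comp cgam (@continuous_shift R d (row p.1)).
- by have := integrableZl measurableT G (integrable_coef n A).
- move=> t p; rewrite ncM mulrC; apply: ler_pM; rewrite ?nc_ge0//.
  exact (coef_boundE p H).
Qed.

(** By N the quotient w_p / w_n is integrable for some p, and by M some w_m is
    controlled by w_p and the decay of the window. *)
Lemma kernel_decay n : exists m p C, [/\ 0 <= C,
  mu.-integrable setT (fun t => (w p (row t) / w n (row t))%:E) &
  forall t z, nc (synth_kernel t z) * w m t <= G * C * w p (row z.1)].
Proof.
have [p ip] := wseq_N hw n; have [m [C C0 HM]] := wseq_M hw p kap.
have [_ gw _] := Sgam.
exists m, p, C; split=> //; first exact: ltW.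
move=> t z; rewrite /synth_kernel ncM nc_ech mul1r.
have := HM (row z.1) (t - row z.1); rewrite addrC subrK => h.
apply: (@le_trans _ _ (nc (gam (t - row z.1)) * (C * w p (row z.1) * w kap (t - row z.1)))).
  by rewrite ler_wpM2l ?nc_ge0.
rewrite mulrCA -mulrA [leRHS]mulrC ler_wpM2l ?mulr_ge0 ?(ltW C0) ?wseq_ge0//.
Qed.

Lemma fourier_kernel_decay n : exists m p C, [/\ 0 <= C,
  mu.-integrable setT (fun t => (v p (row t) / v n (row t))%:E) &
  forall zeta z, nc (fourier (fun t => synth_kernel t z) zeta) * v m zeta <=
    G * C * v p (row z.2)].
Proof.
have [p ip] := wseq_N hv n; have [m [C C0 HM]] := wseq_M hv p kap.
have [_ _ gv] := Sgam.
exists m, p, C; split=> //; first exact: ltW.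
move=> zeta z; rewrite /synth_kernel (fourier_shift _ _ _ (stepball_L1 Sgam)).
rewrite ncM nc_ech mul1r.
have := HM (row z.2) (zeta - row z.2); rewrite addrC subrK => h.
apply: (@le_trans _ _ (nc (fourier gam (zeta - row z.2)) *
    (C * v p (row z.2) * v kap (zeta - row z.2)))).
  by rewrite ler_wpM2l ?nc_ge0.
rewrite mulrCA -mulrA [leRHS]mulrC ler_wpM2l ?mulr_ge0 ?(ltW C0) ?wseq_ge0//.
Qed.

Let L1_kernel z : L1 mu (fun t => synth_kernel (row t) z).
Proof.
have [m [B Sb]] := stepball_shift (row z.2) (row z.1) Sgam.
exact (stepball_L1 Sb).
Qed.

(** Fubini; the decay of the kernel yields integrability jointly with the variable t. *)
Lemma fourier_synth n A Phi zeta : coef_bound n A Phi ->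
  fourier (synth Phi) zeta =
  cint mu2 (fun p => Phi p * fourier (fun t => synth_kernel t p) zeta).
Proof.
move=> HP; have A0 := coef_bound_ge0 HP; have [mP _] := HP.
have [m [p [C [C0 ip Hk]]]] := kernel_decay n.
pose e t := ech (- (2 * pi * dotprod zeta (row t))).
have me : cmeas e.
  apply: cmeas_ech; apply: measurable_funN; apply: measurable_funM.
    exact: measurable_cst.
  exact: measurable_continuous (@continuous_dotprodr R d zeta) (@vmeas_row R d).
have e1 t : nc (e t) <= 1 by rewrite nc_ech.
pose k (z : Td * (Td * Td)) := Phi z.2 * synth_kernel (row z.1) z.2 * e z.1.
have i2 : mu2.-integrable setT
    (fun z => (w p (row z.1) / w n (row z.1) * (v n (row z.2))^-1)%:E).
  exact: integrable_prod ip (integrable_wseqV hv n).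
have i3 := integrable_prod (integrable_wseqV hw m) i2.
have mk : cmeas k.
  apply: cmeasM; last exact: (cmeas_comp (h := fst) me).
  apply: cmeasM; first exact: (cmeas_comp (h := snd) mP).
  have v1 : vmeas (fun z : Td * (Td * Td) => row z.1) by exact: vmeas_comp (@vmeas_row R d) _.
  have v2 : vmeas (fun z : Td * (Td * Td) => row z.2.1).
    by apply: (vmeas_comp (@vmeas_row R d)); exact: measurableT_comp.
  have v3 : vmeas (fun z : Td * (Td * Td) => row z.2.2).
    by apply: (vmeas_comp (@vmeas_row R d)); exact: measurableT_comp.
  apply: cmeasM.
    apply: cmeas_ech; apply: measurable_funM; first exact: measurable_cst.
    exact: measurable_dotprod.
  exact: (cmeas_cont cgam (vmeasB v1 v2)).
have Lk : L1 (mu \x mu2)%E k.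
  have i4 := integrableZl measurableT (A * G * C) i3.
  apply: (L1_dom (g := fun z => A * G * C * ((w m (row z.1))^-1 *
    (w p (row z.2.1) / w n (row z.2.1) * (v n (row z.2.2))^-1))) mk) => [|z].
    by move: i4; congr (integrable _ _); apply/funext => z; rewrite EFinM.
  have -> : nc (k z) = nc (Phi z.2) * nc (synth_kernel (row z.1) z.2).
    have ez : nc (e z.1) = 1 by rewrite /e nc_ech.
    by rewrite /k ncM ez mulr1 ncM.
  have h1 := coef_boundE z.2 HP.
  have h2 := Hk (row z.1) z.2; rewrite -ler_pdivlMr ?wseq_gt0// in h2.
  apply: le_trans (ler_pM (nc_ge0 _) (nc_ge0 _) h1 h2) _.
  by rewrite le_eqVlt; apply/orP; left; apply/eqP; ring.
have S1 t : L1 mu2 (fun z => k (t, z)).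
  have L := L1Zl (e t) (L1_synth (row t) HP).
  by move: L; congr L1; apply/funext => z; rewrite mulrC.
have S2 z : L1 mu (fun t => k (t, z)).
  have L : L1 mu (fun t => synth_kernel (row t) z * e t).
    exact: L1_bnd (L1_kernel z) me e1.
  by have := L1Zl (Phi z) L; congr L1; apply/funext => t; rewrite mulrA.
have := cint_fubini1 Lk S1; rewrite (cint_fubini2 Lk S2) => E.
rewrite fourierE; transitivity (cint mu (fun t => cint mu2 (fun z => k (t, z)))).
  congr cint; apply/funext => t; rewrite /synth -/(e t).
  by rewrite -(cintZr (e t) (L1_synth (row t) HP)).
rewrite -E; congr cint; apply/funext => z; rewrite fourierE -cintZl.
  by congr cint; apply/funext => t; rewrite mulrA.
exact: L1_bnd (L1_kernel z) me e1.
Qed.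

(** The bounds on the kernel are integrated against those on the coefficients; by N
    the resulting quotients of weights are integrable. *)
Lemma synth_stepball n : exists m K, 0 <= K /\
  forall Phi A, coef_bound n A Phi -> stepball m (K * A) (synth Phi).
Proof.
have [m1 [p1 [C1 [C10 ip1 Hk1]]]] := kernel_decay n.
have [m2 [p2 [C2 [C20 ip2 Hk2]]]] := fourier_kernel_decay n.
have i1 := integrable_prod ip1 (integrable_wseqV hv n).
have i2 := integrable_prod (integrable_wseqV hw n) ip2.
pose J1 := \int[mu2]_z (w p1 (row z.1) / w n (row z.1) * (v n (row z.2))^-1).
pose J2 := \int[mu2]_z ((w n (row z.1))^-1 * (v p2 (row z.2) / v n (row z.2))).
have J10 : 0 <= J1.
  by apply: Rintegral_ge0 => z _; rewrite mulr_ge0 ?divr_ge0 ?invr_ge0 ?wseq_ge0.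
have J20 : 0 <= J2.
  by apply: Rintegral_ge0 => z _; rewrite mulr_ge0 ?divr_ge0 ?invr_ge0 ?wseq_ge0.
exists (maxn m1 m2), (G * C1 * J1 + G * C2 * J2); split.
  by rewrite addr_ge0// !mulr_ge0.
move=> Phi A HP; have A0 := coef_bound_ge0 HP; have [mP _] := HP.
have B1 t : nc (synth Phi t) * w m1 t <= G * C1 * J1 * A.
  rewrite -ler_pdivlMr ?wseq_gt0//.
  apply: le_trans (le_nc_cint (g := fun z => (A * G * C1 / w m1 t) *
    (w p1 (row z.1) / w n (row z.1) * (v n (row z.2))^-1)) _ _ _) _.
  - exact: cmeasM.
  - by have := integrableZl measurableT (A * G * C1 / w m1 t) i1.
  - move=> z; rewrite ncM.
    have h1 := coef_boundE z HP.
    have h2 := Hk1 t z; rewrite -ler_pdivlMr ?wseq_gt0// in h2.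
    apply: le_trans (ler_pM (nc_ge0 _) (nc_ge0 _) h1 h2) _.
    by rewrite le_eqVlt; apply/orP; left; apply/eqP; ring.
  - by rewrite RintegralZl// -/J1 le_eqVlt; apply/orP; left; apply/eqP; ring.
have B2 zeta : nc (fourier (synth Phi) zeta) * v m2 zeta <= G * C2 * J2 * A.
  rewrite -ler_pdivlMr ?wseq_gt0// (fourier_synth zeta HP).
  apply: le_trans (le_nc_cint (g := fun z => (A * G * C2 / v m2 zeta) *
    ((w n (row z.1))^-1 * (v p2 (row z.2) / v n (row z.2)))) _ _ _) _.
  - apply: cmeasM mP _.
    have -> : (fun z => fourier (fun t => synth_kernel t z) zeta) =
      (fun z => ech (2 * pi * dotprod (row z.2 - zeta) (row z.1)) *
         fourier gam (zeta - row z.2)).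
      by apply/funext => z; rewrite (fourier_shift _ _ _ (stepball_L1 Sgam)).
    have vz : vmeas (fun _ : Td * Td => zeta) by exact: vmeas_cst.
    apply: cmeasM.
      apply: cmeas_ech; apply: measurable_funM; first exact: measurable_cst.
      by apply: measurable_dotprod => //; exact: vmeasB.
    exact: (cmeas_cont (stepball_ccontF Sgam) (vmeasB vz vrow2)).
  - by have := integrableZl measurableT (A * G * C2 / v m2 zeta) i2.
  - move=> z; rewrite ncM.
    have h1 := coef_boundE z HP.
    have h2 := Hk2 zeta z; rewrite -ler_pdivlMr ?wseq_gt0// in h2.
    apply: le_trans (ler_pM (nc_ge0 _) (nc_ge0 _) h1 h2) _.
    by rewrite le_eqVlt; apply/orP; left; apply/eqP; ring.
  - by rewrite RintegralZl// -/J2 le_eqVlt; apply/orP; left; apply/eqP; ring.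
split=> [|x|xi]; first exact: ccont_synth HP.
- apply: (@le_trans _ _ (nc (synth Phi x) * w m1 x)).
    by rewrite ler_wpM2l ?nc_ge0// wseq_dec// leq_maxl.
  by apply: le_trans (B1 x) _; rewrite ler_wpM2r// lerDl !mulr_ge0.
- apply: (@le_trans _ _ (nc (fourier (synth Phi) xi) * v m2 xi)).
    by rewrite ler_wpM2l ?nc_ge0// wseq_dec// leq_maxr.
  by apply: le_trans (B2 xi) _; rewrite ler_wpM2r// lerDr !mulr_ge0.
Qed.

End window.

End synthesis.

(** * Decay and reconstruction *)

Section convolution_estimates.
Variables (R : realType) (d : nat).
Local Notation Rd := 'rV[R]_d.
Local Notation nc := (@Normc.normc R).
Local Notation mu := (@lebT R d).
Local Notation row := (@row_of_tuple R d).
Variable w : nat -> Rd -> R.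
Hypothesis hw : wseq w.
Variables (kap : nat) (A : R) (g : Rd -> R[i]).
Hypotheses (cg : ccont g) (gA : forall x, nc (g x) * w kap x <= A).

Let gA' x : nc (g x) <= A.
Proof. by apply: le_trans (gA x); rewrite ler_peMr ?nc_ge0// wseq_ge1. Qed.

(** The window decays like 1/w_kap, and N provides kp for which w_kp / w_kap is
    integrable. The weight e at the point x is shared out between f, which takes wf,
    and the window, which takes w_kp. *)
Lemma conv_decay : exists kp I, 0 <= I /\ forall (f : Rd -> R[i]) x e (wf : Rd -> R) dl,
  L1 mu (fun t => f (row t)) -> (forall t, 0 <= wf t) ->
  (forall t, e <= wf t * w kp (x - t)) -> (forall t, nc (f t) * wf t <= dl) ->
  e * convn f g x <= dl * I.
Proof.
have [kp ikp] := wseq_N hw kap.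
pose h (s : Rd) := w kp s / w kap s.
have h0 s : 0 <= h s by rewrite divr_ge0// wseq_ge0.
have m1 : (-1 : R) != 0 by rewrite oppr_eq0 oner_eq0.
have A0 : 0 <= A by apply: le_trans (gA' 0); exact: nc_ge0.
pose J := \int[mu]_t h (row t).
exists kp, (A * J); split.
  by rewrite mulr_ge0//; apply: Rintegral_ge0 => t _; exact: h0.
move=> f x e wf dl Lf wf0 ew fw.
have dl0 : 0 <= dl by apply: le_trans (fw 0); rewrite mulr_ge0 ?nc_ge0.
have ic := convn_integrable x Lf cg gA'.
have ih := integrable_affine (g := h) x m1 ikp.
have Eh := Rintegral_affine (g := h) x m1 ikp.
rewrite normrN normr1 expr1n invr1 mul1r in Eh.
rewrite /convn mulrA /J -Eh -RintegralZl// -RintegralZl//.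
apply: le_Rintegral => //.
- by have := integrableZl measurableT e ic.
- by have := integrableZl measurableT (dl * A) ih.
move=> t _; have wk0 s : 0 < w kap s := wseq_gt0 hw kap s.
have -> : -1 *: row t + x = x - row t by rewrite scaleN1r addrC.
set s := x - row t.
apply: (@le_trans _ _ ((nc (f (row t)) * wf (row t)) * (nc (g s) * w kp s))).
  rewrite mulrCA -mulrA ler_wpM2l ?nc_ge0//.
  by rewrite mulrCA mulrC ler_wpM2l ?nc_ge0// ew.
rewrite -[leRHS]mulrA ler_pM ?mulr_ge0 ?nc_ge0 ?wf0 ?wseq_ge0//.
by rewrite /h mulrCA [leLHS]mulrC ler_wpM2l ?wseq_ge0// ler_pdivlMr.
Qed.

(** One infimum of weights controls the convolution against another one:
    Sq removes the square, M distributes the weight over the two factors. *)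
Lemma nachbin_control (D : nat -> R) : (forall k, 1 <= D k) ->
  exists B I, [/\ forall k, 1 <= B k, 0 <= I & forall (f : Rd -> R[i]) dl,
    L1 mu (fun t => f (row t)) -> (forall t, nc (f t) * infw w B t <= dl) ->
    forall x, infw (fun m y => w m y ^+ 2) D x * convn f g x <= dl * I].
Proof.
move=> D1; have [kp [I [I0 H]]] := conv_decay.
have w21 m x : 1 <= w m x ^+ 2 by rewrite exprn_ege1// wseq_ge1.
have /choice [B HB] k : exists B, 1 <= B /\
    forall x t, infw (fun m y => w m y ^+ 2) D x <= B * w k t * w kp (x - t).
  have [l [C C0 HM]] := wseq_M hw k kp; have [m [C' C'0 HS]] := wseq_Sq hw l.
  have pos : 0 <= D m * (C' * C) by rewrite !mulr_ge0 ?(ltW C0) ?(ltW C'0)// (le_trans _ (D1 m)).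
  exists (1 + D m * (C' * C)); split; first by rewrite lerDl.
  move=> x t; apply: le_trans (infw_le w21 D1 m x) _.
  apply: (@le_trans _ _ (D m * (C' * (C * w k t * w kp (x - t))))).
    rewrite ler_wpM2l ?(le_trans _ (D1 m))//; apply: le_trans (HS x) _.
    rewrite ler_wpM2l ?(ltW C'0)//.
    by have := HM t (x - t); rewrite addrC subrK.
  rewrite !mulrA -(mulrA (D m)) ler_wpM2r ?wseq_ge0// ler_wpM2r ?wseq_ge0//.
  by rewrite lerDr.
have B1 k : 1 <= B k by case: (HB k).
exists B, I; split=> // f dl Lf fw x.
apply: (H f x _ (infw w B)) => // t.
  by apply: le_trans (infw_ge1 (wseq_ge1 hw) B1 t).
rewrite -ler_pdivrMr ?wseq_gt0//; apply: le_infw => k.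
by rewrite ler_pdivrMr ?wseq_gt0//; case: (HB k).
Qed.

Lemma step_control n : exists l C, 0 <= C /\ forall (f : Rd -> R[i]) B,
  L1 mu (fun t => f (row t)) -> (forall t, nc (f t) * w n t <= B) ->
  forall x, w l x * convn f g x <= B * C.
Proof.
have [kp [I [I0 H]]] := conv_decay; have [l [C C0 HM]] := wseq_M hw n kp.
exists l, (C * I); split; first by rewrite mulr_ge0// ltW.
move=> f B Lf fw x; rewrite mulrA (mulrC B).
apply: (H f x _ (fun t => C * w n t)) => // t.
- by rewrite mulr_ge0 ?wseq_ge0 ?ltW.
- by have := HM t (x - t); rewrite addrC subrK.
- by rewrite mulrCA ler_wpM2l// ltW.
Qed.

End convolution_estimates.

Lemma cmeas_if d (T : measurableType d) (R : realType) (b : T -> bool) (f g : T -> R[i]) :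
  measurable_fun setT b -> cmeas f -> cmeas g -> cmeas (fun x => if b x then f x else g x).
Proof.
move=> mb [f1 f2] [g1 g2]; split.
  have := measurable_fun_ifT mb f1 g1; apply: eq_measurable_fun => x _.
  by case: (b x).
have := measurable_fun_ifT mb f2 g2; apply: eq_measurable_fun => x _.
by case: (b x).
Qed.

Section reconstruction.
Variables (R : realType) (d : nat).
Local Notation Rd := 'rV[R]_d.
Local Notation nc := (@Normc.normc R).
Local Notation mu := (@lebT R d).
Local Notation row := (@row_of_tuple R d).
Local Notation Td := (d.-tuple (measurableTypeR R)).
Local Notation mu2 := (@lebT2 R d).
Variables v w : nat -> Rd -> R.
Hypotheses (hv : wseq v) (hw : wseq w).
Variables (kap : nat) (A : R) (chi : Rd -> R[i]).
Hypothesis Schi : stepball v w kap A chi.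

Definition window_pairing (gam : Rd -> R[i]) : R[i] :=
  cint mu (fun s => conjc (chi (row s)) * gam (- row s)).

(** Some time-frequency shift of the window has a nonzero pairing with it, since
    these pairings are the values of a Fourier transform that does not vanish. *)
Lemma dual_window s0 : chi s0 <> 0 ->
  exists n G gam, stepball v w n G gam /\ window_pairing gam <> 0.
Proof.
move=> c0; apply: contrapT => N.
have [cchi _ _] := Schi.
pose H s := conjc (chi s) * chi (s0 *+ 2 - s).
have cH : ccont H by apply: ccontM; [exact: ccont_conj|exact: ccont_reflect].
have LH : L1 mu (fun s => H (row s)).
  apply: (bounded_L1_mul (f := fun s => conjc (chi s)) (g := fun s => chi (s0 *+ 2 - s))
    (L1_conj (stepball_L1 hw Schi)) (ccont_reflect _ cchi)).
  by move=> x; exact: (stepball_bound hw Schi).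
have HB s : nc (H s) <= A * A.
  by rewrite ncM ncJ ler_pM ?nc_ge0// (stepball_bound hw Schi).
have F0 eta : fourier H eta = 0.
  apply: contrapT => Fn0; apply: N.
  have [n [G Sg]] := stepball_shift hv hw eta (- (s0 *+ 2)) Schi.
  exists n, G; eexists; split; first exact: Sg.
  rewrite /window_pairing => E; apply: Fn0; rewrite fourierE -[RHS]E.
  congr cint; apply/funext => s; rewrite /H dotprodNr mulrN opprK (addrC (- row s)).
  by rewrite mulrCA mulrC.
have LF : L1 mu (fun s => fourier H (row s)).
  have -> : (fun s : Td => fourier H (row s)) = (fun s => 0 * H (row s)).
    by apply/funext => s; rewrite F0 mul0r.
  exact: L1Zl.
have := fourier_inversion cH HB LH LF s0.
have -> : (fun s : Td => fourier H (row s) * ech (2 * pi * dotprod (row s) s0)) =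
    (fun s => 0 * H (row s)).
  by apply/funext => s; rewrite F0 !mul0r.
rewrite (cintZl 0 LH) mul0r => /esym/eqP; rewrite mulf_eq0.
rewrite (negbTE (inversion_constant_neq0 R d)) /= /H mulr2n addrK mulf_eq0.
by rewrite fmorph_eq0 orbb => /eqP.
Qed.

(** Sq applied twice: the fourth powers absorb the square roots that appear in
    combining the two decay estimates. *)
Lemma stft_decay n : exists q C, 0 <= C /\ forall phi B, stepball v w n B phi ->
  (forall x xi, nc (stft phi chi x xi) <= B * C) /\
  (forall x xi, (nc (stft phi chi x xi) * (w q x * v q xi)) ^+ 4 <=
     (B * C) ^+ 2 * C * nc (stft phi chi x xi) ^+ 2).
Proof.
have [cchi chiw chiv] := Schi.
have [l1 [I1 [I10 H1]]] := step_control hw cchi chiw n.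
have [l2 [I2 [I20 H2]]] := step_control hv (stepball_ccontF hw Schi) chiv n.
have four (u : nat -> Rd -> R) (hu : wseq u) l : exists q, exists2 C, 0 <= C &
    forall x, u q x ^+ 4 <= C * u l x.
  have [m [C C0 HS]] := wseq_Sq hu l; have [q [C' C'0 HS']] := wseq_Sq hu m.
  exists q, (C' ^+ 2 * C); first by rewrite mulr_ge0 ?exprn_ge0// ltW.
  move=> x; apply: (@le_trans _ _ ((C' * u m x) ^+ 2)).
    rewrite -[4%N]/(2 * 2)%N exprM lerXn2r ?nnegrE ?exprn_ge0 ?mulr_ge0 ?(ltW C'0)//;
    by rewrite ?wseq_ge0// HS'.
  by rewrite exprMn -[leRHS]mulrA ler_wpM2l ?exprn_ge0 ?(ltW C'0).
have [q1 [E1 E10 HE1]] := four w hw l1; have [q2 [E2 E20 HE2]] := four v hv l2.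
pose c0 := nc (inversion_constant R d).
have c00 : 0 < c0 by apply: nc_gt0; exact/eqP/inversion_constant_neq0.
pose C := 1 + I1 + I2 / c0 + E1 * E2.
have t1 : 0 <= I2 / c0 by rewrite divr_ge0// ltW.
have t2 : 0 <= E1 * E2 by rewrite mulr_ge0.
have C0 : 0 <= C by rewrite !addr_ge0.
exists (maxn q1 q2), C; split=> // phi B Sphi.
have B0 := stepball_ge0 hw Sphi.
have [cphi phiw phiv] := Sphi.
have Lphi := stepball_L1 hw Sphi.
have b1 x xi : w l1 x * nc (stft phi chi x xi) <= B * C.
  apply: (@le_trans _ _ (w l1 x * convn phi chi x)).
    rewrite ler_wpM2l ?wseq_ge0//.
    exact: stft_le_conv Lphi cchi (stepball_bound hw Schi) x xi.
  apply: le_trans (H1 _ _ Lphi phiw x) _; rewrite ler_wpM2l//.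
  by rewrite /C; lra.
have b2 x xi : v l2 xi * nc (stft phi chi x xi) <= B * C.
  have LF := stepball_L1F hv hw Sphi.
  apply: (@le_trans _ _ (v l2 xi * (c0^-1 * convn (fourier phi) (fourier chi) xi))).
    rewrite ler_wpM2l ?wseq_ge0//.
    exact: (stft_le_conv_fourier Lphi cchi (stepball_bound hw Schi) (stepball_L1 hw Schi)
      (stepball_L1F hv hw Schi)).
  rewrite mulrCA; apply: (@le_trans _ _ (c0^-1 * (B * I2))).
    by rewrite ler_wpM2l ?invr_ge0 ?(ltW c00)//; exact: (H2 _ _ LF phiv).
  by rewrite mulrCA ler_wpM2l// mulrC /C; lra.
split=> x xi.
  by apply: le_trans (b1 x xi); rewrite ler_peMl ?nc_ge0// wseq_ge1.
set V := nc _; have V0 : 0 <= V := nc_ge0 _.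
have w4 : w (maxn q1 q2) x ^+ 4 <= E1 * w l1 x.
  apply: le_trans (HE1 x).
  by rewrite lerXn2r ?nnegrE ?wseq_ge0// wseq_dec// leq_maxl.
have v4 : v (maxn q1 q2) xi ^+ 4 <= E2 * v l2 xi.
  apply: le_trans (HE2 xi).
  by rewrite lerXn2r ?nnegrE ?wseq_ge0// wseq_dec// leq_maxr.
rewrite !exprMn.
apply: (@le_trans _ _ (V ^+ 4 * ((E1 * w l1 x) * (E2 * v l2 xi)))).
  by rewrite ler_wpM2l ?exprn_ge0// ler_pM ?exprn_ge0 ?wseq_ge0.
rewrite [leLHS](_ : _ = (E1 * E2) * ((w l1 x * V) * (v l2 xi * V)) * V ^+ 2); last by ring.
rewrite ler_wpM2r ?exprn_ge0// [leLHS]mulrC ler_pM ?mulr_ge0 ?wseq_ge0//.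
  by rewrite -exprMn expr2 ler_pM ?mulr_ge0 ?wseq_ge0 ?b1 ?b2.
by rewrite /C; lra.
Qed.

Section resynthesis.
Variables (m : nat) (G : R) (gam : Rd -> R[i]).
Hypothesis Sgam : stepball v w m G gam.

Definition stft_coef (phi : Rd -> R[i]) (p : Td * Td) : R[i] :=
  stft phi chi (row p.1) (row p.2).

Lemma cmeas_stft_coef n B phi : stepball v w n B phi -> cmeas (stft_coef phi).
Proof.
move=> Sphi; have [cchi _ _] := Schi.
have := cmeas_cont2 (ccont_stft (stepball_L1 hw Sphi) cchi (stepball_bound hw Schi))
  (vmeas_comp (@vmeas_row R d) (@measurable_fst _ _ Td Td))
  (vmeas_comp (@vmeas_row R d) (@measurable_snd _ _ Td Td)).
by [].
Qed.

(** At each x, integrating over the frequency inverts the Fourier transform of phi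
    times the window; integrating over x then leaves the pairing of the windows. *)
Lemma synth_stft n B phi q D t : stepball v w n B phi ->
  coef_bound v w q D (stft_coef phi) ->
  synth gam (stft_coef phi) t = inversion_constant R d * window_pairing gam * phi t.
Proof.
move=> Sphi HP; have [cchi chiw _] := Schi; have [cgam _ _] := Sgam.
have [cphi _ _] := Sphi; have Lphi := stepball_L1 hw Sphi.
have LS := L1_synth hv hw Sgam t HP.
have LV x : L1 mu (fun s => stft phi chi (row x) (row s)).
  have iV := integrableZl measurableT (D / w q (row x)) (integrable_wseqV hv q).
  apply: (L1_dom (g := fun s => D / w q (row x) * (v q (row s))^-1)) => //.
    have := cmeas_comp (h := fun s : Td => (x, s)) (cmeas_stft_coef Sphi).
    by apply; exact: measurable_pair1.
  move=> s; have := coef_boundE hv hw (x, s) HP.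
  by rewrite /stft_coef /= mulrA.
have LVe x : L1 mu (fun s => stft phi chi (row x) (row s) * ech (2 * pi * dotprod (row s) t)).
  have e1 (s : Td) : nc (ech (2 * pi * dotprod (row s) t)) <= 1 by rewrite nc_ech.
  apply: L1_bnd (LV x) _ e1.
  apply: cmeas_ech; apply: measurable_funM; first exact: measurable_cst.
  exact: (measurable_continuous (F := fun y => dotprod y t) (@continuous_dotprodl R d t)
    (@vmeas_row R d)).
have S1 x : L1 mu (fun s => stft_coef phi (x, s) * synth_kernel gam t (x, s)).
  have := L1Zl (gam (t - row x)) (LVe x); congr L1; apply/funext => s.
  by rewrite /stft_coef /synth_kernel /= mulrC mulrA.
rewrite /synth (cint_fubini1 (m1 := mu) (m2 := mu) LS S1).
pose h (s : Rd) := conjc (chi s) * gam (- s).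
have Lh : L1 mu (fun s => h (row s)).
  apply: (bounded_L1_mul (f := fun s => conjc (chi s)) (g := fun s => gam (- s)) (C := G)
    (L1_conj (stepball_L1 hw Schi))).
    by have := ccont_reflect 0 cgam; congr ccont; apply/funext => s; rewrite sub0r.
  by move=> x; exact: (stepball_bound hw Sgam).
have Lh' := L1_affine (f := h) (- t) (oner_neq0 R) Lh.
have Eh := cint_affine (f := h) (- t) (oner_neq0 R) Lh.
rewrite normr1 expr1n invr1 mul1r in Eh.
rewrite /window_pairing -Eh mulrAC -cintZl//.
congr cint; apply/funext => x.
transitivity (cint mu (fun s => stft phi chi (row x) (row s) *
   ech (2 * pi * dotprod (row s) t)) * gam (t - row x)).
  rewrite -cintZr//; congr cint; apply/funext => s.
  by rewrite /stft_coef /synth_kernel /= mulrA.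
rewrite (stft_inversion cphi Lphi cchi (stepball_bound hw Schi) t
  (stepball_bound hw Sphi) (LV x)).
by rewrite /h scale1r opprB !mulrA.
Qed.

End resynthesis.

End reconstruction.

(** * Decomposition into small elements of the steps *)

Section decomposition.
Variables (R : realType) (d : nat).
Local Notation Rd := 'rV[R]_d.
Local Notation nc := (@Normc.normc R).
Local Notation mu := (@lebT R d).
Local Notation row := (@row_of_tuple R d).
Local Notation Td := (d.-tuple (measurableTypeR R)).
Variables v w : nat -> Rd -> R.
Hypotheses (hv : wseq v) (hw : wseq w).

Lemma stepballZ n A c f : stepball v w n A f ->
  stepball v w n (nc c * A) (fun t => c * f t).
Proof.
move=> Sf; have [cf fw fv] := Sf; split.
- by apply: ccontM => //; exact: ccont_cst.
- by move=> x; rewrite ncM -mulrA ler_wpM2l ?nc_ge0.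
- move=> xi; rewrite (fourierZ c xi (stepball_L1 hw Sf)).
  by rewrite ncM -mulrA ler_wpM2l ?nc_ge0.
Qed.

Section pieces.
Variables (V : Td * Td -> R[i]) (C : nat -> R).
Hypothesis mV : cmeas V.
Hypothesis C1 : forall k, 1 <= C k.

Definition below k p : bool :=
  nc (V p) * C k * (w k (row p.1) * v k (row p.2)) < 1.

(** Removing the pieces one after the other makes them disjoint, so that they add up
    to V. *)
Fixpoint rest k : Td * Td -> R[i] :=
  if k is j.+1 then fun p => if below j p then 0 else rest j p else V.

Definition piece k : Td * Td -> R[i] := fun p => if below k p then rest k p else 0.

Lemma measurable_below k : measurable_fun setT (below k).
Proof.
apply: measurable_fun_ltr; last exact: measurable_cst.
apply: measurable_funM.
  by apply: measurable_funM; [exact: cmeas_nc|exact: measurable_cst].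
apply: measurable_funM.
  exact: (measurable_continuous (wseq_cont hw (n := k))
    (vmeas_comp (@vmeas_row R d) (@measurable_fst _ _ Td Td))).
exact: (measurable_continuous (wseq_cont hv (n := k))
    (vmeas_comp (@vmeas_row R d) (@measurable_snd _ _ Td Td))).
Qed.

Lemma cmeas_rest k : cmeas (rest k).
Proof.
by elim: k => //= k IH; apply: cmeas_if => //; exact: measurable_below.
Qed.

Lemma cmeas_piece k : cmeas (piece k).
Proof.
by apply: cmeas_if; [exact: measurable_below|exact: cmeas_rest|exact: cmeas_cst].
Qed.

Lemma rest_split k p : rest k p = piece k p + rest k.+1 p.
Proof. by rewrite /piece /=; case: ifP => _; rewrite ?addr0 ?add0r. Qed.

Lemma restP k p : rest k p = 0 \/ (rest k p = V p /\ forall j, (j < k)%N -> ~~ below j p).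
Proof.
elim: k => [|k [IH|[IH1 IH2]]] /=; first by right.
  by left; case: ifP.
case: ifPn => [_|nb]; first by left.
right; split=> // j; rewrite ltnS leq_eqVlt => /orP[/eqP -> //|]; exact: IH2.
Qed.

Lemma nc_rest_le k p : nc (rest k p) <= nc (V p).
Proof. by case: (restP k p) => [->|[-> _]] //; rewrite nc0 nc_ge0. Qed.

Lemma piece_bound k : coef_bound v w k (C k)^-1 (piece k).
Proof.
split; first exact: cmeas_piece.
have Ck : 0 < C k := lt_le_trans ltr01 (C1 k).
move=> p; rewrite /piece; case: ifPn => [b|_]; last by rewrite nc0 mul0r invr_ge0 ltW.
apply: (@le_trans _ _ (nc (V p) * (w k (row p.1) * v k (row p.2)))).
  by rewrite ler_wpM2r ?nc_rest_le// mulr_ge0 ?wseq_ge0.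
by rewrite -[leRHS]mul1r ler_pdivlMr// mulrAC ltW.
Qed.

End pieces.

Variables (kap : nat) (A0 : R) (chi : Rd -> R[i]).
Hypothesis Schi : stepball v w kap A0 chi.
Variables (kap' : nat) (G : R) (gam : Rd -> R[i]).
Hypothesis Sgam : stepball v w kap' G gam.
Hypothesis pairing_neq0 : window_pairing chi gam <> 0.

(** The constants C k and the weights are chosen before phi, since they define a
    seminorm; the number N of pieces depends on phi. The synthesis of the remainder is z 0, that
    of the k-th piece is z k.+1, rescaled so that phi becomes their convex combination. *)
Lemma decomposition (eps : nat -> R) : (forall m, 0 < eps m) ->
  exists Bv Bw dl, [/\ forall k, 1 <= Bv k, forall k, 1 <= Bw k, 0 < dl &
    forall n B phi, stepball v w n B phi ->
      (forall x, nc (phi x) * infw w Bw x <= dl) ->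
      (forall xi, nc (fourier phi xi) * infw v Bv xi <= dl) ->
    exists N (z : nat -> Rd -> R[i]),
      (forall k, exists m A, stepball v w m A (z k) /\ A < eps m) /\
      forall t, phi t = 2^-1 * z 0%N t + 2^-1 * \sum_(k < N) 2^-1 ^+ k.+1 * z k.+1 t].
Proof.
move=> eps0.
have [cchi chiw chiv] := Schi.
have /choice [m Hm] n : exists m K, 0 <= K /\
   forall Phi A, coef_bound v w n A Phi -> stepball v w m (K * A) (synth gam Phi).
  exact (synth_stepball hv hw Sgam n).
have /choice [K HK] := Hm.
have K0 n : 0 <= K n by case: (HK n).
pose c1 := inversion_constant R d * window_pairing chi gam.
have c1n0 : c1 <> 0.
  move=> /eqP; rewrite mulf_eq0 (negbTE (inversion_constant_neq0 R d)) /=.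
  by move=> /eqP.
pose a1 := nc c1; have a10 : 0 < a1 by exact: nc_gt0.
(* C k > a k makes the rescaled k-th piece smaller than eps (m k) *)
pose a k := 2 ^+ k.+2 / a1 * K k / eps (m k).
have a0 k : 0 <= a k.
  have e0 := ltW (eps0 (m k)); have a1' := ltW a10.
  by rewrite /a divr_ge0// mulr_ge0// divr_ge0// exprn_ge0.
pose C n := \sum_(k < n.+1) (1 + a k).
have Cmon i j : (i <= j)%N -> C i <= C j.
  move=> ij; rewrite /C (big_ord_widen j.+1 (fun k => 1 + a k))//.
  rewrite big_mkcond; apply: ler_sum => k _; case: ifP => // _.
  by rewrite addr_ge0.
have Ca n : 1 + a n <= C n.
  rewrite /C big_ord_recr /= lerDr; apply: sumr_ge0 => k _; exact: addr_ge0.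
have Cn n : n.+1%:R <= C n.
  rewrite /C; elim: n => [|n IH]; first by rewrite big_ord_recr big_ord0 /= add0r lerDl.
  by rewrite big_ord_recr /= -natr1 lerD// lerDl.
have C1 n : 1 <= C n by apply: le_trans (Ca n); rewrite lerDl.
have C0 n : 0 < C n := lt_le_trans ltr01 (C1 n).
have D1 k : 1 <= C k ^+ 2 by exact: exprn_ege1.
have [Bw [I1 [Bw1 I10 Hw]]] := nachbin_control hw cchi chiw D1.
have [Bv [I2 [Bv1 I20 Hv]]] := nachbin_control hv (stepball_ccontF hw Schi) chiv D1.
pose c0 := nc (inversion_constant R d).
have c00 : 0 < c0 by apply: nc_gt0; exact/eqP/inversion_constant_neq0.
have I20' : 0 <= I2 / c0 by rewrite divr_ge0// ltW.
pose dl := (1 + I1 + I2 / c0)^-1.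
have s0 : 0 < 1 + I1 + I2 / c0 by rewrite -addrA ltr_pwDl// addr_ge0.
have dl0 : 0 < dl by rewrite invr_gt0.
exists Bv, Bw, dl; split=> // n B phi Sphi phiw phiv.
have Lphi := stepball_L1 hw Sphi.
have B0 := stepball_ge0 hw Sphi.
pose V := stft_coef chi phi.
have mV : cmeas V := cmeas_stft_coef hw Schi Sphi.
have w21 (u : nat -> Rd -> R) (hu : wseq u) k x : 1 <= u k x ^+ 2.
  by rewrite exprn_ege1// wseq_ge1.
pose ew x := infw (fun m y => w m y ^+ 2) (fun k => C k ^+ 2) x.
pose ev x := infw (fun m y => v m y ^+ 2) (fun k => C k ^+ 2) x.
have ew1 x : 1 <= ew x by exact: infw_ge1 (w21 _ hw) D1 x.
have ev1 x : 1 <= ev x by exact: infw_ge1 (w21 _ hv) D1 x.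
have b1 p : ew (row p.1) * nc (V p) < 1.
  apply: (@le_lt_trans _ _ (dl * I1)).
    apply: le_trans (Hw _ _ Lphi phiw (row p.1)); rewrite ler_wpM2l ?(le_trans _ (ew1 _))//.
    exact: stft_le_conv Lphi cchi (stepball_bound hw Schi) _ _.
  by rewrite mulrC ltr_pdivrMr// mul1r; lra.
have b2 p : ev (row p.2) * nc (V p) < 1.
  apply: (@le_lt_trans _ _ (c0^-1 * (dl * I2))).
    apply: le_trans (_ : _ <= c0^-1 * (ev (row p.2) *
        convn (fourier phi) (fourier chi) (row p.2))) _.
      rewrite mulrCA ler_wpM2l ?(le_trans _ (ev1 _))//.
      exact: (stft_le_conv_fourier Lphi cchi (stepball_bound hw Schi) (stepball_L1 hw Schi)
        (stepball_L1F hv hw Schi) _ _ (stepball_L1F hv hw Sphi)).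
    rewrite ler_wpM2l ?invr_ge0 ?(ltW c00)//.
    exact: (Hv _ _ (stepball_L1F hv hw Sphi) phiv).
  rewrite mulrCA mulrC ltr_pdivrMr// mul1r.
  by rewrite mulrC; lra.
(* a strict bound on each infimum holds at some index, i or j; the product of the two
   bounds gives the claim at their maximum *)
have exb p : exists k, below V C k p.
  have [V0|V0] := eqVneq (nc (V p)) 0; first by exists 0%N; rewrite /below V0 !mul0r.
  have Vp : 0 < nc (V p) by rewrite lt_neqAle eq_sym V0 nc_ge0.
  have := b1 p; rewrite -ltr_pdivlMr// => /infw_lt[i Hi].
  have := b2 p; rewrite -ltr_pdivlMr// => /infw_lt[j Hj].
  rewrite ltr_pdivlMr// in Hi; rewrite ltr_pdivlMr// in Hj.
  exists (maxn i j); rewrite /below; set k := maxn i j.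
  set W := w k _ * v k _; have W0 : 0 <= W by rewrite mulr_ge0 ?wseq_ge0.
  have x0 : 0 <= nc (V p) * C k * W by rewrite mulr_ge0// mulr_ge0 ?nc_ge0 ?(ltW (C0 k)).
  rewrite -(@ltr_pXn2r _ 2)// ?nnegrE// expr1n.
  apply: le_lt_trans (_ : _ <= (C i ^+ 2 * w i (row p.1) ^+ 2 * nc (V p)) *
     (C j ^+ 2 * v j (row p.2) ^+ 2 * nc (V p))) _; last first.
    rewrite -[ltRHS]mulr1; apply: ltr_pM => //;
    by rewrite mulr_ge0 ?nc_ge0// mulr_ge0// exprn_ge0 ?wseq_ge0 ?(ltW (C0 _)).
  have CC : C k <= C i * C j.
    rewrite /k; case: (leqP i j) => ij.
      by rewrite ler_peMl ?(ltW (C0 j)).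
    by rewrite ler_peMr ?(ltW (C0 i)).
  have WW : W <= w i (row p.1) * v j (row p.2).
    rewrite ler_pM ?wseq_ge0//; first by rewrite wseq_dec// leq_maxl.
    by rewrite wseq_dec// leq_maxr.
  rewrite [leRHS](_ : _ = (nc (V p) * (C i * C j) * (w i (row p.1) * v j (row p.2))) ^+ 2);
    last by ring.
  rewrite lerXn2r ?nnegrE// ?mulr_ge0 ?nc_ge0 ?(ltW (C0 _)) ?wseq_ge0//.
  apply: ler_pM => //; first by rewrite mulr_ge0 ?nc_ge0 ?(ltW (C0 k)).
  by rewrite ler_wpM2l ?nc_ge0.
have [q [E [E0 HE]]] := stft_decay hv hw Schi n.
have [HE1 HE2] := HE _ _ Sphi.
pose M := (B * E) ^+ 2 * E.
have M0 : 0 <= M by rewrite mulr_ge0 ?exprn_ge0 ?mulr_ge0.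
pose eta := eps (m q) * a1 / (2 * (K q + 1)).
have Kq1 : 0 < K q + 1 by rewrite ltr_wpDl.
have eta0 : 0 < eta by rewrite divr_gt0 ?mulr_gt0.
(* [stft_decay] bounds the fourth power of the weighted remainder by M / C N, and
   C N is at least N + 1 *)
have [N HN] : exists N, M <= eta ^+ 4 * N.+1%:R.
  exists (Num.truncn (M / eta ^+ 4)).
  by rewrite mulrC -ler_pdivrMr ?exprn_gt0// ltW// truncnS_gt.
have Wq0 p : 0 <= w q (row p.1) * v q (row p.2) by rewrite mulr_ge0 ?wseq_ge0.
have qb k : coef_bound v w q (1 + M * (B * E) ^+ 2) (rest V C k).
  split; first exact: cmeas_rest.
  move=> p; apply: (@le_trans _ _ (nc (V p) * (w q (row p.1) * v q (row p.2)))).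
    by rewrite ler_wpM2r// nc_rest_le.
  set x := nc (V p) * _; have x0 : 0 <= x by rewrite mulr_ge0 ?nc_ge0.
  have x4 : x ^+ 4 <= M * (B * E) ^+ 2.
    apply: le_trans (HE2 _ _) _; rewrite ler_wpM2l//.
    by rewrite lerXn2r ?nnegrE ?nc_ge0 ?mulr_ge0// HE1.
  have [x1|x1] := lerP x 1; first by rewrite (le_trans x1)// lerDl mulr_ge0 ?exprn_ge0 ?mulr_ge0.
  apply: le_trans (_ : _ <= x ^+ 4) _; first by rewrite exprS ler_peMr// exprn_ege1// ltW.
  by rewrite (le_trans x4)// lerDr.
have tb : coef_bound v w q eta (rest V C N).
  split; first exact: cmeas_rest.
  move=> p; case: (restP V C N p) => [->|[-> Hb]].
    by rewrite nc0 mul0r ltW.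
  have [k bk] := exb p.
  have Nk : (N <= k)%N by rewrite leqNgt; apply/negP => /Hb; rewrite bk.
  have VC : nc (V p) <= (C N)^-1.
    rewrite -[leRHS]mul1r ler_pdivlMr//; apply: le_trans (ltW bk).
    apply: (@le_trans _ _ (nc (V p) * C k)); first by rewrite ler_wpM2l ?nc_ge0 ?Cmon.
    rewrite ler_peMr ?mulr_ge0 ?nc_ge0 ?(ltW (C0 k))//.
    by rewrite -[leLHS]mulr1 ler_pM ?wseq_ge1.
  rewrite -(@ler_pXn2r _ 4)// ?nnegrE ?(ltW eta0) ?(mulr_ge0 (nc_ge0 _) (Wq0 p))//.
  apply: le_trans (HE2 _ _) _; rewrite -/M.
  apply: (@le_trans _ _ (M * (C N)^-1)).
    rewrite ler_wpM2l//; apply: (@le_trans _ _ ((C N)^-1 ^+ 2)).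
      by rewrite lerXn2r ?nnegrE ?nc_ge0 ?invr_ge0 ?(ltW (C0 N)).
    by rewrite expr2 ler_piMr ?invr_ge0 ?(ltW (C0 N))// invf_le1.
  rewrite ler_pdivrMr//; apply: le_trans HN _.
  by rewrite ler_wpM2l ?exprn_ge0 ?(ltW eta0).
have Ssum k t :
    synth gam V t = \sum_(i < k) synth gam (piece V C i) t +
    synth gam (rest V C k) t.
  elim: k => [|k IH]; first by rewrite big_ord0 add0r.
  rewrite IH big_ord_recr /= -addrA; congr (_ + _).
  rewrite -(synthD hv hw Sgam t (piece_bound mV C1 k) (qb k.+1)).
  by congr synth; apply/funext => p; exact: rest_split.
pose z k : Rd -> R[i] := if k is j.+1 then fun t => (2 ^+ j.+2 / c1) * synth gam (piece V C j) t
  else fun t => (2 / c1) * synth gam (rest V C N) t.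
have nc2 j : nc (2 ^+ j) = 2 ^+ j.
  have -> : (2 ^+ j : R[i]) = (2 ^+ j)%:C by rewrite rmorphXn rmorph_nat.
  by rewrite ncR ger0_norm// exprn_ge0.
have c1n : c1 != 0 by exact/eqP.
have ncV : nc c1^-1 = a1^-1.
  apply: (mulfI (lt0r_neq0 a10)); rewrite (mulfV (lt0r_neq0 a10)) -ncM (mulfV c1n).
  exact: Normc.normc1.
exists N, z; split.
  case=> [|k].
    exists (m q), (nc (2 / c1) * (K q * eta)); split.
      by apply: stepballZ; exact: (HK q).2 _ _ tb.
    have := nc2 1%N; rewrite !expr1 => e2.
    rewrite ncM ncV e2 /eta.
    rewrite [ltLHS](_ : _ = eps (m q) * (K q / (K q + 1))); last first.
      by field; rewrite !gt_eqF.
    by rewrite gtr_pMr ?eps0// ltr_pdivrMr// mul1r ltrDl.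
  exists (m k), (nc (2 ^+ k.+2 / c1) * (K k * (C k)^-1)); split.
    by apply: stepballZ; exact: (HK k).2 _ _ (piece_bound mV C1 k).
  rewrite ncM ncV nc2 mulrA ltr_pdivrMr// -ltr_pdivrMl ?eps0// mulrC.
  by apply: lt_le_trans (Ca k); rewrite ltr_pwDl.
move=> t; have := synth_stft hv hw Schi Sgam t Sphi (qb 0%N).
rewrite -/V -/c1 (Ssum N) => E1.
apply: (mulfI c1n); rewrite -E1 mulrDr addrC; congr (_ + _).
  by rewrite /z; field.
rewrite !mulr_sumr; apply: eq_bigr => k _; rewrite /z [2 ^+ k.+2]exprS exprVn.
by field; rewrite c1n expf_neq0.
Qed.

End decomposition.

(** * Equality of the spaces *)

Section suprema.
Variables (R : realType) (d : nat).
Local Notation Rd := 'rV[R]_d.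
Local Notation nc := (@Normc.normc R).
Implicit Types (h : Rd -> R) (phi : Rd -> R[i]^o).

Definition supn h : \bar R := ereal_sup [set (h x)%:E | x in setT].

Lemma supn_ub h x : ((h x)%:E <= supn h)%E.
Proof. by apply: ereal_sup_ubound; exists x. Qed.

Lemma supn_le h (y : \bar R) : (forall x, ((h x)%:E <= y)%E) -> (supn h <= y)%E.
Proof. by move=> H; apply: ge_ereal_sup => _ [x _ <-]. Qed.

Lemma supn_ge0 h : (forall x, 0 <= h x) -> (0 <= supn h)%E.
Proof. by move=> h0; apply: le_trans (supn_ub h 0); rewrite lee_fin. Qed.

Lemma supn_lt h (e : R) : (supn h < e%:E)%E -> forall x, h x <= e.
Proof. by move=> H x; rewrite -lee_fin (le_trans (supn_ub h x))// ltW. Qed.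

Lemma supn_fin h : (supn h < +oo)%E -> exists C, forall x, h x <= C.
Proof.
case E: (supn h) => [r| |]// _; first by exists r => x; rewrite -lee_fin -E supn_ub.
by have := supn_ub h 0; rewrite E leeNy_eq.
Qed.

Lemma supnD h k : (forall x, 0 <= h x) -> (forall x, 0 <= k x) ->
  (supn (fun x => (h x + k x)%R) <= supn h + supn k)%E.
Proof. by move=> h0 k0; apply: supn_le => x; rewrite EFinD leeD ?supn_ub. Qed.

Lemma supn_mono h k : (forall x, h x <= k x) -> (supn h <= supn k)%E.
Proof.
by move=> hk; apply: supn_le => x; apply: le_trans (supn_ub k x); rewrite lee_fin.
Qed.

Lemma supnZ h c : 0 <= c -> (forall x, 0 <= h x) ->
  supn (fun x => c * h x) = (c%:E * supn h)%E.
Proof.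
move=> c0 h0; apply/eqP; rewrite eq_le; apply/andP; split.
  by apply: supn_le => x; rewrite EFinM lee_pmul ?lee_fin ?supn_ub.
have [->|cn0] := eqVneq c 0.
  by rewrite mul0e; apply: supn_ge0 => x; rewrite mul0r.
have cp : 0 < c by rewrite lt_neqAle eq_sym cn0.
rewrite muleC -lee_pdivlMr//; apply: supn_le => x.
rewrite lee_pdivlMr// -EFinM mulrC.
exact: (supn_ub (fun x => c * h x)).
Qed.

Section norms.
Variables v w : Rd -> R.
Hypotheses (v0 : forall x, 0 <= v x) (w0 : forall x, 0 <= w x).

Let p0 phi x : 0 <= nc (phi x) * w x. Proof. by rewrite mulr_ge0 ?nc_ge0. Qed.
Let q0 phi x : 0 <= nc (hat phi x) * v x. Proof. by rewrite mulr_ge0 ?nc_ge0. Qed.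

Lemma S_normE phi : S_norm v w phi =
  (supn (fun x => (nc (phi x) * w x)%R) + supn (fun x => (nc (hat phi x) * v x)%R))%E.
Proof. by []. Qed.

Lemma S_norm_lt phi (e : R) : (S_norm v w phi < e%:E)%E ->
  (forall x, nc (phi x) * w x <= e) /\ (forall x, nc (hat phi x) * v x <= e).
Proof.
rewrite S_normE => H; split; apply: supn_lt; apply: le_lt_trans H.
  by rewrite leeDl// supn_ge0.
by rewrite leeDr// supn_ge0.
Qed.

Lemma S_norm_fin phi : (S_norm v w phi < +oo)%E ->
  (exists C, forall x, nc (phi x) * w x <= C) /\
  (exists C, forall x, nc (hat phi x) * v x <= C).
Proof.
rewrite S_normE => H; split; apply: supn_fin; apply: le_lt_trans H.
  by rewrite leeDl// supn_ge0.
by rewrite leeDr// supn_ge0.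
Qed.

Lemma S_norm_le phi A B : (forall x, nc (phi x) * w x <= A) ->
  (forall x, nc (hat phi x) * v x <= B) -> (S_norm v w phi <= (A + B)%:E)%E.
Proof. by move=> H1 H2; rewrite S_normE EFinD leeD// supn_le// => x; rewrite lee_fin. Qed.

Lemma S_norm_ge0 phi : (0 <= S_norm v w phi)%E.
Proof. by rewrite S_normE adde_ge0// supn_ge0. Qed.

Lemma S_normD phi (psi : Rd -> R[i]^o) : hat (phi + psi) = hat phi + hat psi ->
  (S_norm v w (phi + psi)%R <= S_norm v w phi + S_norm v w psi)%E.
Proof.
move=> hE; rewrite !S_normE hE addeACA leeD//.
  apply: le_trans (supnD (p0 phi) (p0 psi)); apply: supn_mono => x.
  by rewrite -mulrDl ler_wpM2r// ncD.
apply: le_trans (supnD (q0 phi) (q0 psi)); apply: supn_mono => x.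
by rewrite -mulrDl ler_wpM2r// ncD.
Qed.

Lemma S_normZ phi (a : R[i]) : hat (a *: phi) = a *: hat phi ->
  S_norm v w (a *: phi) = ((nc a)%:E * S_norm v w phi)%E.
Proof.
move=> hE; rewrite !S_normE hE ge0_muleDr ?supn_ge0//.
rewrite -!supnZ ?nc_ge0//.
by congr (supn _ + supn _)%E; apply/funext => x; rewrite ncM mulrA.
Qed.

End norms.
End suprema.

Section steps_and_spaces.
Variables (R : realType) (d : nat).
Local Notation Rd := 'rV[R]_d.
Local Notation nc := (@Normc.normc R).
Local Notation mu := (@lebT R d).
Local Notation row := (@row_of_tuple R d).
Variables V W : {posnum R} -> Rd -> R.
Hypotheses (hV : weight_function_system V) (hW : weight_function_system W).
Hypotheses (hv : wseq (wnat V)) (hw : wseq (wnat W)).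
Local Notation ball := (stepball (wnat V) (wnat W)).
Implicit Types (phi psi : Rd -> R[i]^o).

Let V0 l x : 0 <= V l x.
Proof. by have [H _] := hV; have [_ h] := H l; exact: le_trans (h x). Qed.
Let W0 l x : 0 <= W l x.
Proof. by have [H _] := hW; have [_ h] := H l; exact: le_trans (h x). Qed.

(** The value of [hat] is chosen among the transforms of phi, and N makes phi
    integrable. *)
Lemma hat_fourier phi n C : (exists g, is_fourier phi g) ->
  (forall x, nc (phi x) * wnat W n x <= C) -> hat phi = fourier phi.
Proof.
move=> [g Hg] HC.
have cphi : ccont phi by apply/ccontP; case: Hg => T [_ []].
apply: (is_fourier_unique cphi (L1_wseq hw cphi HC)).
by rewrite /hat; case: xgetP => [h -> //|/(_ g)]; rewrite /= => H; case: H.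
Qed.

Lemma stepball_is_fourier n A phi : ball n A phi -> is_fourier phi (fourier phi).
Proof. by move=> Sphi; have [c _ _] := Sphi; exact: is_fourier_fourier c (stepball_L1 hw Sphi). Qed.

Lemma stepball_hat n A phi : ball n A phi -> hat phi = fourier phi.
Proof.
move=> Sphi; have [_ H _] := Sphi; apply: hat_fourier H.
by exists (fourier phi); exact: stepball_is_fourier Sphi.
Qed.

Lemma stepball_S_norm n A phi : ball n A phi ->
  (S_norm (V (nat_pos R n)) (W (nat_pos R n)) phi <= (A + A)%:E)%E.
Proof.
move=> Sphi; have [_ H1 H2] := Sphi; apply: S_norm_le => // x.
by rewrite (stepball_hat Sphi).
Qed.

Lemma stepball_S_space n A phi : ball n A phi ->
  S_space (V (nat_pos R n)) (W (nat_pos R n)) phi.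
Proof.
move=> Sphi; split; first by exists (fourier phi); exact: stepball_is_fourier Sphi.
exact: le_lt_trans (stepball_S_norm Sphi) (ltry _).
Qed.

Lemma bounds_stepball phi n1 C1 n2 C2 : (exists g, is_fourier phi g) ->
  (forall x, nc (phi x) * wnat W n1 x <= C1) ->
  (forall x, nc (hat phi x) * wnat V n2 x <= C2) -> exists n A, ball n A phi.
Proof.
move=> ef H1 H2; exists (maxn n1 n2), (Num.max C1 C2).
have cphi : ccont phi by apply/ccontP; case: ef => g [T [_ []]].
split=> // x.
  apply: le_trans (_ : _ <= C1) _; last by rewrite le_max lexx.
  by apply: le_trans (H1 x); rewrite ler_wpM2l ?nc_ge0// (wseq_dec hw)// leq_maxl.
rewrite -(hat_fourier ef H1); apply: le_trans (_ : _ <= C2) _; last by rewrite le_max lexx orbT.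
by apply: le_trans (H2 x); rewrite ler_wpM2l ?nc_ge0// (wseq_dec hv)// leq_maxr.
Qed.

Lemma S_space_stepball l phi : S_space (V l) (W l) phi -> exists n A, ball n A phi.
Proof.
move=> [ef fin]; have [[C1 H1] [C2 H2]] := S_norm_fin (V0 l) (W0 l) fin.
have [n1 Hn1] := wnat_cofinal l hW; have [n2 Hn2] := wnat_cofinal l hV.
apply: (bounds_stepball (n1 := n1) (C1 := C1) (n2 := n2) (C2 := C2) ef) => x.
  by apply: le_trans (H1 x); rewrite ler_wpM2l ?nc_ge0.
by apply: le_trans (H2 x); rewrite ler_wpM2l ?nc_ge0.
Qed.

Lemma S_indP phi : S_ind V W phi <-> exists n A, ball n A phi.
Proof.
split; first by move=> [l _]; exact: S_space_stepball.
by move=> [n [A H]]; exists (nat_pos R n) => //; exact: stepball_S_space H.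
Qed.

Lemma nachbin_le (U : {posnum R} -> Rd -> R) u l : (forall x, 0 < U l x) -> nachbin U u ->
  exists2 c, 0 <= c & forall x, u x <= c * U l x.
Proof.
move=> U0 [u0 _ /(_ l)[c Hc]]; exists c.
  by apply: le_trans (Hc _ (ex_intro2 _ _ 0 I erefl)); rewrite divr_ge0// ltW.
by move=> x; rewrite -ler_pdivrMr//; apply: Hc; exists x.
Qed.

(** The weights of the Nachbin family are dominated by each member of the system.
    Conversely, [nachbin_bounded] applies to phi and to its transform separately,
    since the zero function is a member of the Nachbin family. *)
Lemma S_ind_proj : S_ind V W = S_proj V W.
Proof.
have W1 l x : 0 < W l x.
  by have [H _] := hW; have [_ h] := H l; exact: lt_le_trans (h x).
have V1 l x : 0 < V l x.
  by have [H _] := hV; have [_ h] := H l; exact: lt_le_trans (h x).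
apply/seteqP; split=> phi.
  move/S_indP => [n [A Sphi]]; have [cphi H1 H2] := Sphi.
  split; first exact/ccontP.
  move=> v w Nv Nw; split; first by exists (fourier phi); exact: stepball_is_fourier Sphi.
  have [a a0 Ha] := nachbin_le (V1 (nat_pos R n)) Nv.
  have [b b0 Hb] := nachbin_le (W1 (nat_pos R n)) Nw.
  have [v0 _ _] := Nv; have [w0 _ _] := Nw.
  apply: le_lt_trans (ltry (b * A + a * A)); apply: S_norm_le => // x.
    apply: le_trans (_ : _ <= nc (phi x) * (b * W (nat_pos R n) x)) _.
      by rewrite ler_wpM2l ?nc_ge0.
    by rewrite mulrCA ler_wpM2l.
  rewrite (stepball_hat Sphi).
  apply: le_trans (_ : _ <= nc (fourier phi x) * (a * V (nat_pos R n) x)) _.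
    by rewrite ler_wpM2l ?nc_ge0.
  by rewrite mulrCA ler_wpM2l.
move=> [cphi H]; apply/S_indP.
have N0 (U : {posnum R} -> Rd -> R) : nachbin U (fun=> 0).
  split=> [x|x a a0|l]; [exact: lexx|by apply: filterE|].
  by exists 0 => _ [x _ <-]; rewrite mul0r.
have ef : exists g, is_fourier phi g by case: (H _ _ (N0 V) (N0 W)).
have [n1 [C1 H1]] := @nachbin_bounded _ _ W (fun x => nc (phi x)) hW hw
  (fun x => nc_ge0 _) (fun w Nw => (S_norm_fin (fun=> lexx 0)
    (let: And3 w0 _ _ := Nw in w0) (H _ _ (N0 V) Nw).2).1).
have [n2 [C2 H2]] := @nachbin_bounded _ _ V (fun x => nc (hat phi x)) hV hv
  (fun x => nc_ge0 _) (fun v Nv => (S_norm_fin (let: And3 v0 _ _ := Nv in v0)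
    (fun=> lexx 0) (H _ _ Nv (N0 W)).2).2).
exact: bounds_stepball ef H1 H2.
Qed.

Lemma stepballD n A m B phi psi : ball n A phi -> ball m B psi ->
  ball (maxn n m) (A + B) (phi + psi).
Proof.
move=> S1 S2.
have [c1 w1 v1] := stepball_le hv hw (leq_maxl n m) (lexx A) S1.
have [c2 w2 v2] := stepball_le hv hw (leq_maxr n m) (lexx B) S2.
split; first exact: ccontD.
- move=> x; apply: le_trans (_ : _ <= (nc (phi x) + nc (psi x)) * wnat W (maxn n m) x) _.
    by rewrite ler_wpM2r ?(wseq_ge0 hw)// ncD.
  by rewrite mulrDl lerD.
- move=> x; rewrite (fourierD x (stepball_L1 hw S1) (stepball_L1 hw S2)).
  apply: le_trans (_ : _ <= (nc (fourier phi x) + nc (fourier psi x)) * wnat V (maxn n m) x) _.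
    by rewrite ler_wpM2r ?(wseq_ge0 hv)// ncD.
  by rewrite mulrDl lerD.
Qed.

Lemma stepball0 : ball 0 0 (0 : Rd -> R[i]^o).
Proof.
have c0 : ccont (0 : Rd -> R[i]) by exact: ccont_cst.
have w0 (x : Rd) : nc ((0 : Rd -> R[i]) x) * wnat W 0 x <= 0.
  by rewrite (_ : (0 : Rd -> R[i]) x = 0)// nc0 mul0r.
have L0 := L1_wseq hw c0 w0.
split=> // xi; have := fourierZ 0 xi L0.
have -> : (fun x : Rd => 0 * (0 : Rd -> R[i]) x) = 0 by apply/funext => x; rewrite mul0r.
by move=> ->; rewrite mul0r nc0 mul0r.
Qed.

Lemma S_ind0 : S_ind V W 0.
Proof. by apply/S_indP; exists 0%N, 0; exact: stepball0. Qed.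

Lemma S_ind_linear (a : R[i]) phi psi : S_ind V W phi -> S_ind V W psi ->
  S_ind V W (a *: phi + psi).
Proof.
move=> /S_indP[n [A S1]] /S_indP[m [B S2]]; apply/S_indP.
by eexists; eexists; exact: stepballD (stepballZ hw a S1) S2.
Qed.

Lemma hatD phi psi : S_ind V W phi -> S_ind V W psi -> hat (phi + psi) = hat phi + hat psi.
Proof.
move=> /S_indP[n [A S1]] /S_indP[m [B S2]].
rewrite (stepball_hat (stepballD S1 S2)) (stepball_hat S1) (stepball_hat S2); apply/funext => x.
exact: fourierD (stepball_L1 hw S1) (stepball_L1 hw S2).
Qed.

Lemma hatZ a phi : S_ind V W phi -> hat (a *: phi) = a *: hat phi.
Proof.
move=> /S_indP[n [A S1]]; rewrite (stepball_hat (stepballZ hw a S1)) (stepball_hat S1).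
by apply/funext => x; exact: fourierZ (stepball_L1 hw S1).
Qed.

End steps_and_spaces.

(** * Equality of the topologies *)

Section topologies.
Variables (R : realType) (d : nat).
Local Notation Rd := 'rV[R]_d.
Local Notation nc := (@Normc.normc R).
Variables V W : {posnum R} -> Rd -> R.
Hypotheses (hV : weight_function_system V) (hW : weight_function_system W).
Hypotheses (hv : wseq (wnat V)) (hw : wseq (wnat W)).
Local Notation ball := (stepball (wnat V) (wnat W)).
Local Notation Fun := (Rd -> R[i]^o).
Implicit Types (phi psi : Fun) (C : set Fun).

Let V1 l x : 0 < V l x.
Proof. by have [H _] := hV; have [_ h] := H l; exact: lt_le_trans (h x). Qed.
Let W1 l x : 0 < W l x.
Proof. by have [H _] := hW; have [_ h] := H l; exact: lt_le_trans (h x). Qed.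

(** The sum is the midpoint of its first point and of the same kind of sum over the
    others; the missing mass sits at the origin. *)
Lemma convex_series C : C 0 -> (forall (t : R) y z, 0 <= t <= 1 -> C y -> C z ->
    C (t%:C *: y + (1 - t)%:C *: z)) ->
  forall N (z : nat -> Fun), (forall k, C (z k)) ->
  C (fun t => \sum_(k < N) 2^-1 ^+ k.+1 * z k t).
Proof.
move=> C0 Cc; elim=> [|N IH] z Cz.
  by rewrite (_ : (fun t => _) = 0)//; apply/funext => t; rewrite big_ord0.
have h01 : 0 <= (2^-1 : R) <= 1 by rewrite invr_ge0 ler0n /= invf_le1// ler1n.
have := Cc _ _ _ h01 (Cz 0%N) (IH _ (fun k => Cz k.+1)).
congr C; apply/funext => t.
have h2 : (2^-1 : R)%:C = 2^-1 by rewrite fmorphV rmorph_nat.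
have h3 : (1 - 2^-1 : R)%:C = 2^-1 by rewrite -h2; congr (_%:C); field.
rewrite big_ord_recl expr1 h3 h2 -[LHS]/(2^-1 * _ + 2^-1 * _) mulr_sumr.
by congr (_ + _); apply: eq_bigr => k _; rewrite mulrA -exprS.
Qed.

Lemma fine_leD (a b c : \bar R) : a \is a fin_num -> b \is a fin_num ->
  c \is a fin_num -> (a <= b + c)%E -> fine a <= fine b + fine c.
Proof. by case: a => // a _; case: b => // b _; case: c => // c _; rewrite -EFinD lee_fin. Qed.

Lemma proj_topology_lc : lc_topology (S_ind V W) (S_proj_topology V W).
Proof.
rewrite /S_proj_topology -(S_ind_proj hV hW hv hw).
apply: seminorm_topology_lc.
- exact: S_ind0.
- by move=> a x y; exact: S_ind_linear.
move=> _ [v [w [Nv Nw ->]]]; exists (fun phi => fine (S_norm v w phi)).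
have [v0 _ _] := Nv; have [w0 _ _] := Nw.
have fin phi : S_ind V W phi -> S_norm v w phi \is a fin_num.
  rewrite (S_ind_proj hV hW hv hw) => -[_ H]; have [_ h] := H _ _ Nv Nw.
  by rewrite ge0_fin_numE// S_norm_ge0.
split=> [phi Ephi|phi psi E1 E2|a phi E1].
- by rewrite fineK// fin.
- have E3 : S_ind V W (phi + psi).
    by have := S_ind_linear hV hW hv hw 1 E1 E2; rewrite scale1r.
  apply: (fine_leD (fin _ E3) (fin _ E1) (fin _ E2)).
  exact: (S_normD v0 w0 (hatD hV hW hv hw E1 E2)).
- have -> : S_norm v w (a *: phi) = ((nc a)%:E * S_norm v w phi)%E.
    by apply: S_normZ => //; exact: (hatZ hV hW).
  by rewrite fineM// fin.
Qed.

(** On a step the norm dominates every seminorm of the projective description. *)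
Lemma proj_topology_step l U : S_proj_topology V W U ->
  S_topology (V l) (W l) (S_space (V l) (W l) `&` U).
Proof.
move=> [UE oU]; split; first by move=> phi [].
move=> x [Fx Ux]; have [n [p [e [Pp e0 Hp]]]] := oU _ Ux.
have /choice [c Hc] i : exists c, 0 <= c /\ forall phi e', 0 <= e' ->
    (S_norm (V l) (W l) phi < e'%:E)%E -> (p i phi <= (c * e')%:E)%E.
  have [v [w [Nv Nw ->]]] := Pp i.
  have [a a0 Ha] := nachbin_le (V1 l) Nv; have [b b0 Hb] := nachbin_le (W1 l) Nw.
  exists (b + a); split; first exact: addr_ge0.
  move=> phi e' e'0 Hphi.
  have [H1 H2] := S_norm_lt (fun x => ltW (V1 l x)) (fun x => ltW (W1 l x)) Hphi.
  rewrite mulrDl; apply: S_norm_le => y.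
    apply: le_trans (_ : _ <= nc (phi y) * (b * W l y)) _.
      by rewrite ler_wpM2l ?nc_ge0.
    by rewrite mulrCA ler_wpM2l.
  apply: le_trans (_ : _ <= nc (hat phi y) * (a * V l y)) _.
    by rewrite ler_wpM2l ?nc_ge0.
  by rewrite mulrCA ler_wpM2l.
pose s := 1 + \sum_i c i.
have s0 : 0 < s by rewrite ltr_pwDl// sumr_ge0// => i _; case: (Hc i).
have es0 : 0 < e / s by rewrite divr_gt0.
exists 1%N, (fun=> S_norm (V l) (W l)), (e / s); split=> //.
move=> y Fy /(_ ord0) hy; split=> //.
apply: Hp => [|i].
  by rewrite -(S_ind_proj hV hW hv hw); exists l.
apply: le_lt_trans ((Hc i).2 _ _ (ltW es0) hy) _; rewrite lte_fin.
rewrite mulrCA gtr_pMr// ltr_pdivrMr// mul1r /s (bigD1 i)//= addrCA ltrDl.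
by rewrite ltr_pwDl// sumr_ge0// => j _; case: (Hc j).
Qed.

Lemma lc_topology_sub (X : lmodType R[i]) (E : set X) tau U :
  lc_topology E tau -> tau U -> U `<=` E.
Proof. by case=> T [f [_ <- ->]] [Q _ <-] _ [y _ <-]; exists y. Qed.

(** The radii eps m of balls of the steps inside a convex neighbourhood are fed into
    [decomposition], which returns the weights of a seminorm. *)
Lemma ind_open_proj tau U : lc_topology (S_ind V W) tau ->
  (forall l U', tau U' -> S_topology (V l) (W l) (S_space (V l) (W l) `&` U')) ->
  tau U -> S_proj_topology V W U.
Proof.
move=> lct ct tU; rewrite /S_proj_topology -(S_ind_proj hV hW hv hw).
have UE := lc_topology_sub lct tU.
split=> // x Ux; have Ex := UE _ Ux.
have [C [tC C0 CU Cc]] := lc_topology_convex_nbhs lct tU Ux.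
have /choice [eps Heps] m : exists e, 0 < e /\ forall phi A, ball m A phi -> A < e -> C phi.
  have [_ /(_ 0)] := ct (nat_pos R m) _ tC.
  have F0 : S_space (V (nat_pos R m)) (W (nat_pos R m)) 0.
    apply: (stepball_S_space hw (n := m) (A := 0)).
    have b0 := stepball0 V hw.
    exact (stepball_le hv hw (leq0n m) (lexx 0) b0).
  move=> /(_ (conj F0 C0)) [n [p [e [Pp e0 Hp]]]].
  exists (e / 2); split; first by rewrite divr_gt0.
  move=> phi A Sphi Ae.
  have [] : (S_space (V (nat_pos R m)) (W (nat_pos R m)) `&` C) phi; last by [].
  apply: Hp; first exact: stepball_S_space Sphi.
  move=> i; rewrite (Pp i) subr0; apply: le_lt_trans (stepball_S_norm hw Sphi) _.
  by rewrite lte_fin; lra.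
have eps0 m : 0 < eps m by case: (Heps m).
have [[n [A [chi [s0 [Schi chi0]]]]]|triv] :=
    pselect (exists n A (chi : Fun) s0, ball n A chi /\ chi s0 <> 0); last first.
  (* without a nonzero window the space is zero *)
  have z phi : S_ind V W phi -> phi = 0.
    move=> /(S_indP hV hW hv hw) [n [A S]]; apply/funext => s; apply: contrapT => H.
    by apply: triv; exists n, A, phi, s.
  exists 0%N, (fun=> S_norm (fun=> 0) (fun=> 0)), 1; split=> // [[]//|y Ey _].
  by rewrite (z y Ey) -(z x Ex).
have [n' [G [gam [Sgam pair0]]]] := dual_window hv hw Schi chi0.
have [Bv [Bw [dl [Bv1 Bw1 dl0 Hdec]]]] := decomposition hv hw Schi Sgam pair0 eps0.
have Nv := nachbin_infw hV Bv1 hv; have Nw := nachbin_infw hW Bw1 hw.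
have [v0 _ _] := Nv; have [w0 _ _] := Nw.
exists 1%N, (fun=> S_norm (infw (wnat V) Bv) (infw (wnat W) Bw)), dl; split=> //.
  by move=> _; eexists; eexists; split; [exact: Nv|exact: Nw|].
move=> y Ey /(_ ord0) hy.
have /(S_indP hV hW hv hw) [m [B Sm]] : S_ind V W (y - x).
  have := S_ind_linear hV hW hv hw (-1) Ex Ey.
  by rewrite scaleN1r addrC.
have [H1 H2] := S_norm_lt v0 w0 hy; rewrite (stepball_hat hw Sm) in H2.
have [N [z [Hz E]]] := Hdec _ _ _ Sm H1 H2.
have Cz k : C (z k).
  by have [m' [A' [S' lt']]] := Hz k; have [_ H] := Heps m'; exact: H S' lt'.
have Cs := convex_series C0 Cc N (fun k => Cz k.+1).
have h01 : 0 <= (2^-1 : R) <= 1 by rewrite invr_ge0 ler0n /= invf_le1// ler1n.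
have := CU _ (Cc _ _ _ h01 (Cz 0%N) Cs); congr U.
have h2 : (2^-1 : R)%:C = 2^-1 by rewrite fmorphV rmorph_nat.
have h3 : (1 - 2^-1 : R)%:C = 2^-1 by rewrite -h2; congr (_%:C); field.
rewrite h3 h2; apply/funext => t.
by have := E t; rewrite -[(y - x) t]/(y t - x t) => /(canRL (subrK _)) ->; rewrite addrC.
Qed.

End topologies.

Local Close Scope complex_scope.
Local Close Scope classical_set_scope.

Theorem theorem4p7 (R : realType) (d : nat) (V W : {posnum R} -> 'rV[R]_d -> R)
    (hV : weight_function_system V) (hW : weight_function_system W)
    (hVM : condM V) (hVSq : condSq V) (hVN : condN V)
    (hWM : condM W) (hWSq : condSq W) (hWN : condN W) :
  S_ind V W = S_proj V W /\ S_ind_topology V W = S_proj_topology V W.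
Proof.
have hv := wseq_system hV hVM hVSq hVN; have hw := wseq_system hW hWM hWSq hWN.
split; first exact: S_ind_proj.
apply/seteqP; split=> U.
  move=> [tau [lct ct tU]]; exact: (ind_open_proj hV hW hv hw lct ct tU).
move=> pU; exists (S_proj_topology V W); split=> //.
  exact: (proj_topology_lc hV hW hv hw).
by move=> l U' pU'; exact: (proj_topology_step hV hW hv hw).
Qed.
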